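(* Let $(X,\lambda)$ and $(X',\lambda')$ be weighted polyhedra of the same type and let $f:(X,\lambda)\to(X',\lambda')$ be an isomorphism, i.e. a homeomorphism $f:X\to X'$ with $\lambda'(f(x))=\lambda(x)$ for all $x\in X$. Let $(K,\xi)$ and $(K',\xi')$ be divisibly weighted triangulations of $(X,\lambda)$ and $(X',\lambda')$, respectively, and let $\widehat{\xi},\widehat{\xi'}$ be the inversions of $\xi,\xi'$. Then the induced homomorphisms $f_*:H_*(K,\partial^{\xi})\to H_*(K',\partial^{\xi'})$ and $\widehat{f}_*:H_*(K,\partial^{\widehat{\xi}})\to H_*(K',\partial^{\widehat{\xi'}})$ are both isomorphisms.
   Context: Conventions: simplicial complexes are finite, weighted polyhedra are compact, homology has integer coefficients. Weighted complexes. An ascending weight on a simplicial complex $K$ is a function $\mu$ from the simplices of $K$ to the positive integers with $\mu(\sigma')\mid\mu(\sigma)$ whenever $\sigma'$ is a face of $\sigma$; a descending weight satisfies instead $\mu(\sigma)\mid\mu(\sigma')$. A weighted simplicial complex $(K,\mu)$ has a weight of one of these two types. On the oriented simplicial chain groups $C_n(K)$ put $\partial^{\mu}\sigma=\sum_{j=0}^n(-1)^jc_j\,\partial_j\sigma$, where $\partial_j[v_0,\dots,v_n]=[v_0,\dots,\widehat{v}_j,\dots,v_n]$ and $c_j=\mu(\sigma)/\mu(\partial_j\sigma)$ if $\mu$ is ascending, $c_j=\mu(\partial_j\sigma)/\mu(\sigma)$ if $\mu$ is descending; $H_*(K,\partial^\mu)$ is the homology of $(C_*(K),\partial^\mu)$.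 Divisible weights. A weight $\xi$ is divisible if the vertices of every simplex $\sigma$ can be ordered $v_0,\dots,v_k$ with $\xi(v_0)\mid\cdots\mid\xi(v_k)$ and $\xi(\sigma)=\xi(v_k)$ (ascending case) or $\xi(\sigma)=\xi(v_0)$ (descending case). The inversion $\widehat{\xi}$ of a divisible weight $\xi$ is the divisible weight of the opposite type with the same values on vertices. Morphisms. For weighted complexes of the same type, a morphism $\varrho:(K,\mu)\to(K',\mu')$ is a simplicial map with $\mu'(\varrho(\sigma))\mid\mu(\sigma)$ (ascending) or $\mu(\sigma)\mid\mu'(\varrho(\sigma))$ (descending) for every simplex $\sigma$; it is weight-preserving if equality always holds. It induces the chain map $\varrho_{\#}(\sigma)=\frac{\mu(\sigma)}{\mu'(\varrho(\sigma))}\varrho(\sigma)$ (ascending) or $\frac{\mu'(\varrho(\sigma))}{\mu(\sigma)}\varrho(\sigma)$ (descending), where $\varrho(\sigma)=0$ as a chain if $\varrho$ is not injective on $\sigma$. A weight-preserving morphism $\varrho:(K,\xi)\to(K',\xi')$ of divisibly weighted complexes is also a weight-preserving morphism $\widehat{\varrho}:(K,\widehat{\xi})\to(K',\widehat{\xi'})$. Subdivision. $Sd(K)$ is the barycentric subdivision, with simplices $\{b_{\sigma_0},\dots,b_{\sigma_l}\}$, $\sigma_0\subsetneq\cdots\subsetneq\sigma_l$; the weight $Sd(\mu)(\{b_{\sigma_0},\dots,b_{\sigma_l}\})=\mu(\sigma_l)$ is divisible and of the same type as $\mu$. Chain maps $Sd_{\#}:(C_*(K),\partial^{\mu})\to(C_*(Sd(K)),\partial^{Sd(\mu)})$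 and, for divisible $\xi$, $\widehat{Sd}_{\#}:(C_*(K),\partial^{\widehat{\xi}})\to(C_*(Sd(K)),\partial^{\widehat{Sd(\xi)}})$ are defined inductively by $Sd_{\#}(v)=\widehat{Sd}_{\#}(v)=v$ on vertices and $Sd_{\#}(\sigma)=b_\sigma\cdot Sd_{\#}(\partial\sigma)$, $\widehat{Sd}_{\#}(\sigma)=b_\sigma\cdot\widehat{Sd}_{\#}(\partial^{\widehat{\xi}}\sigma)$, where $\partial$ is the ordinary boundary and $b_\sigma\cdot$ denotes coning. $Sd_{\#}^m$, $\widehat{Sd}_{\#}^m$ denote the $m$-fold iterates. Weighted polyhedra. For $x\in|K|$ let $\mathrm{Car}_K(x)$ be the unique simplex containing $x$ in its relative interior, and put $\lambda_\mu(x)=\mu(\mathrm{Car}_K(x))$. A weighted polyhedron is a pair $(X,\lambda)$, $X$ a space and $\lambda:X\to\mathbb{Z}_{+}$ a function, isomorphic (by a weight-preserving homeomorphism) to $(|K|,\lambda_\mu)$ for some weighted simplicial complex $(K,\mu)$, called a weighted triangulation (a divisibly weighted triangulation if $\mu$ is divisible); its type is that of $\mu$. One identifies $X$ with $|K|$. Induced maps. A W-continuous map $f:(X,\lambda)\to(X',\lambda')$ between weighted polyhedra of the same type is a continuous map with $\lambda'(f(x))\mid\lambda(x)$ (ascending) or $\lambda(x)\mid\lambda'(f(x))$ (descending) for all $x$; weight-preserving means equality. A W-simplicial approximation of $f$ is a morphism $\varrho:(Sd^m(K),Sd^m(\xi))\to(K',\xi')$, for some $m$, which is a simplicial approximation of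 $f$ (i.e. $f$ maps the open star of each vertex $v$ into the open star of $\varrho(v)$). Define $f_*=\varrho_*\circ Sd^m_*$. If $f$ is weight-preserving, choose $\varrho$ weight-preserving and define $\widehat{f}_*=\widehat{\varrho}_*\circ\widehat{Sd}{}^m_*$. (The paper establishes that such $\varrho$ exist and that these maps do not depend on the choices.)
   Formalization: A weight-preserving W-simplicial approximation of f need not exist for every isomorphism f, so the hatted f_* can be undefined; the claim for it is proved for every weight-preserving approximation ρ, without asserting that one exists. *)

(* Defs.v *)
From HB Require Import structures.
From mathcomp Require Import all_boot all_order all_algebra.
From mathcomp Require Import generic_quotient ring_quotient.

Set Implicit Arguments.
Unset Strict Implicit.
Unset Printing Implicit Defensive.

Import GRing.Theory Num.Theory.

Local Open Scope ring_scope.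
Local Open Scope quotient_scope.

(* Every element of [vert] is a vertex, i.e. spans a 0-simplex. *)
Record complex := Complex {
  vert : finType;
  simps : {set {set vert}};
  simps_vert : forall v, [set v] \in simps;
  simps_n0 : set0 \notin simps;
  simps_face : forall s s' : {set vert},
    s \in simps -> s' \subset s -> s' != set0 -> s' \in simps }.

Definition simplex (K : complex) : finType := {s : {set vert K} | s \in simps K}.

(* ** Barycentric subdivision *)

Section Sd.
Variable K : complex.

(* The vertex b_sigma of Sd K is sigma itself; a simplex of Sd K is a nonempty
   set of simplices of K that is totally ordered by inclusion. *)
Definition sd_simps : {set {set simplex K}} :=
  [set S : {set simplex K} | (S != set0) &&
     [forall s in S, forall s' in S,
        (val s \subset val s') || (val s' \subset val s)]].

Lemma sd_simps_vert v : [set v] \in sd_simps.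
Proof.
rewrite inE; apply/andP; split; first by apply/set0Pn; exists v; rewrite inE.
by apply/forall_inP=> s /set1P -> ; apply/forall_inP=> s' /set1P ->; rewrite subxx.
Qed.

Lemma sd_simps_n0 : set0 \notin sd_simps.
Proof. by rewrite inE eqxx. Qed.

Lemma sd_simps_face (S S' : {set simplex K}) :
  S \in sd_simps -> S' \subset S -> S' != set0 -> S' \in sd_simps.
Proof.
rewrite !inE => /andP[_ /forall_inP h] /subsetP sS' ->/=.
apply/forall_inP=> s /sS' sS; apply/forall_inP=> s' /sS' s'S.
by have /forall_inP := h _ sS; exact.
Qed.

Definition Sd : complex := Complex sd_simps_vert sd_simps_n0 sd_simps_face.

End Sd.

Notation Sdn K m := (iter m Sd K).

(* ** Weights *)

Inductive wtype := Ascending | Descending.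

Definition opposite (t : wtype) : wtype :=
  if t is Ascending then Descending else Ascending.

(* Only the values on the simplices of K matter. *)
Definition weight (K : complex) := {set vert K} -> nat.

Definition is_weight (t : wtype) (K : complex) (mu : weight K) : Prop :=
  (forall s, s \in simps K -> (0 < mu s)%N) /\
  (forall s s', s \in simps K -> s' \in simps K -> s' \subset s ->
     if t is Ascending then (mu s' %| mu s)%N else (mu s %| mu s')%N).

Definition is_divisible (t : wtype) (K : complex) (xi : weight K) : Prop :=
  is_weight t xi /\
  forall s, s \in simps K -> exists v (r : seq (vert K)),
    [/\ perm_eq (v :: r) (enum s),
        path (fun u w => xi [set u] %| xi [set w])%N v r &
        xi s = if t is Ascending then xi [set last v r]
               else xi [set v]].

(* On a set of vertices whose weights form a divisibility chain, the gcd is the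
   smallest and the lcm is the largest of these weights. *)
Definition inversion (t : wtype) (K : complex) (xi : weight K) : weight K :=
  fun s => if t is Ascending then \big[gcdn/0%N]_(v in s) xi [set v]
           else \big[lcmn/1%N]_(v in s) xi [set v].

Lemma inversionE (t : wtype) (K : complex) (xi : weight K) v :
  inversion t xi [set v] = xi [set v].
Proof.
rewrite /inversion; case: t; first by rewrite big_set1.
by rewrite big_set1.
Qed.

Lemma biggcd_chain (T : finType) (w : T -> nat) v r (s : {set T}) :
  perm_eq (v :: r) (enum s) -> path (fun u z => w u %| w z)%N v r ->
  \big[gcdn/0%N]_(u in s) w u = w v.
Proof.
move=> /perm_mem vr p; apply/eqP; rewrite eqn_dvd; apply/andP; split.
  by apply: (biggcdn_inf v); rewrite // -mem_enum -vr mem_head.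
apply/dvdn_biggcdP=> u; rewrite -mem_enum -vr inE => /predU1P[->//|ur].
have tr : transitive (fun u z => w u %| w z)%N by move=> a b c; apply: dvdn_trans.
by move: p; rewrite path_sortedE// => /andP[/allP/(_ _ ur)].
Qed.

Lemma biglcm_chain (T : finType) (w : T -> nat) v r (s : {set T}) :
  perm_eq (v :: r) (enum s) -> path (fun u z => w u %| w z)%N v r ->
  \big[lcmn/1%N]_(u in s) w u = w (last v r).
Proof.
move=> /perm_mem vr p; apply/eqP; rewrite eqn_dvd; apply/andP; split; last first.
  by apply: (@biglcmn_sup _ (last v r)); rewrite // -mem_enum -vr mem_last.
apply/dvdn_biglcmP=> u; rewrite -mem_enum -vr => {vr}.
elim: r v p u => [|a r IH] v /=; first by move=> _ u; rewrite inE => /eqP ->.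
move=> /andP[va p] u; rewrite inE => /predU1P[->|]; last exact: IH.
by apply: (dvdn_trans va); apply: (IH a p a); rewrite mem_head.
Qed.

Lemma inversion_divisible (t : wtype) (K : complex) (xi : weight K) :
  is_divisible t xi -> is_divisible (opposite t) (inversion t xi).
Proof.
move=> [[pos _] dv].
have dv' s : s \in simps K -> exists v (r : seq (vert K)),
    [/\ perm_eq (v :: r) (enum s),
        path (fun u w => inversion t xi [set u] %| inversion t xi [set w])%N v r &
        inversion t xi s = if opposite t is Ascending
          then inversion t xi [set last v r] else inversion t xi [set v]].
  move=> /dv[v [r [vr p _]]]; exists v, r; split=> //.
    by rewrite (eq_path (e' := fun u w => xi [set u] %| xi [set w])%N)// => u w;
      rewrite !inversionE.
  rewrite !inversionE /inversion; case: (t) => /=.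
    exact: (biggcd_chain (w := fun u => xi [set u])) vr p.
  exact: (biglcm_chain (w := fun u => xi [set u])) vr p.
split=> //; split.
  move=> s /dv'[v [r [_ _ ->]]]; case: opposite;
  by rewrite inversionE pos// simps_vert.
move=> s s' sK s'K /subsetP ss'; rewrite /inversion; case: (t) => /=.
  by apply/dvdn_biggcdP=> u us'; apply: (biggcdn_inf u) => //; exact: ss'.
by apply/dvdn_biglcmP=> u us'; apply: (@biglcmn_sup _ u) => //; exact: ss'.
Qed.

(* The largest simplex of a chain of simplices is its union. *)
Definition sdw (K : complex) (mu : weight K) : weight (Sd K) :=
  fun S : {set simplex K} => mu (\bigcup_(s in S) val s).

Fixpoint sdwn (K : complex) (mu : weight K) m : weight (Sdn K m) :=
  if m is m'.+1 return weight (Sdn K m) then sdw (@sdwn K mu m') else mu.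
Arguments sdwn {K} mu m _.

(* The integer quotient that is the coefficient attached to a pair of simplices
   of weights a (source) and b (target), both in the boundary operator and in
   the chain map of a morphism. *)
Definition wratio (t : wtype) (a b : nat) : int :=
  (if t is Ascending then a %/ b else b %/ a)%N%:Z.

(* ** Weighted chains *)

(* The direct sum of all oriented chain groups C_n(K): a chain is given by its
   coefficients on the simplices, each oriented by the order of [enum]. *)
Definition chain (K : complex) := {ffun simplex K -> int}.
HB.instance Definition _ K := GRing.Zmodule.on (chain K).

Definition basis (K : complex) (s : simplex K) : chain K :=
  [ffun s' => (s' == s)%:R].

Fixpoint inversions (T : finType) (s : seq T) : nat :=
  if s is x :: s' then
    (count (fun y => enum_rank y < enum_rank x) s' + inversions s')%N
  else 0%N.

(* The oriented simplex [v_0, ..., v_n]; it is 0 if a vertex is repeated, or if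
   the v_i do not span a simplex (in particular on the empty sequence). *)
Definition oriented (K : complex) (s : seq (vert K)) : chain K :=
  if uniq s then
    if insub [set v in s] is Some sigma
    then basis sigma *~ (-1) ^+ inversions s else 0
  else 0.

Definition linext (K L : complex) (g : simplex K -> chain L) (c : chain K) :
  chain L := \sum_(s : simplex K) g s *~ c s.

Definition face (T : Type) (j : nat) (s : seq T) : seq T :=
  take j s ++ drop j.+1 s.

Definition bd (t : wtype) (K : complex) (mu : weight K) : chain K -> chain K :=
  linext (fun s : simplex K => \sum_(j < #|val s|)
    oriented (face j (enum (val s))) *~
      ((-1) ^+ j *
       wratio t (mu (val s)) (mu [set v in face j (enum (val s))]))).

(* With constant weight 1 this is the usual boundary, for either type. *)
Definition bd1 (K : complex) : chain K -> chain K :=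
  bd Ascending (fun _ : {set vert K} => 1%N).

(* The chain map induced by the vertex map of a morphism. *)
Definition push (t : wtype) (K : complex) (mu : weight K) (K' : complex)
    (mu' : weight K') (rho : vert K -> vert K') : chain K -> chain K' :=
  linext (fun s : simplex K =>
    oriented (map rho (enum (val s))) *~
      wratio t (mu (val s)) (mu' (rho @: val s))).

Definition cone (K : complex) (b : vert K) : chain K -> chain K :=
  linext (fun s : simplex K => oriented (b :: enum (val s))).

(* [subdiv_simplex d n s] is, for an n-simplex s, the subdivision of s that is
   defined by coning over the subdivision of d s. *)
Fixpoint subdiv_simplex (K : complex) (d : chain K -> chain K) (n : nat)
    (s : simplex K) : chain (Sd K) :=
  if n is n'.+1
  then cone (s : vert (Sd K)) (linext (subdiv_simplex d n') (d (basis s)))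
  else oriented [:: s : vert (Sd K)].

Definition subdiv (K : complex) (d : chain K -> chain K) :
    chain K -> chain (Sd K) :=
  linext (fun s : simplex K => subdiv_simplex d #|val s|.-1 s).

Definition sd_chain (K : complex) : chain K -> chain (Sd K) :=
  subdiv (@bd1 K).

Fixpoint sdn_chain (K : complex) m : chain K -> chain (Sdn K m) :=
  if m is m'.+1 return chain K -> chain (Sdn K m)
  then fun c => sd_chain (sdn_chain m' c) else id.

(* Here t is the type of xi, so [opposite t] is the type of its inversion. *)
Definition hsd_chain (t : wtype) (K : complex) (xi : weight K) :
    chain K -> chain (Sd K) :=
  subdiv (bd (opposite t) (inversion t xi)).

Fixpoint hsdn_chain (t : wtype) (K : complex) (xi : weight K) m :
    chain K -> chain (Sdn K m) :=
  if m is m'.+1 return chain K -> chain (Sdn K m)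
  then fun c => hsd_chain t (sdwn xi m') (hsdn_chain t xi m' c) else id.

(* ** Morphisms *)

Definition simplicial (K K' : complex) (rho : vert K -> vert K') : Prop :=
  forall s, s \in simps K -> rho @: s \in simps K'.

Definition morphism (t : wtype) (K K' : complex) (mu : weight K)
    (mu' : weight K') (rho : vert K -> vert K') : Prop :=
  simplicial rho /\
  forall s, s \in simps K ->
    if t is Ascending then (mu' (rho @: s) %| mu s)%N
    else (mu s %| mu' (rho @: s))%N.

Definition weight_preserving (K K' : complex) (mu : weight K)
    (mu' : weight K') (rho : vert K -> vert K') : Prop :=
  forall s, s \in simps K -> mu' (rho @: s) = mu s.

(* ** Barycentric coordinates *)

(* The vertex set of the unique simplex of K that has the point x of |K| in its
   relative interior. *)
Definition carrier (R : numFieldType) (K : complex) (x : vert K -> R) :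
    {set vert K} := [set v | x v != 0].

(* The homeomorphism |Sd K| -> |K| that is affine on simplices and sends b_sigma
   to the barycenter of sigma. *)
Definition sd_coord (R : numFieldType) (K : complex) (y : vert (Sd K) -> R) :
    vert K -> R :=
  fun v => \sum_(s : simplex K | v \in val s) y s / #|val s|%:R.

Fixpoint sdn_coord (R : numFieldType) (K : complex) m :
    (vert (Sdn K m) -> R) -> vert K -> R :=
  if m is m'.+1 return (vert (Sdn K m) -> R) -> vert K -> R
  then fun y => sdn_coord (sd_coord y) else id.
Arguments sdn_coord {R K} m _.

(* The analysis library is imported only here because it redefines the
   finite-set notations and [set0]. *)
From mathcomp Require Import all_classical all_reals all_analysis.
Import numFieldNormedType.Exports.

(* ** Homology *)

Definition dim_pred (K : complex) (n : nat) : {pred chain K} :=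
  fun c => [forall s, (c s != 0) ==> (#|val s| == n.+1)].

Section Homology.
Variables (t : wtype) (K : complex) (mu : weight K) (n : nat).

Definition cycle_pred : {pred chain K} :=
  fun c => (c \in dim_pred n) && (bd t mu c == 0).

Lemma linextB L (g : simplex K -> chain L) : {morph linext g : c d / c - d}.
Proof.
by move=> c d; rewrite /linext -sumrB; apply: eq_bigr => s _; rewrite !ffunE mulrzBr.
Qed.

Lemma linext0 L (g : simplex K -> chain L) : linext g 0 = 0.
Proof. by rewrite /linext big1// => s _; rewrite ffunE mulr0z. Qed.

Lemma dim_zmod k : zmod_closed (@dim_pred K k).
Proof.
split; first by apply/forallP=> s; rewrite ffunE eqxx.
move=> c d /forallP hc /forallP hd; apply/forallP=> s; apply/implyP=> h.
move: (hc s) (hd s); case: (c s =P 0) => [c0|_ ? //].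
case: (d s =P 0) => [d0|_ _ //]; by move: h; rewrite !ffunE c0 d0 subrr eqxx.
Qed.

Lemma cycle_zmod : zmod_closed cycle_pred.
Proof.
have [d0 dB] := @dim_zmod n; split.
  by apply/andP; split=> //; rewrite /bd linext0.
move=> c d /andP[hc /eqP bc] /andP[hd /eqP bd']; apply/andP; split.
  exact: dB.
by apply/eqP; move: bc bd'; rewrite /bd linextB => -> ->; rewrite subrr.
Qed.

HB.instance Definition _ := GRing.isZmodClosed.Build _ cycle_pred cycle_zmod.

Record cycle := Cycle { cycle_val :> chain K; _ : cycle_val \in cycle_pred }.
HB.instance Definition _ := [isSub for cycle_val].
HB.instance Definition _ := [Choice of cycle by <:].
HB.instance Definition _ := [SubChoice_isSubZmodule of cycle by <:].

Definition boundary_pred : {pred cycle} :=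
  fun z => `[< exists2 c, c \in dim_pred n.+1 & bd t mu c = val z >].

Lemma boundary_zmod : zmod_closed boundary_pred.
Proof.
have [d0 dB] := dim_zmod n.+1.
split; first by apply/asboolP; exists 0 => //; rewrite /bd linext0 raddf0.
move=> y z /asboolP[c hc bc] /asboolP[d hd bd']; apply/asboolP.
exists (c - d); first exact: dB.
by move: bc bd'; rewrite /bd linextB => -> ->; rewrite raddfB.
Qed.

HB.instance Definition _ := GRing.isZmodClosed.Build _ boundary_pred boundary_zmod.

(* H_n(K, d^mu), for mu of type t. *)
Definition homology : zmodType := Quotient.quot boundary_pred.

Definition hclass (z : cycle) : homology := \pi_(Quotient.quot boundary_pred) z.

End Homology.

(* The map in homology induced by a chain map.  The default 0 of [insubd] is
   never used, because a chain map sends cycles to cycles; see [hmapE]. *)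
Definition hmap (t t' : wtype) (K K' : complex) (mu : weight K)
    (mu' : weight K') n (phi : chain K -> chain K') :
    homology t mu n -> homology t' mu' n :=
  fun a => hclass (insubd (0 : cycle t' mu' n)
    (phi (repr (a : Quotient.quot (@boundary_pred t K mu n)) : cycle t mu n))).

Arguments hmap t t' {K K'} mu mu' {n} phi _.

Lemma hmapE (t t' : wtype) (K K' : complex) (mu : weight K)
    (mu' : weight K') n (phi : chain K -> chain K') :
    {morph phi : c d / c - d} ->
    (forall k c, c \in @dim_pred K k -> phi c \in @dim_pred K' k) ->
    (forall c, phi (bd t mu c) = bd t' mu' (phi c)) ->
  forall (z : cycle t mu n) (z' : cycle t' mu' n),
    phi z = z' -> hmap t t' mu mu' phi (hclass z) = hclass z'.
Proof.
move=> phiB phid phib z z' zz'; have phi0 : phi 0 = 0 by rewrite -(subrr 0) phiB subrr.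
have cyc (y : cycle t mu n) : phi y \in @cycle_pred t' K' mu' n.
  case: y => y /= /andP[hy /eqP b0]; apply/andP; split; first exact: phid.
  by rewrite -phib b0 phi0.
rewrite /hmap /hclass; set q := repr _.
apply/eqP; rewrite -Quotient.idealrBE.
have : (q - z) \in @boundary_pred t K mu n by rewrite Quotient.idealrBE reprK.
move=> /asboolP[c hc bc]; apply/asboolP; exists (phi c); first exact: phid.
by rewrite -phib bc !raddfB /= insubdK ?cyc// phiB zz'.
Qed.

Definition hom_iso (A B : zmodType) (g : A -> B) : Prop :=
  {morph g : x y / x + y} /\ bijective g.

(* ** Weighted polyhedra *)

Local Open Scope classical_set_scope.

Definition homeomorphism (S T : topologicalType) (h : S -> T) : Prop :=
  exists k : T -> S,
    [/\ cancel h k, cancel k h, continuous h & continuous k].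

(* |K|, in barycentric coordinates; the product topology on the finite power
   R^(vert K) is the Euclidean one. *)
Definition realization (R : realType) (K : complex) : set {ptws vert K -> R} :=
  [set x : {ptws vert K -> R} |
    [/\ forall v, 0 <= x v, \sum_v x v = 1 & carrier x \in simps K]].

Arguments realization R K _ : clear implicits.

(* [g] is the homeomorphism that identifies X with |K|. *)
Definition triangulation (R : realType) (t : wtype) (K : complex)
    (mu : weight K) (X : topologicalType) (lam : X -> nat)
    (g : X -> realization R K) : Prop :=
  [/\ is_weight t mu, homeomorphism g &
      forall x, lam x = mu (carrier (set_val (g x)))].

Definition weighted_polyhedron (R : realType) (t : wtype) (X : topologicalType)
    (lam : X -> nat) : Prop :=
  exists (K : complex) (mu : weight K) (g : X -> realization R K),
    triangulation t mu lam g.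

Definition open_star (R : realType) (K : complex) (v : vert K) :
    set (vert K -> R) :=
  [set x | realization R K x /\ v \in carrier x].

(* The open star in X of a vertex of Sd^m K. *)
Definition open_star_in (R : realType) (K : complex) (X : topologicalType)
    (g : X -> realization R K) m (w : vert (Sdn K m)) : set X :=
  [set x | exists2 y : vert (Sdn K m) -> R,
     open_star w y & sdn_coord m y = set_val (g x)].

Definition simplicial_approx (R : realType) (K K' : complex)
    (X X' : topologicalType) (g : X -> realization R K)
    (g' : X' -> realization R K') (f : X -> X') m
    (rho : vert (Sdn K m) -> vert K') : Prop :=
  simplicial rho /\
  forall w, f @` open_star_in g w `<=` @open_star_in R K' X' g' 0 (rho w).

Definition W_simplicial_approx (R : realType) (t : wtype) (K K' : complex)
    (xi : weight K) (xi' : weight K')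
    (X X' : topologicalType) (g : X -> realization R K)
    (g' : X' -> realization R K') (f : X -> X') m
    (rho : vert (Sdn K m) -> vert K') : Prop :=
  morphism t (sdwn xi m) xi' rho /\ simplicial_approx g g' f rho.

Arguments W_simplicial_approx {R} t {K K'} xi xi' {X X'} g g' f m rho.

(* ** Induced homomorphisms *)

(* f_* = rho_* o Sd^m_* for a W-simplicial approximation rho of f *)
Definition induced_hom (t : wtype) (K K' : complex) (xi : weight K)
    (xi' : weight K') m (rho : vert (Sdn K m) -> vert K') n :
    homology t xi n -> homology t xi' n :=
  hmap t t (sdwn xi m) xi' (push t (sdwn xi m) xi' rho) \o
  hmap t t xi (sdwn xi m) (@sdn_chain K m).

(* The hatted f_*, for a weight-preserving rho; t is the type of xi and xi'. *)
Definition hat_induced_hom (t : wtype) (K K' : complex) (xi : weight K)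
    (xi' : weight K') m (rho : vert (Sdn K m) -> vert K') n :
    homology (opposite t) (inversion t xi) n ->
    homology (opposite t) (inversion t xi') n :=
  let xih := inversion t xi in
  let xih' := inversion t xi' in
  let sdh := inversion t (sdwn xi m) in
  hmap (opposite t) (opposite t) sdh xih' (push (opposite t) sdh xih' rho) \o
  hmap (opposite t) (opposite t) xih sdh (@hsdn_chain t K xi m).

Arguments induced_hom t {K K'} xi xi' m rho n _.
Arguments hat_induced_hom t {K K'} xi xi' m rho n _.

(* Main.v *)
(* Multiplying the coefficient of each simplex s by mu(s) (ascending case) or by
   1/mu(s) (descending case) turns the weighted boundary into the ordinary one,
   so a weighted chain complex is a lattice in the ordinary rational chains:
   the coefficient of s is divisible by the largest of the vertex weights
   a(v) = xi(v), resp. a(v) = 1/xi(v), in s.  Passing to the inversion replaces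
   a by 1/a, and f_#, Sd_# and its hatted version all become the ordinary
   operators, restricted to these lattices.  A weighted simplex is a cone from
   its vertex of smallest weight, hence acyclic; so acyclic carriers show that
   contiguous maps are homotopic and that Sd_# is a homotopy equivalence.

   In the unhatted case, rho Sd^m and rho' Sd^m' for simplicial approximations
   of f and of its inverse are therefore inverse to each other in homology.  In
   the hatted case f^-1 may have no weight-preserving approximation.  But its
   approximations respect the weights when each subdivision of K' gives b_s the
   largest instead of the smallest of the weights 1/a of the vertices of s.
   After replacing K' by a fine enough subdivision, compactness yields a left
   inverse G of f_* (up to the subdivision isomorphism) which is itself of the
   form f^-1_*.  Then G also has a left inverse, and f_* is bijective. *)

From HB Require Import structures.
Require Import Defs.
From mathcomp Require Import all_boot all_order all_algebra.
From mathcomp Require Import generic_quotient ring_quotient boolp.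

Set Implicit Arguments.
Unset Strict Implicit.
Unset Printing Implicit Defensive.

Import Order.TTheory GRing.Theory Num.Theory.

Local Open Scope ring_scope.

(** * The exterior algebra on the vertices *)

(** In lattice form a vertex map is admissible when the weight of each image vertex divides that of
    the vertex. The two triangulations share one number at each point: in the unhatted case the
    largest vertex weight of the carrier, in the hatted case the smallest inverted one. If the
    largest is shared, every vertex weight of one carrier divides the largest weight of the other,
    in both directions, and this is what makes approximations composable. If the smallest is shared,
    only a vertex of least weight is sure to do so: an approximation still exists, but composition
    fails. A refinement with smallest weights restores the condition for all vertices in one
    direction, which yields a one-sided inverse only. The hatted subdivision carries smallest
    weights, while the argument on approximations needs largest ones on the source. A
    weight-preserving vertex map is admissible for both choices, and the rational operator is the
    same, so the hatted map can be treated as an approximation with largest weights. *)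

Notation ealg V := {ffun {set V} -> rat^o}.

Definition ebasis (V : finType) (S : {set V}) : ealg V := [ffun T => (T == S)%:R].

Lemma ealg_sum (V : finType) (c : ealg V) : c = \sum_S c S *: ebasis S.
Proof.
apply/ffunP => T; rewrite sum_ffunE (bigD1 T) //= !ffunE eqxx /GRing.scale /= mulr1.
by rewrite big1 ?addr0// => S ST; rewrite !ffunE eq_sym (negPf ST) /GRing.scale /= mulr0.
Qed.

Lemma linear_ealg (V : finType) (M : lmodType rat) (f : ealg V -> M) :
  linear f -> forall c, f c = \sum_S c S *: f (ebasis S).
Proof.
move=> lf c; pose F : {linear ealg V -> M} :=
  HB.pack f (GRing.isLinear.Build _ _ _ _ f lf).
rewrite {1}(ealg_sum c) -[f]/(F : _ -> _) linear_sum.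
by apply: eq_bigr => S _; rewrite linearZ.
Qed.

Section Ext.
Variables (V : finType) (M : lmodType rat) (g : {set V} -> M).

Definition ext (c : ealg V) : M := \sum_S c S *: g S.

Lemma ext_linear : linear ext.
Proof.
move=> k c d; rewrite /ext scaler_sumr -big_split; apply: eq_bigr => S _ /=.
by rewrite !ffunE scalerDl scalerA.
Qed.
HB.instance Definition _ := GRing.isLinear.Build _ _ _ _ ext ext_linear.

Lemma ext_ebasis S : ext (ebasis S) = g S.
Proof.
rewrite /ext (bigD1 S) //= ffunE eqxx scale1r big1 ?addr0// => T TS.
by rewrite ffunE (negPf TS) scale0r.
Qed.

Lemma extZ k c : ext (k *: c) = k *: ext c.
Proof. exact: linearZ. Qed.

Lemma ext_sum (I : Type) (r : seq I) (P : pred I) (F : I -> ealg V) :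
  ext (\sum_(i <- r | P i) F i) = \sum_(i <- r | P i) ext (F i).
Proof. exact: linear_sum. Qed.

End Ext.

Section Exterior.
Variable V : finType.
Implicit Types (u v : V) (S T : {set V}) (c : ealg V).

Definition before (u v : V) : bool := (enum_rank u < enum_rank v)%N.

(** The sign of moving [u] to its place in the enumeration order of [S]. Since [before] is strict,
    [u] itself is never counted, so it may or may not belong to [S]. *)
Definition sgn u S : rat := (-1) ^+ #|[set v in S | before v u]|.

Lemma before_total u v : u != v -> before u v = ~~ before v u.
Proof.
move=> uv; rewrite /before -leqNgt ltn_neqAle.
by rewrite (inj_eq val_inj) (inj_eq enum_rank_inj) uv.
Qed.

Lemma sgnK u S : sgn u S * sgn u S = 1.
Proof. by rewrite -expr2 sqrr_sign. Qed.

Lemma sgnU1 u v S : v \notin S ->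
  sgn u (v |: S) = (if before v u then -1 else 1) * sgn u S.
Proof.
move=> vS; rewrite /sgn; case: ifP => vu; last first.
  rewrite mul1r; congr (_ ^+ #|pred_of_set _|); apply/setP => w; rewrite !inE.
  by case: eqP => //= ->; rewrite vu andbF.
rewrite -exprS; congr (_ ^+ _).
rewrite (_ : [set _ in _ | _] = v |: [set w in S | before w u]); last first.
  by apply/setP => w; rewrite !inE; case: eqP => //= ->; rewrite vu.
by rewrite cardsU1 !inE (negPf vS).
Qed.

Lemma sgnU1_id u S : sgn u (u |: S) = sgn u S.
Proof.
rewrite /sgn; congr (_ ^+ #|pred_of_set _|); apply/setP => w; rewrite !inE.
by case: eqP => //= ->; rewrite /before ltnn andbF.
Qed.

Lemma sgnD1_id u S : sgn u (S :\ u) = sgn u S.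
Proof.
rewrite /sgn; congr (_ ^+ #|pred_of_set _|); apply/setP => w; rewrite !inE.
by case: eqP => //= ->; rewrite /before ltnn andbF.
Qed.

Lemma sgn_swap u v S : u != v -> u \notin S -> v \notin S ->
  sgn u S * sgn v (u |: S) = - (sgn v S * sgn u (v |: S)).
Proof.
move=> uv uS vS; rewrite !sgnU1// (before_total uv).
by case: (before v u) => /=; rewrite ?mulN1r ?mul1r ?mulrN ?opprK mulrC.
Qed.

Lemma sgn_swap2 u v S : u != v -> u \notin S -> v \notin S ->
  sgn v (u |: S) * sgn u (v |: S) = - (sgn u S * sgn v S).
Proof.
move=> uv uS vS; rewrite !sgnU1// (before_total uv).
by case: (before v u) => /=; rewrite ?mulN1r ?mul1r ?mulrN ?mulNr ?opprK mulrC.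
Qed.

(* [wedge u] is coning with the vertex u.  The empty set counts as a simplex, so
   [dl] is the augmented boundary. *)
Definition wedge u c : ealg V :=
  [ffun S : {set V} => if u \in S then sgn u S * c (S :\ u) else 0].

Definition dl c : ealg V := [ffun S : {set V} => \sum_(u | u \notin S) sgn u S * c (u |: S)].

Lemma wedge_linear u : linear (wedge u).
Proof.
move=> k c d; apply/ffunP => S; rewrite !ffunE /=; case: ifP => _.
  by rewrite /GRing.scale/= mulrDr mulrCA.
by rewrite addr0 /GRing.scale /= mulr0.
Qed.
HB.instance Definition _ u := GRing.isLinear.Build _ _ _ _ (wedge u) (wedge_linear u).

Lemma dl_linear : linear dl.
Proof.
move=> k c d; apply/ffunP => S; rewrite !ffunE /= /GRing.scale /= mulr_sumr -big_split.
by apply: eq_bigr => u _; rewrite !ffunE /= /GRing.scale/= mulrDr mulrCA.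
Qed.
HB.instance Definition _ := GRing.isLinear.Build _ _ _ _ dl dl_linear.

Lemma dlZ k c : dl (k *: c) = k *: dl c.
Proof. exact: linearZ. Qed.

Lemma dl_sum (I : Type) (r : seq I) (P : pred I) (F : I -> ealg V) :
  dl (\sum_(i <- r | P i) F i) = \sum_(i <- r | P i) dl (F i).
Proof. exact: linear_sum. Qed.

Lemma wedge_id u c : wedge u (wedge u c) = 0.
Proof.
by apply/ffunP => S; rewrite !ffunE; case: ifP => // _; rewrite setD11 mulr0.
Qed.

Lemma wedgeC u v c : wedge u (wedge v c) = - wedge v (wedge u c).
Proof.
have [->|uv] := eqVneq u v; first by rewrite wedge_id oppr0.
apply/ffunP => S; rewrite !ffunE !inE (eq_sym v u) uv /=.
case: ifPn => uS; case: ifPn => vS; rewrite ?mulr0 ?oppr0//=.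
have e : S :\ v :\ u = S :\ u :\ v by apply/setP => w; rewrite !inE andbCA.
rewrite e !mulrA -mulNr; congr (_ * _).
set B := S :\ u :\ v.
have uB : u \notin B by rewrite !inE eqxx andbF.
have vB : v \notin B by rewrite !inE eqxx.
have -> : sgn u S = sgn u (v |: B).
  by rewrite -sgnD1_id /B; congr sgn; rewrite setD1K// !inE eq_sym uv.
have -> : sgn v S = sgn v (u |: B).
  by rewrite -sgnD1_id /B -e; congr sgn; rewrite setD1K// !inE uv.
have -> : sgn v (S :\ u) = sgn v B by rewrite -(sgnD1_id v (S :\ u)).
have -> : sgn u (S :\ v) = sgn u B by rewrite /B -e sgnD1_id.
by rewrite mulrC (sgn_swap (u := v)) 1?eq_sym// mulrC.
Qed.

(** Cartan's formula: coning is a contracting homotopy. At [S] without [u] only the term [v = u] of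
    the boundary survives; at [S] containing [u] the other terms cancel in pairs by [sgn_swap2]. The
    empty simplex makes the formula hold in every degree. *)
Lemma dl_wedge u c : dl (wedge u c) = c - wedge u (dl c).
Proof.
apply/eqP; rewrite eq_sym subr_eq eq_sym; apply/eqP/ffunP => S; rewrite !ffunE.
case: ifPn => uS; last first.
  rewrite addr0 (bigD1 u) //= !ffunE setU11 sgnU1_id setU1K// mulrA sgnK mul1r.
  rewrite big1 ?addr0// => v /andP[vS vu]; rewrite ffunE !inE (negPf uS) orbF.
  by rewrite eq_sym (negPf vu) mulr0.
rewrite [X in _ + _ * X](bigD1 u) ?setD11//= setD1K// sgnD1_id.
rewrite mulrDr mulrA sgnK mul1r addrCA mulr_sumr.
rewrite [X in _ + (_ + X)](_ : _ =
  \sum_(v | v \notin S) sgn u S * (sgn v (S :\ u) * c (v |: S :\ u))); last first.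
  apply: eq_bigl => v; rewrite !inE; case: eqP => [->|] /=; rewrite ?uS //.
  by rewrite andbT.
rewrite -big_split big1 ?addr0// => v vS; rewrite ffunE in_setU1 uS orbT.
have vu : v != u by apply: contraNneq vS => ->.
have e : (v |: S) :\ u = v |: S :\ u.
  by apply/setP => w; rewrite !inE; case: (eqVneq w v) => [->|]//=; rewrite vu.
rewrite /= e !mulrA -mulrDl.
set B := S :\ u; have uB : u \notin B by rewrite !inE eqxx.
have vB : v \notin B by rewrite !inE (negPf vS) andbF.
have -> : sgn v S = sgn v (u |: B) by rewrite setD1K.
have -> : sgn u (v |: S) = sgn u (v |: B) by rewrite -sgnD1_id e.
have -> : sgn u S = sgn u B by rewrite sgnD1_id.
by rewrite (sgn_swap2 (u := u) (v := v)) 1?eq_sym// addNr mul0r.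
Qed.

Lemma wedge_ebasis u S :
  wedge u (ebasis S) = if u \in S then 0 else sgn u S *: ebasis (u |: S).
Proof.
apply/ffunP => T; rewrite !ffunE; case: (boolP (u \in S)) => uS.
  rewrite ffunE; case: ifPn => // uT; case: eqP => [e|_]; last by rewrite mulr0.
  by move: uS; rewrite -e setD11.
rewrite !ffunE /GRing.scale /=; case: ifPn => uT.
  have -> : (T :\ u == S) = (T == u |: S).
    by apply/eqP/eqP => [<-|->]; rewrite ?setD1K ?setU1K.
  by case: eqP => [->|]; rewrite ?mulr0// sgnU1_id.
by case: eqP => [e|]; rewrite ?mulr0//; move: uT; rewrite e setU11.
Qed.

Lemma ebasis_wedge u S : u \in S -> ebasis S = sgn u S *: wedge u (ebasis (S :\ u)).
Proof.
move=> uS; rewrite wedge_ebasis setD11 setD1K// scalerA sgnD1_id.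
by rewrite sgnK scale1r.
Qed.


Lemma set_card_ind (P : {set V} -> Prop) :
  (forall S, (forall T, (#|T| < #|S|)%N -> P T) -> P S) -> forall S, P S.
Proof.
move=> h S; have [n] := ubnP #|S|; elim: n S => // n IH S Sn.
by apply: h => T TS; apply: IH; apply: leq_trans TS _; rewrite -ltnS.
Qed.

(** The operators [wedge u] generate everything from the empty simplex, so identities between linear
    maps reduce to one induction step per vertex, without computing signs. *)
Lemma wedge_ext (M : lmodType rat) (f g : ealg V -> M) : linear f -> linear g ->
  f (ebasis set0) = g (ebasis set0) ->
  (forall u c, f c = g c -> f (wedge u c) = g (wedge u c)) ->
  forall c, f c = g c.
Proof.
move=> lf lg fg0 fgW c; rewrite (linear_ealg lf) (linear_ealg lg).
apply: eq_bigr => S _; congr (_ *: _); elim/set_card_ind: S => S IH.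
have [->//|/set0Pn[u uS]] := eqVneq S set0.
pose F : {linear ealg V -> M} := HB.pack f (GRing.isLinear.Build _ _ _ _ f lf).
pose G : {linear ealg V -> M} := HB.pack g (GRing.isLinear.Build _ _ _ _ g lg).
rewrite (ebasis_wedge uS) -[f]/(F : _ -> _) -[g]/(G : _ -> _) !linearZ /=.
by congr (_ *: _); apply/fgW/IH; rewrite [in ltnRHS](cardsD1 u) uS.
Qed.

Lemma dl_ebasis0 : dl (ebasis set0) = 0.
Proof.
apply/ffunP => S; rewrite !ffunE big1// => u _; rewrite ffunE.
by rewrite (negPf (_ : u |: S != set0)) ?mulr0//; apply/set0Pn; exists u; rewrite setU11.
Qed.

Lemma dl_dl c : dl (dl c) = 0.
Proof.
apply: (wedge_ext (f := fun c => dl (dl c)) (g := fun=> 0)).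
- by move=> k x y; rewrite !linearP.
- by move=> k x y; rewrite scaler0 addr0.
- by rewrite dl_ebasis0 linear0.
- by move=> u x h; rewrite dl_wedge linearB /= dl_wedge h linear0 subr0 subrr.
Qed.

Lemma dl_ebasis S : dl (ebasis S) = \sum_(u in S) sgn u S *: ebasis (S :\ u).
Proof.
apply/ffunP => T; rewrite ffunE sum_ffunE.
rewrite [LHS]big_mkcond [RHS]big_mkcond /=; apply: eq_bigr => u _.
rewrite !ffunE /GRing.scale /=.
case: (boolP (u \in T)) => uT; case: (boolP (u \in S)) => uS //=; rewrite ?ffunE.
- by case: eqP => [e|]; rewrite ?mulr0//; move: uT; rewrite e setD11.
- have -> : (u |: T == S) = (T == S :\ u).
    by apply/eqP/eqP => [<-|->]; rewrite ?setD1K ?setU1K.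
  by case: eqP => [->|]; rewrite ?mulr0// sgnD1_id.
- by case: eqP => [e|]; rewrite ?mulr0//; move: uS; rewrite -e setU11.
Qed.

End Exterior.

(** * Anticommuting operators and orientation signs *)

Section Anticommuting.
Variables (V : finType).

Definition anticommuting (M : lmodType rat) (T : V -> M -> M) : Prop :=
  [/\ forall u, linear (T u), forall u c, T u (T u c) = 0 &
      forall u v c, T u (T v c) = - T v (T u c)].

Variables (M : lmodType rat) (T : V -> M -> M).
Hypothesis aT : anticommuting T.

Lemma anticommutingZ u k c : T u (k *: c) = k *: T u c.
Proof.
case: aT => lT _ _.
pose F : {linear M -> M} := HB.pack (T u) (GRing.isLinear.Build _ _ _ _ (T u) (lT u)).
by rewrite -[T u]/(F : _ -> _) linearZ.
Qed.

Lemma anticommuting0 u : T u 0 = 0.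
Proof. by rewrite -[in T u 0](scale0r 0) anticommutingZ scale0r. Qed.

Lemma foldr_move m x t1 t2 :
  foldr T m (t1 ++ x :: t2) = (-1) ^+ size t1 *: T x (foldr T m (t1 ++ t2)).
Proof.
case: aT => _ _ C; elim: t1 => [|y t1 IH] /=; first by rewrite scale1r.
by rewrite IH anticommutingZ C exprS mulN1r scalerN scaleNr.
Qed.

Lemma foldr_not_uniq m s : ~~ uniq s -> foldr T m s = 0.
Proof.
elim: s => //= x s IH; rewrite negb_and negbK => /orP[xs|/IH ->]; last first.
  exact: anticommuting0.
move/splitPr: xs => [t1 t2]; rewrite foldr_move anticommutingZ.
by case: aT => _ -> _; rewrite scaler0.
Qed.

End Anticommuting.

(* The sign depends on the two enumerations only, not on the operators. *)
Lemma foldr_perm (V : finType) (s t : seq V) : perm_eq s t ->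
  exists e : nat, forall (M : lmodType rat) (T : V -> M -> M) m,
    anticommuting T -> foldr T m s = (-1) ^+ e *: foldr T m t.
Proof.
elim: s t => [|x s IH] t st.
  move: st; rewrite perm_sym => /perm_nilP ->; exists 0%N => M T m _.
  by rewrite scale1r.
have xt : x \in t by rewrite -(perm_mem st) mem_head.
move/splitPr: xt st => [t1 t2]; rewrite perm_sym -cat1s perm_catCA perm_cons perm_sym.
move=> /IH[e h]; exists (size t1 + e)%N => M T m aT /=.
rewrite (h _ _ _ aT) foldr_move// anticommutingZ// scalerA exprD mulrAC -expr2.
by rewrite sqrr_sign mul1r.
Qed.

Section Orient.
Variable V : finType.
Implicit Types (u v : V) (S T : {set V}) (c : ealg V) (s : seq V).

Lemma wedge_anticommuting : anticommuting (@wedge V).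
Proof. by split; [exact: wedge_linear|exact: wedge_id|exact: wedgeC]. Qed.

Definition orient s : ealg V := foldr (@wedge V) (ebasis set0) s.

Lemma orientE s :
  orient s = if uniq s then (-1) ^+ inversions s *: ebasis [set v in s] else 0.
Proof.
case: ifPn => us; last by apply: foldr_not_uniq us; exact: wedge_anticommuting.
elim: s us => [_|x s IH /= /andP[xs us]]; first by rewrite /= scale1r set_nil.
rewrite IH// linearZ /= wedge_ebasis inE (negPf xs) scalerA -set_cons.
congr (_ *: _); rewrite mulrC -exprD; congr (_ ^+ _); congr addn.
rewrite -size_filter -(card_uniqP _) ?filter_uniq//; apply: eq_card => y.
by rewrite !inE mem_filter andbC.
Qed.

Lemma pairwise_before : pairwise (@before V) (enum V).
Proof.
case E: (enum V) => [//|x0 s]; rewrite -E; apply/(pairwiseP x0) => i j.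
rewrite !inE -cardE => iV jV ij; rewrite /before.
have nthE (k : nat) (kV : (k < #|V|)%N) : nth x0 (enum V) k = enum_val (Ordinal kV).
  by apply: set_nth_default; rewrite -cardE.
by rewrite (nthE _ iV) (nthE _ jV) !enum_valK.
Qed.

Lemma inversions_enum S : inversions (enum S) = 0%N.
Proof.
have : pairwise (@before V) (enum S).
  by rewrite /enum_mem; apply: pairwise_filter; have := pairwise_before;
     rewrite enumT.
elim: (enum S) => //= x s IH /andP[xs /IH ->]; rewrite addn0.
apply/eqP; rewrite -leqn0 leqNgt -has_count; apply/hasPn => y ys.
by move/allP: xs => /(_ _ ys); rewrite /before => /ltnW; rewrite leqNgt.
Qed.

Lemma orient_enum S : orient (enum S) = ebasis S.
Proof.
rewrite orientE enum_uniq inversions_enum scale1r; congr ebasis.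
by apply/setP => v; rewrite inE mem_enum.
Qed.

Lemma dl_orient s :
  dl (orient s) = \sum_(j < size s) (-1) ^+ j *: orient (face j s).
Proof.
elim: s => [|x s IH]; first by rewrite big_ord0 dl_ebasis0.
rewrite [orient _]/= dl_wedge IH big_ord_recl /= scale1r /face take0 drop1.
congr (_ + _); rewrite linear_sum -sumrN; apply: eq_bigr => j _.
by rewrite linearZ /= /bump /= add1n exprS mulN1r scaleNr.
Qed.

(** The universal property of the exterior algebra. If [u] is in [S], both sides vanish; otherwise
    sorting [u :: enum S] produces the same sign on both sides, because the sign in [foldr_perm]
    does not depend on the operators. *)
Lemma ext_anticommuting (M : lmodType rat) (T : V -> M -> M) m u c :
  anticommuting T ->
  ext (fun S => foldr T m (enum S)) (wedge u c) =
  T u (ext (fun S => foldr T m (enum S)) c).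
Proof.
move=> aT; set P := ext _.
have [lT T2 _] := aT.
rewrite (linear_ealg (f := fun c => P (wedge u c))); last first.
  by move=> k x y; rewrite linearP /P linearP.
rewrite [RHS](linear_ealg (f := fun c => T u (P c))); last first.
  by move=> k x y; rewrite /P linearP lT.
apply: eq_bigr => S _; congr (_ *: _).
rewrite -[in LHS](orient_enum S) /P ext_ebasis.
have [uS|uS] := boolP (u \in S).
  rewrite -[wedge u _]/(orient (u :: enum S)) -[T u _]/(foldr T m (u :: enum S)).
  have nu : ~~ uniq (u :: enum S) by rewrite /= mem_enum uS.
  rewrite [orient _]foldr_not_uniq ?linear0 ?foldr_not_uniq//.
  exact: wedge_anticommuting.
have : perm_eq (u :: enum S) (enum (u |: S)).
  apply: uniq_perm; rewrite /= ?mem_enum ?uS ?enum_uniq// => v.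
  by rewrite !inE !mem_enum !inE.
move=> /foldr_perm[e h].
rewrite -[wedge u _]/(orient (u :: enum S)) -[T u _]/(foldr T m (u :: enum S)).
rewrite h// [orient _](h _ _ _ wedge_anticommuting) -/(orient _) linearZ /=.
by rewrite orient_enum ext_ebasis.
Qed.

End Orient.

Section Push.
Variables (V V' : finType) (rho : V -> V').

(** The homomorphism of exterior algebras induced by [rho]. Simplices on which [rho] is not
    injective are killed because each [wedge] squares to 0. *)
Definition epush : ealg V -> ealg V' :=
  ext (fun S => foldr (fun u => wedge (rho u)) (ebasis set0) (enum S)).
HB.instance Definition _ := GRing.Linear.on epush.

Lemma epushZ k c : epush (k *: c) = k *: epush c.
Proof. exact: linearZ. Qed.

Lemma epush_sum (I : Type) (r : seq I) (P : pred I) (F : I -> ealg V) :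
  epush (\sum_(i <- r | P i) F i) = \sum_(i <- r | P i) epush (F i).
Proof. exact: linear_sum. Qed.

Lemma wedge_comp_anticommuting : anticommuting (fun u => wedge (rho u)).
Proof.
split; [by move=> u; exact: wedge_linear|by move=> u c; exact: wedge_id|].
by move=> u v c; exact: wedgeC.
Qed.

Lemma epush_wedge u c : epush (wedge u c) = wedge (rho u) (epush c).
Proof. exact: ext_anticommuting wedge_comp_anticommuting. Qed.

Lemma epush_ebasis S : epush (ebasis S) = orient (map rho (enum S)).
Proof. by rewrite /epush ext_ebasis /orient foldr_map. Qed.

Lemma epush0 : epush (ebasis set0) = ebasis set0.
Proof. by rewrite epush_ebasis enum_set0. Qed.

Lemma epush_dl c : epush (dl c) = dl (epush c).
Proof.
apply: (wedge_ext (f := fun c => epush (dl c)) (g := fun c => dl (epush c))).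
- by move=> k x y; rewrite !linearP.
- by move=> k x y; rewrite !linearP.
- by rewrite dl_ebasis0 linear0 epush0 dl_ebasis0.
- move=> u x h; rewrite dl_wedge linearB /= !epush_wedge dl_wedge h.
  by [].
Qed.

End Push.

Lemma epush_comp (V V' V'' : finType) (r : V -> V') (r' : V' -> V'') c :
  epush r' (epush r c) = epush (r' \o r) c.
Proof.
apply: (wedge_ext (f := fun c => epush r' (epush r c))) => //.
- by move=> k x y; rewrite !linearP.
- by move=> k x y; rewrite !linearP.
- by rewrite !epush0.
- by move=> u x h; rewrite !epush_wedge h.
Qed.

Lemma epush_id (V : finType) (r : V -> V) c : r =1 id -> epush r c = c.
Proof.
move=> rid; apply: (wedge_ext (f := epush r) (g := id)) => //.
- by move=> k x y; rewrite !linearP.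
- by rewrite !epush0.
- by move=> u x h; rewrite !epush_wedge h rid.
Qed.

(** * Lattices of chains and homology *)

(* [dvdq 0 x] holds only for [x = 0]: a weight 0 forbids a simplex. *)
Definition dvdq (q x : rat) : Prop := exists k : int, x = k%:~R * q.

Lemma dvdq_refl q : dvdq q q. Proof. by exists 1; rewrite mul1r. Qed.

Lemma dvdq_trans r q s : dvdq q r -> dvdq r s -> dvdq q s.
Proof. by move=> [k ->] [l ->]; exists (l * k); rewrite intrM mulrA. Qed.

Lemma dvdq0 q : dvdq q 0. Proof. by exists 0; rewrite mul0r. Qed.

Lemma dvd0q x : dvdq 0 x -> x = 0. Proof. by move=> [k ->]; rewrite mulr0. Qed.

Lemma dvdqD q x y : dvdq q x -> dvdq q y -> dvdq q (x + y).
Proof. by move=> [k ->] [l ->]; exists (k + l); rewrite intrD mulrDl. Qed.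

Lemma dvdqMz q x (k : int) : dvdq q x -> dvdq q (k%:~R * x).
Proof. by move=> [l ->]; exists (k * l); rewrite intrM mulrA. Qed.

Lemma dvdqN q x : dvdq q x -> dvdq q (- x).
Proof. by move=> /(dvdqMz (-1)); rewrite mulN1r. Qed.

Lemma dvdq_sign q x n : dvdq q x -> dvdq q ((-1) ^+ n * x).
Proof.
by rewrite -signr_odd; case: odd; rewrite ?expr1 ?expr0 ?mul1r ?mulN1r//; exact: dvdqN.
Qed.

Lemma dvdq_le q x : 0 < q -> 0 < x -> dvdq q x -> q <= x.
Proof.
move=> q0 x0 [k xE]; move: x0; rewrite xE pmulr_lgt0// ltr0z => k0.
apply: ler_peMl; first exact: ltW.
by rewrite -[1]/(1%:~R : rat) ler_int -gtz0_ge1.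
Qed.

Lemma dvdqV q x : q != 0 -> x != 0 -> dvdq q x -> dvdq x^-1 q^-1.
Proof.
move=> q0 x0 [k xE]; exists k; apply: (mulfI x0).
by rewrite mulrCA divff// mulr1 xE mulfK.
Qed.

Section Lattice.
Variable V : finType.
Implicit Types (om : {set V} -> rat) (c z : ealg V) (S T : {set V}).

Definition inlat om c : Prop := forall S, dvdq (om S) (c S).

(** Degrees count vertices, hence exceed the dimension by one; a side condition [0 < n] excludes
    just the empty simplex. *)
Definition homog (n : nat) c : Prop := forall S, c S != 0 -> #|S| = n.

Lemma inlatD om c d : inlat om c -> inlat om d -> inlat om (c + d).
Proof. by move=> hc hd S; rewrite !ffunE; exact: dvdqD. Qed.
Lemma inlatN om c : inlat om c -> inlat om (- c).
Proof. by move=> hc S; rewrite !ffunE; exact: dvdqN. Qed.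
Lemma inlat0 om : inlat om 0.
Proof. by move=> S; rewrite !ffunE; exact: dvdq0. Qed.
Lemma inlatZ om k c : inlat om c -> inlat om (k%:~R *: c).
Proof. by move=> hc S; rewrite !ffunE; exact: dvdqMz. Qed.
Lemma inlat_sum om (I : Type) (r : seq I) (P : pred I) (F : I -> ealg V) :
  (forall i, P i -> inlat om (F i)) -> inlat om (\sum_(i <- r | P i) F i).
Proof.
by move=> h; elim/big_ind: _ => //; [exact: inlat0|exact: inlatD].
Qed.

Lemma inlat_mono om om' c :
  (forall S, dvdq (om' S) (om S)) -> inlat om c -> inlat om' c.
Proof. by move=> h hc S; exact: dvdq_trans (h S) (hc S). Qed.

Lemma homogD n c d : homog n c -> homog n d -> homog n (c + d).
Proof.
move=> hc hd S; rewrite !ffunE; have [c0|/hc //] := eqVneq (c S) 0.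
by rewrite c0 add0r => /hd.
Qed.
Lemma homogN n c : homog n c -> homog n (- c).
Proof. by move=> hc S; rewrite !ffunE oppr_eq0 => /hc. Qed.
Lemma homogB n c d : homog n c -> homog n d -> homog n (c - d).
Proof. by move=> hc hd; apply: homogD => //; exact: homogN. Qed.
Lemma homog0 n : homog n 0.
Proof. by move=> S; rewrite !ffunE eqxx. Qed.
Lemma homogZ n k c : homog n c -> homog n (k *: c).
Proof. by move=> hc S; rewrite !ffunE mulf_eq0 negb_or => /andP[_ /hc]. Qed.
Lemma homog_sum n (I : Type) (r : seq I) (P : pred I) (F : I -> ealg V) :
  (forall i, P i -> homog n (F i)) -> homog n (\sum_(i <- r | P i) F i).
Proof.
by move=> h; elim/big_ind: _ => //; [exact: homog0|exact: homogD].
Qed.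
Lemma homog_ebasis S : homog #|S| (ebasis S).
Proof. by move=> T; rewrite ffunE; have [->//|_] := eqVneq T S; rewrite eqxx. Qed.

Lemma homog_wedge n u c : homog n c -> homog n.+1 (wedge u c).
Proof.
move=> hc S; rewrite !ffunE; case: ifP => [uS|]; last by rewrite eqxx.
rewrite mulf_eq0 negb_or => /andP[_ /hc].
by rewrite (cardsD1 u S) uS => ->.
Qed.

Lemma homog_dl n c : homog n.+1 c -> homog n (dl c).
Proof.
move=> hc S; rewrite ffunE => nz; apply/eqP; apply: contraNT nz => Sn.
rewrite big1// => u uS; have [->|/hc] := eqVneq (c (u |: S)) 0; first by rewrite mulr0.
by rewrite cardsU1 uS => -[e]; rewrite -e eqxx in Sn.
Qed.

Lemma homog_set0 n c : (0 < n)%N -> homog n c -> c set0 = 0.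
Proof.
move=> n0 hc; apply/eqP; apply: contraLR n0 => /hc <-.
by rewrite cards0.
Qed.

Lemma inlat_wedge om om' u c :
  (forall S, c S != 0 -> u \notin S -> dvdq (om' (u |: S)) (om S)) ->
  inlat om c -> inlat om' (wedge u c).
Proof.
move=> h hc S; rewrite ffunE; case: ifPn => [uS|_]; last exact: dvdq0.
apply: dvdq_sign; have [->|nz] := eqVneq (c (S :\ u)) 0; first exact: dvdq0.
apply: dvdq_trans (hc _); rewrite -{1}(setD1K uS); apply: h => //.
by rewrite setD11.
Qed.

Definition is_cpx om : Prop := om set0 = 0 /\
  forall S v, v \in S -> S :\ v != set0 -> dvdq (om (S :\ v)) (om S).

Definition acyclic om : Prop := forall n z, (0 < n)%N -> inlat om z -> homog n z ->
  dl z = 0 -> exists y, [/\ inlat om y, homog n.+1 y & dl y = z].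

(* Cycles for the boundary operator without the augmentation. *)
Definition Zc om n z : Prop :=
  [/\ inlat om z, homog n z & forall S, S != set0 -> dl z S = 0].

(** For [0 < n] every simplex of [y] has at least two vertices, so the augmentation does not enter
    [dl y], and these are the ordinary boundaries. *)
Definition Bc om n z : Prop :=
  exists y, [/\ inlat om y, homog n.+1 y & dl y = z].

Lemma BcD om n z z' : Bc om n z -> Bc om n z' -> Bc om n (z + z').
Proof.
move=> [y [ly hy <-]] [y' [ly' hy' <-]]; exists (y + y').
by split; [exact: inlatD|exact: homogD|rewrite linearD].
Qed.

Lemma BcN om n z : Bc om n z -> Bc om n (- z).
Proof.
move=> [y [ly hy <-]]; exists (- y).
by split; [exact: inlatN|exact: homogN|rewrite linearN].
Qed.

Lemma Bc0 om n : Bc om n 0.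
Proof. by exists 0; split; [exact: inlat0|exact: homog0|rewrite linear0]. Qed.

Lemma BcB om n z z' : Bc om n z -> Bc om n z' -> Bc om n (z - z').
Proof. by move=> hz hz'; apply/BcD/BcN. Qed.

Lemma ZcB om n z z' : Zc om n z -> Zc om n z' -> Zc om n (z - z').
Proof.
move=> [lz hz dz] [lz' hz' dz']; split.
- by apply: inlatD => //; exact: inlatN.
- exact: homogB.
- move=> S S0; have -> : dl (z - z') = dl z - dl z' by exact: linearB.
  by rewrite [LHS]ffunE [X in _ + X]ffunE dz// dz'// subrr.
Qed.

Lemma Zc_dl om n z : Zc om n z -> dl z = dl z set0 *: ebasis set0.
Proof.
move=> [_ _ h]; apply/ffunP => S; rewrite [RHS]ffunE [X in _ = _ *: X]ffunE /GRing.scale /=.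
by have [->|/h ->] := eqVneq S set0; rewrite ?mulr1 ?mulr0.
Qed.

End Lattice.

Lemma homog_ext (V V' : finType) (g : {set V} -> ealg V') n m (c : ealg V) :
  homog n c -> (forall S : {set V}, #|S| = n -> homog m (g S)) -> homog m (ext g c).
Proof.
move=> hc hg; apply: homog_sum => S _.
have [->|/hc Sn] := eqVneq (c S) 0; first by rewrite scale0r; exact: homog0.
exact/homogZ/hg.
Qed.

(** * Chain maps between lattices and their homotopies *)

Section ChainMaps.

(** Fixing the empty simplex means preserving the augmentation. Compatibility with [dl] is asked on
    lattice chains because the subdivision operator, being 0 on sets that are not simplices, does
    not commute with [dl] there. *)
Definition cmap (V V' : finType) (om : {set V} -> rat) (om' : {set V'} -> rat)
    (phi : ealg V -> ealg V') : Prop :=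
  [/\ linear phi, phi (ebasis set0) = ebasis set0,
      forall c, inlat om c -> inlat om' (phi c),
      forall n c, inlat om c -> homog n c -> homog n (phi c) &
      forall c, inlat om c -> dl (phi c) = phi (dl c)].

(** Only the effect of a chain homotopy on cycles is kept, since this is all that homology sees and
    it composes without bookkeeping. *)
Definition homotopic (V V' : finType) (om : {set V} -> rat) (om' : {set V'} -> rat)
    (phi psi : ealg V -> ealg V') : Prop :=
  forall n z, (0 < n)%N -> Zc om n z -> Bc om' n (phi z - psi z).

Variables (V V' : finType) (om : {set V} -> rat) (om' : {set V'} -> rat).
Implicit Types phi psi : ealg V -> ealg V'.

Lemma linearB_of phi c d : linear phi -> phi (c - d) = phi c - phi d.
Proof.
move=> lf; pose F : {linear ealg V -> ealg V'} :=
  HB.pack phi (GRing.isLinear.Build _ _ _ _ phi lf).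
by rewrite -[phi]/(F : _ -> _) linearB.
Qed.

Lemma linearZ_of phi k d : linear phi -> phi (k *: d) = k *: phi d.
Proof.
move=> lf; pose F : {linear ealg V -> ealg V'} :=
  HB.pack phi (GRing.isLinear.Build _ _ _ _ phi lf).
by rewrite -[phi]/(F : _ -> _) linearZ.
Qed.

Lemma cmap_Zc phi n z : cmap om om' phi -> Zc om n z -> Zc om' n (phi z).
Proof.
move=> [lp p0 pi ph pd] Zz; have [iz hz dz] := Zz.
split; [exact: pi|exact: ph|move=> S S0].
rewrite pd// (Zc_dl Zz) linearZ_of// p0 !ffunE (negPf S0) /GRing.scale /=.
by rewrite mulr0.
Qed.

Lemma cmap_Bc phi n z : cmap om om' phi -> Bc om n z -> Bc om' n (phi z).
Proof.
move=> [lp p0 pi ph pd] [y [ly hy <-]]; exists (phi y).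
by split; [exact: pi|exact: ph|rewrite pd].
Qed.

Lemma homotopic_refl phi : homotopic om om' phi phi.
Proof. by move=> n z _ _; rewrite subrr; exact: Bc0. Qed.

Lemma homotopic_sym phi psi : homotopic om om' phi psi -> homotopic om om' psi phi.
Proof. by move=> h n z n0 Zz; rewrite -opprB; exact/BcN/h. Qed.

Lemma homotopic_trans psi phi chi :
  homotopic om om' phi psi -> homotopic om om' psi chi -> homotopic om om' phi chi.
Proof.
move=> h1 h2 n z n0 Zz; rewrite -(subrK (psi z) (phi z)) -addrA.
by apply: BcD; [exact: h1|exact: h2].
Qed.

Lemma eq_homotopic phi phi' psi psi' : phi =1 phi' -> psi =1 psi' ->
  homotopic om om' phi psi -> homotopic om om' phi' psi'.
Proof. by move=> e e' h n z n0 Zz; rewrite -e -e'; exact: h. Qed.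

End ChainMaps.

Section ChainMapsComp.
Variables (V V' V'' : finType) (om : {set V} -> rat) (om' : {set V'} -> rat).
Variable (om'' : {set V''} -> rat).

Lemma cmap_comp phi psi : cmap om om' phi -> cmap om' om'' psi ->
  cmap om om'' (psi \o phi).
Proof.
move=> [lp p0 pi ph pd] [lq q0 qi qh qd]; split => /=.
- by move=> k x y /=; rewrite lp lq.
- by rewrite /= p0.
- by move=> c /pi/qi.
- by move=> n c lc hc; apply: qh; [exact: pi|exact: ph].
- by move=> c lc /=; rewrite qd ?pd//; exact: pi.
Qed.

Lemma homotopic_compl phi psi chi : cmap om' om'' chi ->
  homotopic om om' phi psi -> homotopic om om'' (chi \o phi) (chi \o psi).
Proof.
move=> cc h n z n0 Zz /=; rewrite -linearB_of; last by case: cc.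
exact/(cmap_Bc cc)/h.
Qed.

Lemma homotopic_compr phi psi chi : cmap om om' chi ->
  homotopic om' om'' phi psi -> homotopic om om'' (phi \o chi) (psi \o chi).
Proof. by move=> cc h n z n0 Zz /=; apply: h => //; exact: cmap_Zc Zz. Qed.

End ChainMapsComp.

Lemma cmap_id (V : finType) (om : {set V} -> rat) : cmap om om id.
Proof. by split. Qed.

(** * Acyclic carriers *)

Section Carrier.
Variables (V V' : finType) (om : {set V} -> rat) (om' : {set V'} -> rat).
Variable Gam : {set V} -> {set V'} -> rat.
Hypothesis cpx_om : is_cpx om.
Hypothesis Gam_acyclic : forall S, om S != 0 -> acyclic (Gam S).
Hypothesis Gam_mono : forall S v T, om S != 0 -> v \in S -> S :\ v != set0 ->
  dvdq (Gam S T) (Gam (S :\ v) T).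
Hypothesis Gam_om' : forall S T, om S != 0 -> dvdq (om' T) (Gam S T).

Lemma om_face S v : om S != 0 -> v \in S -> S :\ v != set0 -> om (S :\ v) != 0.
Proof.
move=> S0 vS Sv0; apply: contraNneq S0 => e; apply/eqP/dvd0q.
by rewrite -e; case: cpx_om => _; apply.
Qed.

Lemma om_n0 S : om S != 0 -> S != set0.
Proof. by apply: contraNneq => ->; case: cpx_om => ->. Qed.

Definition partial_homotopy (chi : ealg V -> ealg V') (D : {set V} -> ealg V') (S : {set V}) :=
  [/\ homog #|S|.+1 (D S), inlat (Gam S) (om S *: D S) &
      dl (D S) = chi (ebasis S) - ext D (dl (ebasis S))].

Variable chi : {linear ealg V -> ealg V'}.
Hypothesis chi0 : chi (ebasis set0) = 0.
Hypothesis chid : forall S, om S != 0 -> dl (chi (ebasis S)) = chi (dl (ebasis S)).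
Hypothesis chih : forall S, om S != 0 -> homog #|S| (chi (ebasis S)).
Hypothesis chil : forall S, om S != 0 -> inlat (Gam S) (om S *: chi (ebasis S)).

(** Induction on the number of vertices. The values [D S] may be fractional: a lattice chain has
    multiples of [om S] as coefficients, so only [om S *: D S] has to lie in the lattice [Gam S]. *)
Lemma exists_homotopy n : exists D : {set V} -> ealg V', D set0 = 0 /\
  forall S, om S != 0 -> (#|S| <= n)%N -> partial_homotopy chi D S.
Proof.
elim: n => [|n [D [D0 hD]]].
  exists (fun=> 0); split=> // S /om_n0; rewrite -card_gt0 leqn0.
  by rewrite lt0n => /negPf ->.
have step (S : {set V}) : om S != 0 -> #|S| = n.+1 -> exists y : ealg V',
    [/\ homog n.+2 y, inlat (Gam S) (om S *: y) &
      dl y = chi (ebasis S) - ext D (dl (ebasis S))].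
  (* The obstruction cycle, scaled into the lattice [Gam S]. On a face the induction gives
     integrality after scaling by [om (S :\ v)], which divides [om S]. *)
  move=> S0 Sn; pose z := om S *: (chi (ebasis S) - ext D (dl (ebasis S))).
  have face v : v \in S -> D (S :\ v) = 0 /\ S :\ v = set0 \/
      om (S :\ v) != 0 /\ partial_homotopy chi D (S :\ v).
    move=> vS; have [e|Sv0] := eqVneq (S :\ v) set0; first by left; rewrite e.
    right; have o := om_face S0 vS Sv0; split => //; apply: hD => //.
    by have := cardsD1 v S; rewrite Sn vS => -[->].
  have extE : ext D (dl (ebasis S)) = \sum_(v in S) sgn v S *: D (S :\ v).
    by rewrite dl_ebasis ext_sum; apply: eq_bigr => v _; rewrite linearZ/= ext_ebasis.
  have zl : inlat (Gam S) z.
    rewrite /z scalerBr; apply: inlatD; first exact: chil.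
    apply: inlatN; rewrite extE scaler_sumr; apply: inlat_sum => v vS.
    rewrite scalerA mulrC -scalerA => T; rewrite ffunE; apply: dvdq_sign; move: T.
    case: (face v vS) => [[-> _]|[o [_ il _]]]; first by rewrite scaler0; exact: inlat0.
    have Sv0 := om_n0 o.
    have [k ->] : dvdq (om (S :\ v)) (om S) by case: cpx_om => _; apply.
    rewrite -scalerA; apply: inlatZ; apply: inlat_mono il => T.
    exact: Gam_mono.
  have zh : homog n.+1 z.
    apply/homogZ/homogB; first by rewrite -Sn; exact: chih.
    rewrite extE; apply: homog_sum => v vS; apply: homogZ.
    case: (face v vS) => [[-> _]|[_ [h _ _]]]; first exact: homog0.
    by move: h; have := cardsD1 v S; rewrite Sn vS => -[->].
  have zd : dl z = 0.
    rewrite /z linearZ /= linearB /= chid// extE [dl (\sum_(_ in _) _)]linear_sum /=.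
    rewrite [X in _ - X](_ : _ = chi (dl (ebasis S)) - ext D (dl (dl (ebasis S)))).
      by rewrite dl_dl linear0 subr0 subrr scaler0.
    rewrite dl_ebasis (linear_sum chi) dl_sum ext_sum -sumrB; apply: eq_bigr => v vS.
    rewrite !dlZ extZ [chi _]linearZ /= -scalerBr; congr (_ *: _).
    case: (face v vS) => [[-> ->]|[_ [_ _ ->]] //].
    by rewrite chi0 dl_ebasis0 [ext D 0]linear0 [dl 0]linear0 subrr.
  have [y [yl yh yd]] := Gam_acyclic S0 (ltn0Sn n) zl zh zd.
  exists ((om S)^-1 *: y); split; first exact: homogZ.
    by rewrite scalerA divff// scale1r.
  by rewrite linearZ /= yd scalerA mulVf// scale1r.
have [E hE] : exists E : {set V} -> ealg V', forall S, om S != 0 -> #|S| = n.+1 ->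
    [/\ homog n.+2 (E S), inlat (Gam S) (om S *: E S) &
      dl (E S) = chi (ebasis S) - ext D (dl (ebasis S))].
  have : forall S, exists y : ealg V', om S != 0 -> #|S| = n.+1 ->
      [/\ homog n.+2 y, inlat (Gam S) (om S *: y) &
        dl y = chi (ebasis S) - ext D (dl (ebasis S))].
    move=> S; have [o|o] := eqVneq (om S) 0; first by exists 0.
    have [Sn|Sn] := eqVneq #|S| n.+1; last by exists 0 => _ e; rewrite e eqxx in Sn.
    by have [y hy] := step S o Sn; exists y.
  by move=> /choice[E hE]; exists E.
pose D' (S : {set V}) := if #|S| == n.+1 then E S else D S.
have D'D (S : {set V}) : (#|S| <= n.+1)%N -> ext D' (dl (ebasis S)) = ext D (dl (ebasis S)).
  move=> Sn; rewrite dl_ebasis !linear_sum; apply: eq_bigr => v vS.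
  rewrite !linearZ /= !ext_ebasis /D'; case: eqP => // e.
  by move: Sn; rewrite (cardsD1 v) vS e add1n ltnn.
exists D'; split; first by rewrite /D' cards0.
move=> S S0 Sn; rewrite /partial_homotopy D'D// /D'; case: eqP => [e|/eqP ne].
  by rewrite e; exact: hE.
by apply: hD => //; rewrite -ltnS ltn_neqAle ne.
Qed.

Lemma carrier_bounds n z : (0 < n)%N -> Zc om n z -> Bc om' n (chi z).
Proof.
move=> n0 Zz; have [zl zh _] := Zz.
have [D [D0 hD]] := exists_homotopy #|V|.
have zS S : z S != 0 -> om S != 0.
  by apply: contraNneq => e; apply/eqP/dvd0q; rewrite -e; exact: zl.
have {}hD S : z S != 0 -> partial_homotopy chi D S.
  by move=> /zS S0; apply: hD => //; exact: max_card.
exists (ext D z); split.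
- apply: inlat_sum => S _; have [->|zS0] := eqVneq (z S) 0.
    by rewrite scale0r; exact: inlat0.
  have [_ il _] := hD _ zS0; have [k ->] := zl S; rewrite -scalerA; apply: inlatZ.
  by apply: inlat_mono il => T; exact/Gam_om'/zS.
- apply: homog_sum => S _; have [->|zS0] := eqVneq (z S) 0.
    by rewrite scale0r; exact: homog0.
  by apply: homogZ; have [h _ _] := hD _ zS0; rewrite -(zh _ zS0).
- have : ext D (dl z) = 0 by rewrite (Zc_dl Zz) linearZ /= ext_ebasis D0 scaler0.
  have dzE : dl z = \sum_S z S *: dl (ebasis S).
    by rewrite {1}(ealg_sum z) dl_sum; apply: eq_bigr => S _; rewrite dlZ.
  have chiE : chi z = \sum_S z S *: chi (ebasis S).
    by rewrite {1}(ealg_sum z) [LHS]linear_sum; apply: eq_bigr => S _; rewrite linearZ.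
  rewrite -[dl (ext D z)]addr0 => <-; rewrite {1}/ext dl_sum dzE ext_sum chiE -big_split.
  apply: eq_bigr => S _ /=; have [->|zS0] := eqVneq (z S) 0.
    by rewrite !scale0r [dl 0]linear0 [ext D 0]linear0 addr0.
  by have [_ _ e] := hD _ zS0; rewrite dlZ extZ e -scalerDr subrK.
Qed.

End Carrier.

(** The carrier of [S] is a whole lattice, described by the weight [Gam S], and not just a
    subcomplex. Monotonicity means that the lattice carried by a face is contained in the one
    carried by [S]. *)
Lemma carrier_homotopic (V V' : finType) (om : {set V} -> rat) (om' : {set V'} -> rat)
    (Gam : {set V} -> {set V'} -> rat) (phi psi : ealg V -> ealg V') :
  is_cpx om -> (forall S, om S != 0 -> acyclic (Gam S)) ->
  (forall S v T, om S != 0 -> v \in S -> S :\ v != set0 ->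
    dvdq (Gam S T) (Gam (S :\ v) T)) ->
  (forall S T, om S != 0 -> dvdq (om' T) (Gam S T)) ->
  cmap om om' phi -> cmap om om' psi ->
  (forall S, om S != 0 -> inlat (Gam S) (phi (om S *: ebasis S))) ->
  (forall S, om S != 0 -> inlat (Gam S) (psi (om S *: ebasis S))) ->
  homotopic om om' phi psi.
Proof.
move=> cpx ac mono Go' cphi cpsi lphi lpsi n z n0 Zz.
have [[fl f0 _ fh fd] [gl g0 _ gh gd]] := (cphi, cpsi).
have lchi : linear (fun c => phi c - psi c).
  by move=> k x y; rewrite fl gl opprD addrACA -scalerBr.
pose chi : {linear ealg V -> ealg V'} :=
  HB.pack (fun c => phi c - psi c) (GRing.isLinear.Build _ _ _ _ _ lchi).
have eb S : inlat om (om S *: ebasis S).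
  move=> T; rewrite !ffunE /GRing.scale /=; case: eqP => [->|_].
    by rewrite mulr1; exact: dvdq_refl.
  by rewrite mulr0; exact: dvdq0.
have ebE S : om S != 0 -> ebasis S = (om S)^-1 *: (om S *: ebasis S).
  by move=> S0; rewrite scalerA mulVf// scale1r.
apply: (@carrier_bounds _ _ om om' Gam cpx ac mono Go' chi _ _ _ _ n z n0 Zz) => /=.
- by rewrite f0 g0 subrr.
- have key (f : ealg V -> ealg V') S : linear f ->
      (forall c, inlat om c -> dl (f c) = f (dl c)) -> om S != 0 ->
      dl (f (ebasis S)) = f (dl (ebasis S)).
    move=> lf df S0; rewrite (ebE S S0) (linearZ_of _ _ lf) !dlZ df//.
    by rewrite dlZ -(linearZ_of _ _ lf).
  by move=> S S0; rewrite linearB /= !key.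
- move=> S S0; rewrite (ebE S S0) (linearZ_of _ _ fl) (linearZ_of _ _ gl).
  by apply: homogB; apply: homogZ; [apply: fh|apply: gh] => //;
     apply: homogZ; exact: homog_ebasis.
- move=> S S0; rewrite scalerBr -(linearZ_of _ _ fl) -(linearZ_of _ _ gl).
  by apply: inlatD; [exact: lphi|apply: inlatN; exact: lpsi].
Qed.

(** * Vertex weights and contiguity *)

Section MaxWeight.
Variables (V : finType) (a : V -> rat).
Hypothesis a_gt0 : forall v, 0 < a v.
Implicit Types (S T : {set V}).

(* On a chain for divisibility, the numerical maximum is the largest weight
   for divisibility; on the empty set it is 0. *)
Definition mx S : rat := \big[Num.max/0]_(v in S) a v.

Definition dvd_chain S : Prop := forall u v, u \in S -> v \in S ->
  dvdq (a u) (a v) \/ dvdq (a v) (a u).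

Lemma mx0 : mx set0 = 0.
Proof. by rewrite /mx big_set0. Qed.

Lemma mx_ge S v : v \in S -> a v <= mx S.
Proof. by move=> vS; rewrite /mx (bigD1 v)//= le_max lexx. Qed.

Lemma mx_mem S : S != set0 -> exists2 v, v \in S & mx S = a v.
Proof.
move=> /set0Pn[v0 v0S].
have : mx S = 0 \/ exists2 v, v \in S & mx S = a v.
  rewrite /mx; elim/big_ind: _; [by left| |by move=> v vS; right; exists v].
  by move=> x y hx hy; case: (leP x y).
by case=> // e; have := mx_ge v0S; rewrite e leNgt a_gt0.
Qed.

Lemma mx_gt0 S : S != set0 -> 0 < mx S.
Proof. by move=> /mx_mem[v _ ->]. Qed.

Lemma mx1 v : mx [set v] = a v.
Proof.
have [|w /set1P -> //] := @mx_mem [set v].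
by apply/set0Pn; exists v; rewrite set11.
Qed.

Lemma chain_le_dvd S u v : dvd_chain S -> u \in S -> v \in S ->
  a u <= a v -> dvdq (a u) (a v).
Proof.
move=> ch uS vS uv; case: (ch u v uS vS) => // d.
have e : a u = a v by apply/le_anti; rewrite uv dvdq_le.
by rewrite e; exact: dvdq_refl.
Qed.

Lemma dvdq_mx S v : dvd_chain S -> v \in S -> dvdq (a v) (mx S).
Proof.
move=> ch vS; have S0 : S != set0 by apply/set0Pn; exists v.
have [w wS e] := mx_mem S0; rewrite e; apply: chain_le_dvd ch _ _ _ => //.
by rewrite -e mx_ge.
Qed.

Lemma mx_dvdq S x : S != set0 -> (forall v, v \in S -> dvdq (a v) x) -> dvdq (mx S) x.
Proof. by move=> /mx_mem[v vS ->]; apply. Qed.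

Lemma exists_min S : S != set0 -> dvd_chain S ->
  exists2 u, u \in S & forall v, v \in S -> dvdq (a u) (a v).
Proof.
move=> /set0Pn[v0 v0S] ch; have [u uS um] := arg_minP a v0S.
by exists u => // v vS; apply: chain_le_dvd ch _ _ _ => //; exact: um.
Qed.

Lemma dvd_chain_sub S T : T \subset S -> dvd_chain S -> dvd_chain T.
Proof. by move=> /subsetP TS ch u v uT vT; apply: ch; exact: TS. Qed.

End MaxWeight.

Definition om_of (V : finType) (F : {set {set V}}) (a : V -> rat) (S : {set V}) : rat :=
  if S \in F then mx a S else 0.

Definition wcpx (V : finType) (F : {set {set V}}) (a : V -> rat) : Prop :=
  [/\ set0 \notin F,
      forall S T : {set V}, S \in F -> T \subset S -> T != set0 -> T \in F,
      forall v, 0 < a v & forall S, S \in F -> dvd_chain a S].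

Lemma om_of_subset (V : finType) (F F' : {set {set V}}) (a : V -> rat) S :
  F \subset F' -> dvdq (om_of F' a S) (om_of F a S).
Proof.
move=> /subsetP FF'; rewrite /om_of; case: (boolP (S \in F)) => [/FF' ->|_].
  exact: dvdq_refl.
exact: dvdq0.
Qed.

Section WeightedFamily.
Variables (V : finType) (F : {set {set V}}) (a : V -> rat).
Hypothesis wF : wcpx F a.
Implicit Types (S T : {set V}).

Lemma om_ofN0 S : om_of F a S != 0 -> S \in F.
Proof. by rewrite /om_of; case: ifP => //; rewrite eqxx. Qed.

Lemma om_of_mono S T : S \in F -> T \subset S -> T != set0 ->
  dvdq (om_of F a T) (om_of F a S).
Proof.
case: wF => F0 Ff a0 ch SF TS T0; rewrite /om_of SF (Ff _ _ SF TS T0).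
apply: mx_dvdq => // v vT; apply: dvdq_mx => //; first exact: ch.
by move/subsetP: TS => /(_ _ vT).
Qed.

Lemma is_cpx_om_of : is_cpx (om_of F a).
Proof.
split; first by rewrite /om_of mx0 if_same.
move=> S v vS Sv0; have [SF|SF] := boolP (S \in F).
  by apply: om_of_mono => //; rewrite subD1set.
by rewrite [X in dvdq _ X]/om_of (negPf SF); exact: dvdq0.
Qed.

End WeightedFamily.

(** By [dl_wedge] the chain [wedge u z] bounds [z], and it stays in the lattice because coning does
    not increase weights. Nonempty [S] suffice, as a chain of positive degree vanishes on the empty
    set. *)
Lemma acyclic_cone (V : finType) (om : {set V} -> rat) u :
  (forall S, S != set0 -> u \notin S -> dvdq (om (u |: S)) (om S)) -> acyclic om.
Proof.
move=> h n z n0 zl zh zd; exists (wedge u z); split.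
- apply: inlat_wedge zl => S zS; apply: h; apply: contraNneq zS => ->.
  by rewrite (homog_set0 n0 zh).
- exact: homog_wedge.
- by rewrite dl_wedge zd linear0 subr0.
Qed.

Definition subsets (V : finType) (S : {set V}) : {set {set V}} :=
  [set T | (T != set0) && (T \subset S)].

Lemma acyclic_subsets (V : finType) (a : V -> rat) (S : {set V}) :
  (forall v, 0 < a v) -> dvd_chain a S -> S != set0 -> acyclic (om_of (subsets S) a).
Proof.
move=> a0 ch S0; have [u uS um] := exists_min a0 S0 ch.
apply: (acyclic_cone (u := u)) => T T0 uT; rewrite /om_of !inE T0 /= subUset sub1set uS.
case: (boolP (T \subset S)) => TS; last exact: dvdq0.
rewrite (_ : _ != _ = true) /=; last by apply/set0Pn; exists u; rewrite setU11.
apply: mx_dvdq => //; first by apply/set0Pn; exists u; rewrite setU11.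
have chT := dvd_chain_sub TS ch.
move=> v /setU1P[->|vT]; last exact: dvdq_mx.
have /set0Pn[w wT] := T0; apply: dvdq_trans (dvdq_mx a0 chT wT).
by apply: um; move/subsetP: TS; apply.
Qed.

Section PushLattice.
Variables (V V' : finType) (rho : V -> V').

Lemma homog_orient (U : finType) (s : seq U) : homog (size s) (orient s).
Proof.
elim: s => [|x s IH] /=; last exact: homog_wedge.
by have := @homog_ebasis U set0; rewrite cards0.
Qed.

Lemma epush_ebasisE S : epush rho (ebasis S) =
  if uniq (map rho (enum S))
  then (-1) ^+ inversions (map rho (enum S)) *: ebasis (rho @: S) else 0.
Proof.
rewrite epush_ebasis orientE; case: ifP => // _; congr (_ *: ebasis _).
apply/setP => v; rewrite inE; apply/mapP/imsetP => [[x]|[x xS ->]].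
  by rewrite mem_enum => xS ->; exists x.
by exists x; rewrite ?mem_enum.
Qed.

Lemma homog_epush n c : homog n c -> homog n (epush rho c).
Proof.
move=> hc; apply: homog_ext hc _ => S <-.
have := @homog_orient V' (map rho (enum S)).
by rewrite size_map -cardE -epush_ebasis /epush ext_ebasis.
Qed.

Lemma inlat_epush (om : {set V} -> rat) (om' : {set V'} -> rat) c :
  (forall S : {set V}, dvdq (om' (rho @: S)) (om S)) ->
  inlat om c -> inlat om' (epush rho c).
Proof.
move=> h hc; rewrite (ealg_sum c) epush_sum; apply: inlat_sum => S _.
rewrite epushZ epush_ebasisE; case: ifP => _; last first.
  by rewrite scaler0; exact: inlat0.
move=> T; rewrite !ffunE /GRing.scale /=; case: eqP => [->|_]; last first.
  by rewrite !mulr0; exact: dvdq0.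
by rewrite mulr1 mulrC; apply: dvdq_sign; exact: dvdq_trans (h S) (hc S).
Qed.

Lemma inlat_single (U : finType) (q : rat) (S : {set U}) :
  inlat (fun T => if T == S then q else 0) (q *: ebasis S).
Proof.
move=> T; rewrite !ffunE /GRing.scale /=; case: eqP => _; last by rewrite mulr0; exact: dvdq0.
by rewrite mulr1; exact: dvdq_refl.
Qed.

Lemma inlat_epush_single (om' : {set V'} -> rat) q (S : {set V}) : dvdq (om' (rho @: S)) q ->
  inlat om' (epush rho (q *: ebasis S)).
Proof.
move=> h; apply: inlat_epush (inlat_single q S) => T.
by case: eqP => [->//|_]; exact: dvdq0.
Qed.

Lemma cmap_epush F F' a a' : wcpx F a -> wcpx F' a' ->
  (forall S : {set V}, S \in F -> rho @: S \in F') ->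
  (forall (S : {set V}) v, S \in F -> v \in S -> dvdq (a' (rho v)) (a v)) ->
  cmap (om_of F a) (om_of F' a') (epush rho).
Proof.
move=> [F0 _ a0 ch] [F'0 _ a'0 ch'] hF ha; split.
- by move=> k x y; rewrite linearP.
- exact: epush0.
- move=> c; apply: inlat_epush => S; rewrite /om_of.
  case: (boolP (S \in F)) => SF; last exact: dvdq0.
  rewrite hF//; apply: mx_dvdq => //; first by apply: contraNneq F'0 => <-; exact: hF.
  move=> _ /imsetP[v vS ->]; apply: dvdq_trans (ha _ _ SF vS) _.
  by apply: dvdq_mx => //; exact: ch.
- by move=> n c _; exact: homog_epush.
- by move=> c _; rewrite epush_dl.
Qed.

End PushLattice.

(** Both maps are carried by the faces of the simplex spanned by the two images of [S], which is
    acyclic by [acyclic_subsets]. *)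
Lemma contiguous_homotopic (V V' : finType) (r0 r1 : V -> V') F F' a a' :
  wcpx F a -> wcpx F' a' ->
  (forall S : {set V}, S \in F -> (r0 @: S) :|: (r1 @: S) \in F') ->
  (forall (S : {set V}) v, S \in F -> v \in S -> dvdq (a' (r0 v)) (a v)) ->
  (forall (S : {set V}) v, S \in F -> v \in S -> dvdq (a' (r1 v)) (a v)) ->
  homotopic (om_of F a) (om_of F' a') (epush r0) (epush r1).
Proof.
move=> wF wF' hF h0 h1; have [[F0 Ff a0 ch] [F'0 F'f a'0 ch']] := (wF, wF').
have n0 (S : {set V}) : S \in F -> S != set0 by move=> SF; apply: contraNneq F0 => <-.
have im0 (r : V -> V') (S : {set V}) : S \in F -> r @: S != set0.
  by move=> /n0 /set0Pn[v vS]; apply/set0Pn; exists (r v); exact: imset_f.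
pose G (S : {set V}) := om_of (subsets ((r0 @: S) :|: (r1 @: S))) a'.
apply: (carrier_homotopic (Gam := G)).
- exact: is_cpx_om_of.
- move=> S /om_ofN0 SF; have S'F := hF _ SF; refine (acyclic_subsets a'0 (ch' _ S'F) _).
  by apply: contraNneq F'0 => <-.
- move=> S v T _ vS _; apply: om_of_subset; apply/subsetP => W; rewrite !inE.
  case/andP=> ->/= WS; apply: subset_trans WS _.
  by apply: setUSS; apply: imsetS; exact: subD1set.
- move=> S T /om_ofN0 SF; apply: om_of_subset; apply/subsetP => W; rewrite inE.
  by case/andP=> W0 WS; exact: F'f (hF _ SF) WS W0.
- apply: cmap_epush => // S SF; apply: F'f (hF _ SF) _ (im0 _ _ SF).
  exact: subsetUl.
- apply: cmap_epush => // S SF; apply: F'f (hF _ SF) _ (im0 _ _ SF).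
  exact: subsetUr.
- move=> S /om_ofN0 SF; apply: inlat_epush_single; rewrite /G /om_of SF inE im0// subsetUl.
  by apply: mx_dvdq; rewrite ?im0// => _ /imsetP[v vS ->]; apply: dvdq_trans (h0 _ _ SF vS) _;
     apply: dvdq_mx => //; exact: ch.
- move=> S /om_ofN0 SF; apply: inlat_epush_single; rewrite /G /om_of SF inE im0// subsetUr.
  by apply: mx_dvdq; rewrite ?im0// => _ /imsetP[v vS ->]; apply: dvdq_trans (h1 _ _ SF vS) _;
     apply: dvdq_mx => //; exact: ch.
Qed.

(** * Barycentric subdivision *)

Lemma simps_neq0 (K : complex) (S : {set vert K}) : S \in simps K -> S != set0.
Proof. by move=> SK; apply: contraNneq (simps_n0 K) => <-. Qed.

Lemma simplex_neq0 (K : complex) (s : simplex K) : val s != set0.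
Proof. exact: simps_neq0 (valP s). Qed.

Section Subdivision.
Variable K : complex.
Implicit Types (S : {set vert K}) (s : simplex K) (T : {set vert (Sd K)}).

(** Starting the recursion at the empty simplex makes the subdivision of a vertex an instance of the
    cone formula. *)
Fixpoint esd_rec (n : nat) S : ealg (vert (Sd K)) :=
  if n is n'.+1 then
    if insub S is Some s then
      wedge (s : vert (Sd K)) (ext (esd_rec n') (dl (ebasis S)))
    else 0
  else ebasis set0.

Definition esd : ealg (vert K) -> ealg (vert (Sd K)) :=
  ext (fun S => esd_rec #|S| S).
HB.instance Definition _ := GRing.Linear.on esd.

Lemma esdZ k c : esd (k *: c) = k *: esd c.
Proof. exact: linearZ. Qed.

Lemma esd_sum (I : Type) (r : seq I) (P : pred I) (F : I -> ealg (vert K)) :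
  esd (\sum_(i <- r | P i) F i) = \sum_(i <- r | P i) esd (F i).
Proof. exact: linear_sum. Qed.

Lemma esd_empty : esd (ebasis set0) = ebasis set0.
Proof. by rewrite /esd ext_ebasis cards0. Qed.

Lemma esd_simplex s :
  esd (ebasis (val s)) = wedge (s : vert (Sd K)) (esd (dl (ebasis (val s)))).
Proof.
rewrite {1}/esd ext_ebasis; have := simplex_neq0 s; rewrite -card_gt0.
case E: #|val s| => [//|n] _ /=; rewrite valK; congr (wedge _ _).
rewrite /esd dl_ebasis !ext_sum; apply: eq_bigr => v vs.
by rewrite !extZ !ext_ebasis; have := cardsD1 v (val s); rewrite E vs add1n => -[->].
Qed.

(** By [dl_wedge] the boundary of the cone is its base minus the cone over the boundary of the base;
    the latter vanishes by induction and [dl_dl]. *)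
Lemma esd_dl_ebasis S : S \in simps K -> dl (esd (ebasis S)) = esd (dl (ebasis S)).
Proof.
elim/set_card_ind: S => S IH SK.
have -> : S = val (exist _ S SK : simplex K) by [].
set s : simplex K := exist _ _ _.
rewrite esd_simplex dl_wedge (_ : dl (esd _) = 0).
  by rewrite [wedge _ 0]linear0 subr0.
rewrite -[val s]/S {s}.
rewrite (_ : dl _ = esd (dl (dl (ebasis S)))); first by rewrite dl_dl [esd 0]linear0.
rewrite dl_ebasis !esd_sum !dl_sum esd_sum; apply: eq_bigr => v vS.
rewrite esdZ !dlZ esdZ; congr (_ *: _).
have [->|Sv0] := eqVneq (S :\ v) set0.
  by rewrite esd_empty !dl_ebasis0 [esd 0]linear0.
apply: IH; first by rewrite [in ltnRHS](cardsD1 v) vS.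
by apply: simps_face SK _ Sv0; exact: subD1set.
Qed.

Lemma homog_esd n c : homog n c -> homog n (esd c).
Proof.
suff h m S : #|S| = m -> homog m (esd_rec m S).
  by move=> hc; apply: homog_ext hc _ => S <-; exact: h.
elim: m S => [|m IH] S Sm /=.
  by have := @homog_ebasis (vert (Sd K)) set0; rewrite cards0.
case: insubP => [s _ _|_]; last exact: homog0.
apply: homog_wedge; apply: homog_ext IH; apply: homog_dl.
by rewrite -Sm; exact: homog_ebasis.
Qed.

Definition sdfaces S : {set {set vert (Sd K)}} :=
  [set T in simps (Sd K) | [forall s in T, val (s : simplex K) \subset S]].

Lemma sdfacesP S T : reflect
  (T \in simps (Sd K) /\ forall s : simplex K, s \in T -> val s \subset S)
  (T \in sdfaces S).
Proof.
apply: (iffP setIdP) => [[TK /forall_inP h]|[TK h]].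
  by split=> // s; exact: h.
by split=> //; apply/forall_inP.
Qed.

Lemma simps_SdP T : reflect (T != set0 /\ forall s s' : simplex K, s \in T -> s' \in T ->
    (val s \subset val s') || (val s' \subset val s)) (T \in simps (Sd K)).
Proof.
rewrite inE; apply: (iffP andP) => -[T0 h]; split=> //.
  by move=> s s' sT s'T; move/forall_inP: h => /(_ _ sT)/forall_inP; apply.
by apply/forall_inP => s sT; apply/forall_inP => s' s'T; exact: h.
Qed.

Lemma sdfaces_mono S S' : S \subset S' -> sdfaces S \subset sdfaces S'.
Proof.
move=> SS'; apply/subsetP => T /sdfacesP[TK h]; apply/sdfacesP; split=> // s sT.
exact: subset_trans (h s sT) SS'.
Qed.

Lemma sdfaces_face S T T' : T \in sdfaces S -> T' \subset T -> T' != set0 ->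
  T' \in sdfaces S.
Proof.
move=> /sdfacesP[TK h] T'T T'0; apply/sdfacesP; split.
  exact: simps_face TK T'T T'0.
by move=> s sT'; apply: h; move/subsetP: T'T; apply.
Qed.

(** The weights 1 and 0 say two things at once: the coefficients are integers, and the simplices
    that occur lie in the subdivision of [S]. *)
Lemma esd_supp S : S \in simps K ->
  inlat (fun T => if T \in sdfaces S then 1 else 0) (esd (ebasis S)).
Proof.
elim/set_card_ind: S => S IH SK.
have eS : S = val (exist _ S SK : simplex K) by [].
rewrite {2}eS esd_simplex -eS; set s : simplex K := exist _ _ _.
(* If [S] is a vertex, its boundary is the empty simplex, hence the extra alternative [T == set0] in
   the source lattice. *)
apply: (inlat_wedge
  (om := fun T => if (T == set0) || (T \in sdfaces S) then 1 else 0)) => [T _ _|].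
  case: ifPn => [_|]; first by case: ifP => _; [exact: dvdq_refl|exact: dvdq0].
  move=> nU; case: ifPn => [|_]; last exact: dvdq0.
  move=> h; exfalso; move/negP: nU; apply; apply/sdfacesP; split; last first.
    move=> s' /setU1P[->//|s'T]; move: h => /orP[/eqP e|/sdfacesP[_]]; last exact.
    by rewrite e inE in s'T.
  have h1 s' : s' \in T -> val s' \subset S.
    by move: h => /orP[/eqP->|/sdfacesP[_] h' /h' //]; rewrite inE.
  have h2 (s1 s2 : simplex K) : s1 \in T -> s2 \in T ->
      (val s1 \subset val s2) || (val s2 \subset val s1).
    move: h => /orP[/eqP->|/sdfacesP[/simps_SdP[_ h'] _]]; last exact: h'.
    by rewrite inE.
  apply/simps_SdP; split; first by apply/set0Pn; exists s; rewrite setU11.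
  move=> s1 s2 /setU1P[->|s1T] /setU1P[->|s2T]; rewrite ?subxx//.
  - by rewrite [val s2 \subset _]h1 ?orbT.
  - by rewrite [val s1 \subset _]h1.
  - exact: h2.
clear s eS; rewrite dl_ebasis esd_sum; apply: inlat_sum => v vS.
rewrite esdZ => T; rewrite ffunE; apply: dvdq_sign; move: T.
have [->|Sv0] := eqVneq (S :\ v) set0.
  rewrite esd_empty => T; rewrite ffunE; case: eqP => // _; first exact: dvdq_refl.
  exact: dvdq0.
have SvK : S :\ v \in simps K by apply: simps_face SK _ Sv0; exact: subD1set.
have c : (#|S :\ v| < #|S|)%N by rewrite [in ltnRHS](cardsD1 v) vS.
apply: inlat_mono (IH _ c SvK) => T.
case: (boolP (T \in sdfaces (S :\ v))) => h; last exact: dvdq0.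
rewrite (subsetP (sdfaces_mono (subD1set S v)) _ h) orbT; exact: dvdq_refl.
Qed.

Lemma inlat_esd_single om' q S : S \in simps K ->
  (forall T, T \in sdfaces S -> dvdq (om' T) q) -> inlat om' (esd (q *: ebasis S)).
Proof.
move=> SK h T; rewrite esdZ ffunE /GRing.scale /=.
have := esd_supp SK T; case: ifPn => [TS|_]; last by move=> /dvd0q ->; rewrite mulr0; exact: dvdq0.
by move=> [k ->]; rewrite mulr1 mulrC; apply/dvdqMz/h.
Qed.

Section Weights.
Variables (a : vert K -> rat) (al : vert (Sd K) -> rat).

(* Holds both for the largest and for the smallest vertex weight of a simplex. *)
Definition sd_weight : Prop :=
  [/\ forall s : simplex K, 0 < al s,
      forall s s' : simplex K, val s \subset val s' ->
        dvdq (al s) (al s') \/ dvdq (al s') (al s),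
      forall s : simplex K, dvdq (al s) (mx a (val s)),
      forall (s : simplex K) u, u \in val s ->
        (forall v, v \in val s -> dvdq (a u) (a v)) -> dvdq (a u) (al s) &
      forall (s s' : simplex K) u, val s' = u |: val s ->
        (forall v, v \in val s -> dvdq (a u) (a v)) -> dvdq (al s') (al s)].

Hypothesis wK : wcpx (simps K) a.
Hypothesis sw : sd_weight.

Lemma wcpx_Sd : wcpx (simps (Sd K)) al.
Proof.
case: sw => al0 alc _ _ _; split=> //; first exact: simps_n0.
  by move=> S T; exact: simps_face.
move=> T /simps_SdP[_ h] s s' sT s'T; case/orP: (h _ _ sT s'T) => ss'.
  exact: alc.
by case: (alc _ _ ss'); [right|left].
Qed.

Lemma wcpx_sdfaces S : wcpx (sdfaces S) al.
Proof.
have [F0 _ al0 ch] := wcpx_Sd; split=> //.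
- by apply: contra F0 => /sdfacesP[].
- by move=> T T'; exact: sdfaces_face.
- by move=> T /sdfacesP[TK _]; exact: ch.
Qed.

Lemma mx_al_dvd S T : S \in simps K -> T \in sdfaces S -> dvdq (mx al T) (mx a S).
Proof.
have [_ _ a0 ch] := wK; have [al0 _ alm _ _] := sw.
move=> SK /sdfacesP[TK h]; apply: mx_dvdq => //; first exact: simps_neq0.
move=> s sT; apply: dvdq_trans (alm s) _; apply: mx_dvdq => //.
  exact: simplex_neq0.
move=> v vs; apply: dvdq_mx => //; first exact: ch.
by move/subsetP: (h _ sT); apply.
Qed.

Lemma cmap_esd : cmap (om_of (simps K) a) (om_of (simps (Sd K)) al) esd.
Proof.
have supp c S : inlat (om_of (simps K) a) c -> c S != 0 -> S \in simps K.
  move=> cl; apply: contraNT => SK; apply/eqP/dvd0q.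
  by have := cl S; rewrite /om_of (negPf SK).
split.
- by move=> k x y; rewrite linearP.
- exact: esd_empty.
- move=> c cl; rewrite (ealg_sum c) esd_sum; apply: inlat_sum => S _.
  have [->|/(supp _ _ cl) SK] := eqVneq (c S) 0.
    by rewrite scale0r [esd 0]linear0; exact: inlat0.
  apply: inlat_esd_single => // T TS; apply: dvdq_trans (cl S).
  rewrite /om_of SK; have /sdfacesP[-> _] := TS; exact: mx_al_dvd.
- by move=> n c _; exact: homog_esd.
- move=> c cl; rewrite (ealg_sum c) esd_sum !dl_sum esd_sum; apply: eq_bigr => S _.
  rewrite esdZ !dlZ esdZ; have [->|/(supp _ _ cl) SK] := eqVneq (c S) 0.
    by rewrite !scale0r.
  by rewrite esd_dl_ebasis.
Qed.

Section Collapse.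
Variable pi : vert (Sd K) -> vert K.
Hypothesis pi_mem : forall s : simplex K, pi s \in val s.
Hypothesis pi_dvd : forall s : simplex K, dvdq (a (pi s)) (al s).

Lemma pi_sub S T : T \in sdfaces S -> pi @: T \subset S.
Proof.
move=> /sdfacesP[_ h]; apply/subsetP => _ /imsetP[s sT ->].
by move/subsetP: (h s sT); apply.
Qed.

Lemma simps_neq0_im T : T \in simps (Sd K) -> pi @: T != set0.
Proof.
by move=> /simps_neq0/set0Pn[s sT]; apply/set0Pn; exists (pi s); exact: imset_f.
Qed.

Definition sdtop T : {set vert K} := \bigcup_(s in T) val (s : simplex K).

Lemma sdtop_mem T : T \in simps (Sd K) -> exists2 s : simplex K, s \in T & val s = sdtop T.
Proof.
move=> /simps_SdP[/set0Pn[s0 s0T] h].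
have [s sT sm] := arg_maxnP (fun s : simplex K => #|val s|) s0T.
exists s => //; apply/eqP; rewrite eqEsubset; apply/andP; split.
  exact: (bigcup_sup s).
apply/bigcupsP => s' s'T; case/orP: (h _ _ sT s'T) => // ss'.
have /eqP -> : val s == val s' by rewrite eqEcard ss' [(_ <= _)%N]sm.
by [].
Qed.

Lemma sdtop_simps T : T \in simps (Sd K) -> sdtop T \in simps K.
Proof. by move=> /sdtop_mem[s _ <-]; exact: valP. Qed.

Lemma sdfaces_sdtop T : T \in simps (Sd K) -> T \in sdfaces (sdtop T).
Proof. by move=> TK; apply/sdfacesP; split=> // s sT; exact: (bigcup_sup s). Qed.

Lemma pi_simps T : T \in simps (Sd K) -> pi @: T \in simps K.
Proof.
move=> TK; apply: simps_face (sdtop_simps TK) _ (simps_neq0_im TK).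
exact/pi_sub/sdfaces_sdtop.
Qed.

Lemma cmap_pi : cmap (om_of (simps (Sd K)) al) (om_of (simps K) a) (epush pi).
Proof.
apply: (cmap_epush wcpx_Sd wK) => [T|T s _ _]; first exact: pi_simps.
exact: pi_dvd.
Qed.

(** Both maps are carried by the faces of [S]: subdividing stays inside [S], and [pi] sends [b_s] to
    a vertex of [s]. *)
Lemma pi_esd_homotopic :
  homotopic (om_of (simps K) a) (om_of (simps K) a) (epush pi \o esd) id.
Proof.
have [F0 Ff a0 ch] := wK.
apply: (carrier_homotopic (Gam := fun S => om_of (subsets S) a)).
- exact: is_cpx_om_of.
- move=> S /om_ofN0 SK; refine (acyclic_subsets a0 (ch _ SK) _).
  exact: simps_neq0.
- move=> S v T _ vS _; apply: om_of_subset; apply/subsetP => W; rewrite !inE.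
  by case/andP=> ->/= WS; apply: subset_trans WS _; exact: subD1set.
- move=> S T /om_ofN0 SK; apply: om_of_subset; apply/subsetP => W; rewrite inE.
  by case/andP=> W0 WS; exact: Ff SK WS W0.
- exact: cmap_comp cmap_esd cmap_pi.
- exact: cmap_id.
- move=> S /om_ofN0 SK /=; rewrite [in om_of _ _ _]/om_of SK.
  apply: (inlat_epush (om := fun T => if T \in sdfaces S then mx a S else 0)).
    move=> T; case: (boolP (T \in sdfaces S)) => TS; last exact: dvdq0.
    have /sdfacesP[TK _] := TS.
    rewrite /om_of inE (simps_neq0_im TK) (pi_sub TS).
    apply: mx_dvdq => //; first exact: simps_neq0_im.
    move=> v vT; apply: dvdq_mx => //; first exact: ch.
    by move/subsetP: (pi_sub TS); apply.
  by apply: inlat_esd_single => // T ->; exact: dvdq_refl.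
- move=> S /om_ofN0 SK T; rewrite /= !ffunE /GRing.scale /=; case: eqP => [->|_].
    rewrite mulr1 /om_of SK inE subxx simps_neq0//; exact: dvdq_refl.
  by rewrite mulr0; exact: dvdq0.
Qed.

End Collapse.
End Weights.
End Subdivision.

(** * Acyclicity of the subdivision of a simplex *)

Section SubdividedSimplex.
Variables (K : complex) (a : vert K -> rat) (al : vert (Sd K) -> rat).
Hypothesis wK : wcpx (simps K) a.
Hypothesis sw : sd_weight a al.
Variables (tau : {set vert K}) (u : vert K).
Hypothesis tauK : tau \in simps K.
Hypothesis u_tau : u \in tau.
Hypothesis u_min : forall v, v \in tau -> dvdq (a u) (a v).
Implicit Types (s : simplex K) (T : {set vert (Sd K)}).

(** Joining [u] to all faces of [tau] at once is not contiguous to the identity: for [s0] inside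
    [s1], the sets [u |: s0] and [s1] need not be comparable. So [u] is joined to the faces with at
    least [j] vertices, and [j] is changed one unit at a time. *)
Definition join_u j s : simplex K :=
  if (val s \subset tau) && (j <= #|val s|)%N then insubd s (u |: val s) else s.

Lemma val_join_u j s : val s \subset tau ->
  val (join_u j s) = if (j <= #|val s|)%N then u |: val s else val s.
Proof.
move=> st; rewrite /join_u st /=; case: ifP => // _.
rewrite val_insubd; case: ifPn => // /negP[].
apply: simps_face tauK _ _; first by rewrite subUset sub1set u_tau.
by apply/set0Pn; exists u; rewrite setU11.
Qed.

(** Between stages [j] and [j.+1] only faces with exactly [j] vertices change. An incomparable pair
    [u |: s], [s'] with [s] properly inside [s'] would need [j <= #|s| < #|s'| <= j]. *)
Lemma join_u_compare j s s' x y :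
  val s \subset tau -> val s' \subset tau -> val s \subset val s' ->
  x \in [:: join_u j s; join_u j.+1 s] -> y \in [:: join_u j s'; join_u j.+1 s'] ->
  (val x \subset val y) || (val y \subset val x).
Proof.
move=> st s't ss' xs ys.
have vx (i : nat) (z z' : simplex K) : val z \subset tau -> z' \in [:: join_u i z; join_u i.+1 z] ->
    val z' = val z /\ (#|val z| <= i)%N \/ val z' = u |: val z /\ (i <= #|val z|)%N.
  move=> zt; rewrite !inE => /orP[]/eqP ->; rewrite val_join_u//; case: ifPn => h.
  - by right.
  - by left; split=> //; apply: ltnW; rewrite ltnNge.
  - by right; split=> //; exact: ltnW.
  - by left; split=> //; rewrite leqNgt.
have sU z (A : {set vert K}) : A \subset z |: A by exact: subsetUr.
have [e|ne] := eqVneq (val s) (val s').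
  case: (vx _ _ _ st xs) => -[-> _]; case: (vx _ _ _ s't ys) => -[-> _];
  by rewrite e ?subxx ?sU ?orbT.
have lt : (#|val s| < #|val s'|)%N by apply: proper_card; rewrite properEneq ne.
case: (vx _ _ _ st xs) => -[-> hx]; case: (vx _ _ _ s't ys) => -[-> hy].
- by rewrite ss'.
- by rewrite (subset_trans ss').
- by move: (leq_trans (leq_ltn_trans hx lt) hy); rewrite ltnn.
- by rewrite setUS.
Qed.

Lemma join_u_sub j s : val s \subset tau -> val (join_u j s) \subset tau.
Proof.
move=> st; rewrite val_join_u//; case: ifP => // _.
by rewrite subUset sub1set u_tau.
Qed.

Lemma join_u_simps j T : T \in sdfaces tau ->
  (join_u j @: T) :|: (join_u j.+1 @: T) \in sdfaces tau.
Proof.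
move=> /sdfacesP[/simps_SdP[T0 h] ht].
have mem x : x \in (join_u j @: T) :|: (join_u j.+1 @: T) ->
    exists2 s, s \in T & x \in [:: join_u j s; join_u j.+1 s].
  by case/setUP => /imsetP[s sT ->]; exists s; rewrite // !inE eqxx ?orbT.
apply/sdfacesP; split; last first.
  move=> x /mem[s sT]; rewrite !inE => /orP[]/eqP ->; exact/join_u_sub/ht.
apply/simps_SdP; split.
  by case/set0Pn: T0 => s sT; apply/set0Pn; exists (join_u j s); rewrite inE imset_f.
move=> x y /mem[s sT xs] /mem[s' s'T ys]; case/orP: (h _ _ sT s'T) => ss'.
  by apply: join_u_compare ss' xs ys; exact: ht.
by rewrite orbC; apply: join_u_compare ss' ys xs; exact: ht.
Qed.

Lemma join_u_dvd j s : val s \subset tau -> dvdq (al (join_u j s)) (al s).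
Proof.
move=> st; case: (leqP j #|val s|) => jl; last first.
  by rewrite /join_u st leqNgt jl /=; exact: dvdq_refl.
case: sw => _ _ _ _; apply; last by move=> v vs; apply: u_min; move/subsetP: st; apply.
by rewrite val_join_u// jl.
Qed.

Lemma join_u_homotopic j :
  homotopic (om_of (sdfaces tau) al) (om_of (sdfaces tau) al)
    (epush (join_u j : vert (Sd K) -> vert (Sd K))) (epush (join_u j.+1)).
Proof.
have wF := wcpx_sdfaces sw tau.
apply: (contiguous_homotopic wF wF) => [T|T s /sdfacesP[_ h] sT|T s /sdfacesP[_ h] sT].
- exact: join_u_simps.
- exact/join_u_dvd/h.
- exact/join_u_dvd/h.
Qed.

(** A cycle is moved through the stages of [join_u] until every member of every chain contains [u];
    there it is coned off from the barycenter of the vertex [u]. Since [u] has the smallest weight,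
    no step increases weights. *)
Lemma acyclic_sdfaces : acyclic (om_of (sdfaces tau) al).
Proof.
set om := om_of _ _ => n z n0 zl zh zd.
have Zz : Zc om n z by split=> // S _; rewrite zd ffunE.
have B0 j : Bc om n (epush (join_u 0 : vert (Sd K) -> _) z - epush (join_u j) z).
  elim: j => [|j IH]; first by rewrite subrr; exact: Bc0.
  rewrite -(subrK (epush (join_u j) z) (epush _ z)) -addrA.
  by apply: BcD => //; exact: join_u_homotopic.
(* No simplex has that many vertices, so this stage is the identity, while stage 0 joins [u] to
   every face of [tau]. *)
have := B0 #|vert K|.+1; rewrite [X in _ - X]epush_id; last first.
  by move=> s; rewrite /join_u ltnNge max_card /= andbF.
move=> B1.
suff B2 : Bc om n (epush (join_u 0 : vert (Sd K) -> _) z).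
  by have := BcB B2 B1; rewrite subKr.
have uK : [set u] \in simps K by exact: simps_vert.
pose bu : simplex K := exist _ [set u] uK.
(* The chains all of whose members contain [u]: exactly there [bu] can be added as a new smallest
   member. *)
pose F0 := [set T in sdfaces tau | [forall s in T, u \in val (s : simplex K)]].
have hl : inlat (om_of F0 al) (epush (join_u 0 : vert (Sd K) -> _) z).
  apply: inlat_epush zl => T; rewrite /om /om_of.
  case: (boolP (T \in sdfaces tau)) => TF; last exact: dvdq0.
  have hT : join_u 0 @: T \in F0.
    apply/setIdP; split.
      apply: sdfaces_face (join_u_simps 0 TF) (subsetUl _ _) _.
      case/sdfacesP: TF => /simps_neq0/set0Pn[s sT] _.
      by apply/set0Pn; exists (join_u 0 s); exact: imset_f.
    apply/forall_inP => _ /imsetP[s sT ->].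
    by case/sdfacesP: TF => _ /(_ s sT) st; rewrite val_join_u// setU11.
  rewrite hT; have [al0 _ _ _ _] := sw; apply: mx_dvdq => //.
    by case/setIdP: hT => /sdfacesP[/simps_neq0].
  move=> _ /imsetP[s sT ->]; case/sdfacesP: (TF) => _ /(_ s sT) st.
  apply: dvdq_trans (join_u_dvd 0 st) _; apply: dvdq_mx => //.
  by have [_ _ _ ch] := wcpx_sdfaces sw tau; exact: ch.
set w := epush _ z in hl *.
have wh : homog n w by exact: homog_epush.
exists (wedge (bu : vert (Sd K)) w); split.
- apply: inlat_wedge hl => T wT _; rewrite /om /om_of.
  case: (boolP (T \in F0)) => TF; last exact: dvdq0.
  case/setIdP: TF => TF /forall_inP uT; have /sdfacesP[/simps_SdP[T0 h] ht] := TF.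
  have bT : bu |: T \in sdfaces tau.
    apply/sdfacesP; split; last by move=> s /setU1P[->|/ht //]; rewrite sub1set.
    apply/simps_SdP; split; first by apply/set0Pn; exists bu; rewrite setU11.
    move=> s s' /setU1P[->|sT] /setU1P[->|s'T]; rewrite ?subxx//.
    - by rewrite sub1set uT.
    - by rewrite sub1set uT ?orbT.
    - exact: h.
  rewrite bT; have [al0 _ alm almin _] := sw; have [_ _ _ ch] := wcpx_sdfaces sw tau.
  have [_ _ a0 _] := wK.
  apply: mx_dvdq => //; first exact: simps_neq0 (proj1 (sdfacesP _ _ bT)).
  move=> s /setU1P[->|sT]; last by apply: dvdq_mx => //; exact: ch.
  have /set0Pn[t tT] := T0.
  apply: dvdq_trans (dvdq_mx al0 (ch _ TF) tT).
  apply: (@dvdq_trans (a u)); first by have := alm bu; rewrite mx1.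
  apply: almin; first exact: uT.
  by move=> v vt; apply: u_min; move/subsetP: (ht _ tT); apply.
- exact: homog_wedge.
- by rewrite dl_wedge -epush_dl zd [epush _ 0]linear0 [wedge _ 0]linear0 subr0.
Qed.

End SubdividedSimplex.

(** A chain [T] is carried by the subdivision of its largest member, which is acyclic by
    [acyclic_sdfaces]. *)
Lemma esd_pi_homotopic (K : complex) (a : vert K -> rat) (al : vert (Sd K) -> rat)
    (pi : vert (Sd K) -> vert K) :
  wcpx (simps K) a -> sd_weight a al ->
  (forall s : simplex K, pi s \in val s) ->
  (forall s : simplex K, dvdq (a (pi s)) (al s)) ->
  homotopic (om_of (simps (Sd K)) al) (om_of (simps (Sd K)) al)
    (@esd K \o epush pi) id.
Proof.
move=> wK sw pim pid; have [F0 Ff a0 ch] := wK; have [al0 _ alm _ _] := sw.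
have wS := wcpx_Sd sw; have [_ _ _ chS] := wS.
apply: (carrier_homotopic (Gam := fun T => om_of (sdfaces (sdtop T)) al)).
- exact: is_cpx_om_of.
- move=> T /om_ofN0 TK; have tK := sdtop_simps TK.
  have [u ut um] := exists_min a0 (simps_neq0 tK) (ch _ tK).
  exact: acyclic_sdfaces um.
- move=> T s T' _ sT _; apply: om_of_subset; apply: sdfaces_mono.
  by apply/bigcupsP => s' /setD1P[_ s'T]; exact: (bigcup_sup s').
- move=> T T' _; apply: om_of_subset; apply/subsetP => W.
  by case/sdfacesP.
- by apply: cmap_comp (cmap_esd wK sw); exact: cmap_pi.
- exact: cmap_id.
- move=> T /om_ofN0 TK /=; have -> : om_of (simps (Sd K)) al T = mx al T by rewrite /om_of TK.
  rewrite epushZ epush_ebasisE.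
  case: ifP => _; last by rewrite scaler0 [esd 0]linear0; exact: inlat0.
  rewrite scalerA mulrC -scalerA esdZ => W; rewrite ffunE; apply: dvdq_sign; move: W.
  have pK := pi_simps pim TK.
  have pT : pi @: T \subset sdtop T by exact/pi_sub/sdfaces_sdtop.
  apply: inlat_esd_single => // W WT; rewrite /om_of (subsetP (sdfaces_mono pT) _ WT).
  apply: dvdq_trans (mx_al_dvd wK sw pK WT) _; apply: mx_dvdq => //.
    exact: simps_neq0.
  move=> _ /imsetP[s sT ->]; apply: dvdq_trans (pid s) _.
  by apply: dvdq_mx => //; exact: chS.
- move=> T /om_ofN0 TK W; rewrite /= !ffunE /GRing.scale /=; case: eqP => [->|_].
    by rewrite mulr1 /om_of TK sdfaces_sdtop//; exact: dvdq_refl.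
  by rewrite mulr0; exact: dvdq0.
Qed.

(** * Smallest vertex weights, and the two weights on a subdivision *)

Definition mn (V : finType) (a : V -> rat) (S : {set V}) : rat :=
  (mx (fun v => (a v)^-1) S)^-1.

Section MinWeight.
Variables (V : finType) (a : V -> rat).
Hypothesis a_gt0 : forall v, 0 < a v.
Implicit Types (S : {set V}).

Lemma dvdqVE x y : 0 < x -> 0 < y -> dvdq x^-1 y^-1 <-> dvdq y x.
Proof.
move=> x0 y0; split=> [/dvdqV|/dvdqV]; rewrite ?invrK; apply;
by rewrite ?invr_eq0 gt_eqF.
Qed.

Lemma inv_gt0 v : 0 < (a v)^-1. Proof. by rewrite invr_gt0. Qed.

Lemma dvd_chainV S : dvd_chain a S -> dvd_chain (fun v => (a v)^-1) S.
Proof.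
by move=> ch u v uS vS; case: (ch u v uS vS) => d; [right|left]; apply/dvdqVE.
Qed.

Lemma mn_mem S : S != set0 -> exists2 v, v \in S & mn a S = a v.
Proof. by move=> /(mx_mem inv_gt0)[v vS e]; exists v; rewrite // /mn e invrK. Qed.

Lemma mn_dvdq S v : dvd_chain a S -> v \in S -> dvdq (mn a S) (a v).
Proof.
move=> /dvd_chainV ch vS; have := dvdq_mx inv_gt0 ch vS.
have S0 : S != set0 by apply/set0Pn; exists v.
rewrite /mn -{2}[a v]invrK => /dvdqV; apply; rewrite gt_eqF//.
  exact: inv_gt0.
exact: (mx_gt0 inv_gt0).
Qed.

Lemma mn_gt0 S : S != set0 -> 0 < mn a S.
Proof. by move=> /mn_mem[v _ ->]. Qed.

Lemma dvdq_mn S x : S != set0 -> (forall v, v \in S -> dvdq x (a v)) -> dvdq x (mn a S).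
Proof. by move=> /mn_mem[v vS ->]; apply. Qed.

End MinWeight.

Lemma sd_weight_mx (K : complex) (a : vert K -> rat) : wcpx (simps K) a ->
  sd_weight a (fun s : simplex K => mx a (val s)).
Proof.
move=> [F0 Ff a0 ch]; split.
- by move=> s; apply: mx_gt0 => //; exact: simplex_neq0.
- move=> s s' ss'; left; apply: mx_dvdq => //; first exact: simplex_neq0.
  move=> v vs; apply: dvdq_mx => //; first exact/ch/valP.
  by move/subsetP: ss'; apply.
- by move=> s; exact: dvdq_refl.
- by move=> s u us um; apply: dvdq_mx => //; exact/ch/valP.
- move=> s s' u e um; rewrite e; apply: mx_dvdq => //.
    by rewrite -e; exact: simplex_neq0.
  move=> v /setU1P[->|vs]; last by apply: dvdq_mx => //; exact/ch/valP.
  have /set0Pn[w ws] := simplex_neq0 s.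
  by apply: dvdq_trans (um _ ws) _; apply: dvdq_mx => //; exact/ch/valP.
Qed.

Lemma sd_weight_mn (K : complex) (a : vert K -> rat) : wcpx (simps K) a ->
  sd_weight a (fun s : simplex K => mn a (val s)).
Proof.
move=> [F0 Ff a0 ch]; split.
- by move=> s; apply: mn_gt0 => //; exact: simplex_neq0.
- move=> s s' ss'; right; apply: dvdq_mn => //; first exact: simplex_neq0.
  move=> v vs; apply: mn_dvdq => //; first exact/ch/valP.
  by move/subsetP: ss'; apply.
- move=> s; have [v vs ->] := mn_mem a0 (simplex_neq0 s).
  by apply: dvdq_mx => //; exact/ch/valP.
- by move=> s u us um; apply: dvdq_mn => //; exact: simplex_neq0.
- move=> s s' u e um; apply: dvdq_mn => //; first exact: simplex_neq0.
  move=> v vs; apply: mn_dvdq => //; first exact/ch/valP.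
  by rewrite e inE vs orbT.
Qed.

(** * Barycentric coordinates of the subdivision *)

Lemma exists_min_nat (I : finType) (f : I -> nat) (C : {set I}) : C != set0 ->
  exists2 t, t \in C & forall t', t' \in C -> (f t <= f t')%N.
Proof. by move=> /set0Pn[i iC]; have [t tC tm] := arg_minnP f iC; exists t. Qed.

Section Points.
Variable R : realFieldType.

Definition is_pt (K : complex) (x : vert K -> R) : Prop :=
  [/\ forall v, 0 <= x v, \sum_v x v = 1 & carrier x \in simps K].

(* The inverse of [sd_coord]: the coordinate at b_s is #|s| times the length of
   the interval of levels t at which the set of v with x v >= t is s. *)
Definition sd_inv (K : complex) (x : vert K -> R) : vert (Sd K) -> R :=
  fun s : simplex K => #|val s|%:R *
    Num.max 0 (\big[Num.min/1]_(v in val s) x v - \big[Num.max/0]_(v in ~: val s) x v).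

Section OneStep.
Variable K : complex.
Implicit Types (x : vert K -> R) (y : vert (Sd K) -> R) (s t : simplex K).

Lemma simplex_card_gt0 s : 0 < #|val s|%:R :> R.
Proof. by rewrite ltr0n card_gt0; exact: simplex_neq0. Qed.

Lemma sd_coord_sum y : \sum_v sd_coord y v = \sum_(s : simplex K) y s.
Proof.
rewrite /sd_coord (exchange_big_dep predT)//=; apply: eq_bigr => s _.
rewrite sumr_const -[LHS]mulr_natr divfK//.
by rewrite gt_eqF// simplex_card_gt0.
Qed.

Lemma sd_coord_ge0 y : (forall s, 0 <= y s) -> forall v, 0 <= sd_coord y v.
Proof. by move=> y0 v; apply: sumr_ge0 => s _; rewrite divr_ge0// ler0n. Qed.

Lemma sd_coord_carrier y : (forall s, 0 <= y s) ->
  carrier (sd_coord y) = sdtop (carrier y).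
Proof.
move=> y0; apply/setP => v; rewrite inE /sdtop; apply/idP/bigcupP => [|[s]].
  apply: contraNP => h; apply/eqP/big1 => s vs.
  have [->|ys] := eqVneq (y s) 0; first by rewrite mul0r.
  by exfalso; apply: h; exists s; rewrite // inE.
rewrite inE => ys vs; rewrite gt_eqF// /sd_coord (bigD1 s)//=.
rewrite ltr_pwDl//; first by rewrite divr_gt0 ?simplex_card_gt0// lt_def ys y0.
by apply: sumr_ge0 => t _; rewrite divr_ge0// ler0n.
Qed.

Lemma sd_coord_pt y : is_pt y -> is_pt (sd_coord y).
Proof.
move=> [y0 y1 yc]; split; first exact: sd_coord_ge0.
  by rewrite sd_coord_sum.
by rewrite sd_coord_carrier//; exact: sdtop_simps.
Qed.

(** Peel off barycenters: subtracting the smallest positive coordinate over the whole carrier makes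
    the carrier strictly smaller, and the successive carriers form the required chain. The induction
    drops the condition that the coordinates add up to 1, which the peeling destroys. *)
Lemma sd_coord_surj x : is_pt x -> exists2 y, is_pt y & sd_coord y = x.
Proof.
have main : forall n x, (#|carrier x| < n)%N -> (forall v, 0 <= x v) ->
    (carrier x \in simps K \/ carrier x = set0) ->
    exists y, [/\ forall s, 0 <= y s,
      forall s t, y s != 0 -> y t != 0 -> (val s \subset val t) || (val t \subset val s),
      forall s, y s != 0 -> val s \subset carrier x & sd_coord y = x].
  elim=> // n IH {}x xn x0 [cx|c0]; last first.
    exists (fun=> 0); split=> [//|s t|s|]; rewrite ?eqxx//.
    apply/funext => v; rewrite /sd_coord big1; last by move=> s _; rewrite mul0r.
    by apply/eqP; have := in_set0 v; rewrite -c0 inE => /negbT; rewrite negbK eq_sym.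
  have /set0Pn[v0 v0c] := simps_neq0 cx.
  pose sg : simplex K := exist _ (carrier x) cx.
  have [u uc um] : exists2 u, u \in carrier x & forall v, v \in carrier x -> x u <= x v.
    by have [u uc um] := arg_minP x v0c; exists u.
  pose x' v := x v - (v \in carrier x)%:R * x u.
  have cx' : carrier x' \subset carrier x :\ u.
    apply/subsetP => v; rewrite !inE /x' inE.
    have [->|xv] := eqVneq (x v) 0; first by rewrite mul0r subrr eqxx.
    rewrite mul1r andbT; apply: contraNneq => ->; by rewrite subrr.
  have [|||y' [y'0 y'c y's y'x]] := IH x'.
  - apply: leq_ltn_trans (subset_leq_card cx') _.
    by move: xn; rewrite ltnS (cardsD1 u) uc.
  - move=> v; rewrite /x'; case: (boolP (v \in carrier x)) => vc.
      by rewrite mul1r subr_ge0; exact: um.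
    by rewrite mul0r subr0.
  - have [->|c'0] := eqVneq (carrier x') set0; first by right.
    left; apply: (simps_face (valP sg)) c'0.
    exact: subset_trans cx' (subD1set _ _).
  (* [sd_coord] divides by the number of vertices, so this coefficient adds exactly [x u] at each
     vertex of the carrier. *)
  pose y s := y' s + (s == sg)%:R * (#|carrier x|%:R * x u).
  have sub s : y s != 0 -> val s \subset carrier x.
    rewrite /y; have [->//|_] := eqVneq s sg; rewrite mul0r addr0 => /y's h.
    exact: subset_trans h (subset_trans cx' (subD1set _ _)).
  exists y; split=> //.
  - by move=> s; rewrite addr_ge0// mulr_ge0// mulr_ge0.
  - move=> s t ys yt; have [e|ns] := eqVneq s sg.
      by rewrite e [val t \subset _]sub ?orbT.
    have [e|nt] := eqVneq t sg; first by rewrite e sub.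
    by apply: y'c; [move: ys|move: yt]; rewrite /y ?(negPf ns) ?(negPf nt) mul0r addr0.
  - apply/funext => v.
    transitivity (sd_coord y' v + (v \in carrier x)%:R * x u); last first.
      by rewrite y'x /x' subrK.
    rewrite /sd_coord /y; under eq_bigr do rewrite mulrDl.
    rewrite big_split /=; congr (_ + _).
    rewrite big_mkcond (bigD1 sg)//= big1; last first.
      by move=> s ns; rewrite (negPf ns) !mul0r if_same.
    rewrite addr0 eqxx mul1r; case: ifP => _; last by rewrite mul0r.
    by rewrite mul1r mulrAC divff ?mul1r// gt_eqF// (simplex_card_gt0 sg).
move=> [x0 x1 cx]; have [y [y0 yc ys yx]] := main _ x (ltnSn _) x0 (or_introl cx).
have y1 : \sum_s y s = 1 by rewrite -sd_coord_sum yx.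
exists y => //; split=> //; apply/simps_SdP; split; last first.
  by move=> s t; rewrite !inE; exact: yc.
apply: contra_eq_neq y1 => c0; rewrite big1 1?eq_sym ?oner_neq0// => s _.
by apply/eqP; have := in_set0 s; rewrite -c0 inE => /negbT; rewrite negbK.
Qed.

Lemma sd_coordK y : is_pt y -> sd_inv (sd_coord y) = y.
Proof.
move=> [y0 y1 yc]; set x := sd_coord y.
have cmp s t : y s != 0 -> y t != 0 -> (val s \subset val t) || (val t \subset val s).
  by move=> ys yt; case/simps_SdP: yc => _; apply; rewrite inE.
have yn0 s : 0 <= y s / #|val s|%:R by rewrite divr_ge0// ler0n.
have bigminE (A : {set vert K}) u : u \in A -> (forall v, v \in A -> x u <= x v) -> x u <= 1 ->
    \big[Num.min/1]_(v in A) x v = x u.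
  move=> uA h u1; apply/le_anti/andP; split.
    by rewrite (bigD1 u)//= ge_min lexx.
  by elim/big_ind: _ => // p q hp hq; rewrite le_min hp.
have x_le1 v : x v <= 1.
  rewrite -y1 -sd_coord_sum -/x (bigD1 v)//= lerDl.
  by apply: sumr_ge0 => w _; exact: sd_coord_ge0.
apply/funext => s; rewrite /sd_inv.
have /set0Pn[v0 v0s] := simplex_neq0 s.
have [ys|ys] := eqVneq (y s) 0; last first.
  (* A vertex of [s] outside all smaller members of the chain. Every member containing it contains
     [s], so [x] is least on [s] at [u]. *)
  have [u us uE] : exists2 u, u \in val s & forall t, y t != 0 -> u \in val t -> val s \subset val t.
    pose C := [set t in carrier y | val (t : simplex K) \proper val s].
    have [C0|C0] := eqVneq C set0.
      exists v0 => // t yt v0t; case/orP: (cmp _ _ ys yt) => // ts.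
      have [e|ne] := eqVneq (val t) (val s); first by rewrite e.
      have : t \in C by rewrite !inE yt properEneq ne.
      by rewrite C0 inE.
    have CK : C \in simps (Sd K).
      by apply: simps_face yc _ C0; apply/subsetP => t; rewrite inE => /andP[].
    have [t tC te] := sdtop_mem CK.
    move: (tC); rewrite inE => /andP[_ /properP[_ [u us ut]]].
    exists u => // t' yt' ut'; case/orP: (cmp _ _ ys yt') => // t's.
    have [e|ne] := eqVneq (val t') (val s); first by rewrite e.
    have : t' \in C by rewrite !inE yt' properEneq ne.
    move=> t'C; move: ut; rewrite te => /bigcupP[]; by exists t'.
  (* The part of the coordinates that comes from the members strictly above [s]. It is also the
     largest value of [x] outside [s], attained in the next larger member or equal to 0 if there is
     none. *)
  pose B := \sum_(t : simplex K | val s \proper val t) y t / #|val t|%:R.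
  have xu : x u = y s / #|val s|%:R + B.
    rewrite /x /sd_coord (bigD1 s)//=; congr (_ + _).
    rewrite /B big_mkcond [RHS]big_mkcond; apply: eq_bigr => t _.
    have [->|yt] := eqVneq (y t) 0; first by rewrite mul0r !if_same.
    congr (if _ then _ else _); apply/andP/idP => [[ut ts]|].
      rewrite properEneq uE// andbT; apply: contraNneq ts => e.
      by apply/eqP/val_inj.
    move=> st; split; first by move/properP: st => [/subsetP h _]; exact: h.
    by apply: contraTneq st => ->; rewrite properxx.
  have xge v : v \in val s -> x u <= x v.
    move=> vs; rewrite /x /sd_coord big_mkcond [leRHS]big_mkcond.
    apply: ler_sum => t _; case: ifP => ut; last by case: ifP.
    have [->|yt] := eqVneq (y t) 0; first by rewrite mul0r if_same.
    by rewrite (subsetP (uE t yt ut)).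
  have xle v : v \notin val s -> x v <= B.
    move=> vs; rewrite /x /sd_coord /B big_mkcond [leRHS]big_mkcond.
    apply: ler_sum => t _; case: ifP => vt; last by case: ifP.
    have [->|yt] := eqVneq (y t) 0; first by rewrite mul0r if_same.
    case/orP: (cmp _ _ ys yt) => [st|ts].
      rewrite properE st (_ : ~~ _)//; apply: contra vs => /subsetP; exact.
    by move/subsetP: ts => /(_ _ vt) vs'; rewrite vs' in vs.
  have B0 : 0 <= B by exact: sumr_ge0.
  have -> : \big[Num.min/1]_(v in val s) x v = x u by exact: bigminE.
  have -> : \big[Num.max/0]_(v in ~: val s) x v = B.
    apply/le_anti/andP; split.
      elim/big_ind: _ => //; first by move=> p q hp hq; rewrite ge_max hp.
      by move=> v; rewrite inE; exact: xle.
    pose C := [set t in carrier y | val s \proper val (t : simplex K)].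
    have [C0|/(exists_min_nat (fun t => #|val t|))[t tC tm]] := eqVneq C set0.
      rewrite /B big1; last first.
        move=> t st; have [->|yt] := eqVneq (y t) 0; first by rewrite mul0r.
        by have := in_set0 t; rewrite -C0 !inE yt st.
      elim/big_ind: _ => //; first by move=> p q hp hq; rewrite le_max hp.
      by move=> v _; exact: sd_coord_ge0.
    move: (tC); rewrite !inE => /andP[yt /properP[st [w wt ws]]].
    apply: (@le_trans _ _ (x w)); last first.
      by rewrite (bigD1 w) ?inE//= le_max lexx.
    rewrite /x /sd_coord /B big_mkcond [leRHS]big_mkcond.
    apply: ler_sum => t' _; case: ifP => st'; last by case: ifP.
    have [->|yt'] := eqVneq (y t') 0; first by rewrite mul0r if_same.
    have t'C : t' \in C by rewrite !inE yt'.
    suff -> : w \in val t' by [].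
    have := tm _ t'C; case/orP: (cmp _ _ yt yt') => [/subsetP h _|h1 h2].
      exact: h.
    by have /eqP -> : val t' == val t by rewrite eqEcard h1.
  rewrite xu addrK max_r// mulrCA divff ?mulr1// gt_eqF//; exact: simplex_card_gt0.
(* If the difference were positive, [s] would be a superlevel set of [x], hence the smallest member
   [t] of the chain that contains a minimum point [u] of [x] on [s]; but [y t] is not 0. *)
rewrite ys (_ : Num.max _ _ = 0) ?mulr0//; apply/max_l; rewrite leNgt.
apply/negP; rewrite subr_gt0 => h.
have [u us um] : exists2 u, u \in val s & forall v, v \in val s -> x u <= x v.
  by have [u us um] := arg_minP x v0s; exists u.
have minu : \big[Num.min/1]_(v in val s) x v = x u by exact: bigminE.
have lt w : w \notin val s -> x w < x u.
  move=> ws; rewrite -minu; apply: le_lt_trans h.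
  by rewrite (bigD1 w) ?inE//= le_max lexx.
have xu0 : 0 < x u.
  rewrite -minu; apply: le_lt_trans h.
  elim/big_ind: _ => //; first by move=> p q hp hq; rewrite le_max hp.
  by move=> v _; exact: sd_coord_ge0.
have [t0 yt0 ut0] : exists2 t, y t != 0 & u \in val t.
  have : u \in carrier x by rewrite inE gt_eqF.
  by rewrite sd_coord_carrier// => /bigcupP[t]; rewrite inE => yt ut; exists t.
pose C := [set t in carrier y | u \in val (t : simplex K)].
have /(exists_min_nat (fun t => #|val t|))[t tC tm] : C != set0.
  by apply/set0Pn; exists t0; rewrite !inE yt0.
move: (tC); rewrite !inE => /andP[yt ut].
have tsub t' : y t' != 0 -> u \in val t' -> val t \subset val t'.
  move=> yt' ut'; have t'C : t' \in C by rewrite !inE yt'.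
  have := tm _ t'C; case/orP: (cmp _ _ yt yt') => // h1 h2.
  by have /eqP -> : val t' == val t by rewrite eqEcard h1.
suff e : t = s by rewrite e ys eqxx in yt.
apply/val_inj/eqP; rewrite eqEsubset; apply/andP; split; apply/subsetP => w.
  apply: contraTT => /lt; apply: contraTN => wt; rewrite -leNgt.
  rewrite /x /sd_coord big_mkcond [leRHS]big_mkcond.
  apply: ler_sum => t' _; case: ifP => ut'; last by case: ifP.
  have [->|yt'] := eqVneq (y t') 0; first by rewrite mul0r if_same.
  by rewrite (subsetP (tsub _ yt' ut')).
move=> ws; apply: contraTT (um _ ws) => wt; rewrite -ltNge.
rewrite /x /sd_coord [ltRHS](bigD1 t)//=.
rewrite ltr_pwDl//; first by rewrite divr_gt0 ?simplex_card_gt0// lt_def yt y0.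
rewrite big_mkcond [leRHS]big_mkcond.
apply: ler_sum => t' _; case: ifP => wt'; last by case: ifP.
have [->|yt'] := eqVneq (y t') 0; first by rewrite mul0r if_same.
rewrite (_ : _ && _ = true)//; apply/andP; split; last first.
  by apply: contraNneq wt => <-.
case/orP: (cmp _ _ yt yt') => [/subsetP h'|/subsetP h']; first exact: h'.
by rewrite (h' _ wt') in wt.
Qed.

Lemma sd_invK x : is_pt x -> sd_coord (sd_inv x) = x.
Proof. by move=> /sd_coord_surj[y yp <-]; rewrite sd_coordK. Qed.

Lemma sd_inv_pt x : is_pt x -> is_pt (sd_inv x).
Proof. by move=> /sd_coord_surj[y yp <-]; rewrite sd_coordK. Qed.

End OneStep.
End Points.

(** * Mesh of the iterated subdivisions *)

Section Mesh.
Variable R : realFieldType.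

Definition vertex_pt (V : finType) (w : V) : V -> R := fun w' => (w' == w)%:R.

Lemma vertex_pt_carrier (K : complex) (w : vert K) :
  carrier (vertex_pt w : vert K -> R) = [set w].
Proof. by apply/setP => v; rewrite !inE /vertex_pt pnatr_eq0 eqb0 negbK. Qed.

Lemma vertex_pt_pt (K : complex) (w : vert K) : is_pt (vertex_pt w).
Proof.
split; first by move=> v; rewrite ler0n.
  rewrite (bigD1 w)//= /vertex_pt eqxx big1 ?addr0// => v vw.
  by rewrite (negPf vw).
by rewrite vertex_pt_carrier; exact: simps_vert.
Qed.

(** Measured from the mean [c] over [A], the deviations over [A] cancel. So the two means differ by
    at most [D] times the share of [B] outside [A], and that share is at most [1 - 1/N] because [A]
    is nonempty. *)
Lemma avg_close (V : finType) (f : V -> R) (A B : {set V}) (N : nat) (D : R) :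
  A != set0 -> A \subset B -> (#|B| <= N)%N ->
  (forall u w, u \in B -> w \in B -> `|f u - f w| <= D) ->
  `|(\sum_(w in A) f w) / #|A|%:R - (\sum_(w in B) f w) / #|B|%:R|
    <= (1 - N%:R^-1) * D.
Proof.
move=> A0 AB BN h.
have B0 : (0 < #|B|)%N by rewrite card_gt0; apply: contraNneq A0 => e; rewrite -subset0 -e.
have gtA : 0 < #|A|%:R :> R by rewrite ltr0n card_gt0.
have gtB : 0 < #|B|%:R :> R by rewrite ltr0n.
have D0 : 0 <= D by case/set0Pn: A0 => u /(subsetP AB) uB; have := h u u uB uB; rewrite subrr normr0.
set c := _ / #|A|%:R.
have cE : \sum_(w in A) (f w - c) = 0.
  by rewrite sumrB sumr_const -[X in _ - X]mulr_natr /c divfK ?subrr// gt_eqF.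
have cB w : w \in B -> `|f w - c| <= D.
  move=> wB; have -> : f w - c = (\sum_(u in A) (f w - f u)) / #|A|%:R.
    by rewrite sumrB mulrBl sumr_const -[f w *+ _]mulr_natr mulfK// gt_eqF.
  rewrite normrM [X in _ * X]ger0_norm ?invr_ge0 ?ler0n// ler_pdivrMr//.
  apply: le_trans (ler_norm_sum _ _ _) _.
  rewrite mulr_natr -sumr_const; apply: ler_sum => u uA; apply: h => //.
  by move/subsetP: AB; apply.
have -> : c - (\sum_(w in B) f w) / #|B|%:R = - ((\sum_(w in B :\: A) (f w - c)) / #|B|%:R).
  have -> : \sum_(w in B :\: A) (f w - c) = \sum_(w in B) (f w - c).
    by rewrite [RHS](big_setID A)/= (setIidPr AB) cE add0r.
  rewrite sumrB mulrBl sumr_const -[c *+ _]mulr_natr mulfK ?gt_eqF//.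
  by rewrite opprB.
rewrite normrN normrM [X in _ * X]ger0_norm ?invr_ge0 ?ler0n//.
apply: (@le_trans _ _ ((#|B :\: A|%:R * D) / #|B|%:R)).
  rewrite ler_pM2r ?invr_gt0//; apply: le_trans (ler_norm_sum _ _ _) _.
  rewrite mulr_natl -sumr_const; apply: ler_sum => w; rewrite inE => /andP[_ wB].
  exact: cB.
rewrite mulrAC ler_wpM2r// cardsD (setIidPr AB) natrB ?subset_leq_card//.
rewrite mulrBl divff ?gt_eqF// lerD2l lerN2.
apply: (@le_trans _ _ #|B|%:R^-1).
  by rewrite lef_pV2 ?posrE ?ltr0n// ?ler_nat// (leq_trans B0).
by rewrite ler_peMl ?invr_ge0 ?ler0n// ler1n card_gt0.
Qed.

(** The members of a chain have distinct cardinalities between 1 and [N]. *)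
Lemma card_Sd (K : complex) N : (forall S, S \in simps K -> (#|S| <= N)%N) ->
  forall T, T \in simps (Sd K) -> (#|T| <= N)%N.
Proof.
move=> h T /simps_SdP[_ hT].
pose g (s : simplex K) : 'I_N.+1 := inord #|val s|.
have gE s : g s = #|val s| :> nat by rewrite inordK// ltnS h// (valP s).
have ginj : {in T &, injective g}.
  move=> s s' sT s'T /(congr1 (@nat_of_ord _)); rewrite !gE => e.
  apply: val_inj; case/orP: (hT _ _ sT s'T) => ss'.
    by apply/eqP; rewrite eqEcard ss' e /=.
  by apply/esym/eqP; rewrite eqEcard ss' e /=.
rewrite -(card_in_imset ginj) -ltnS.
apply: (@leq_trans #|[set: 'I_N.+1] :\ ord0|.+1); last first.
  by rewrite -[X in (_ <= X)%N](card_ord N.+1) -cardsT (cardsD1 ord0 [set: _]) inE.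
rewrite ltnS; apply: subset_leq_card; apply/subsetP => _ /imsetP[s sT ->].
rewrite !inE andbT; apply: contraNneq (simplex_neq0 s).
by move=> /(congr1 (@nat_of_ord _)); rewrite gE => /eqP; rewrite cards_eq0.
Qed.

Lemma card_Sdn (K : complex) m S : S \in simps (Sdn K m) -> (#|S| <= #|vert K|)%N.
Proof.
elim: m S => [|m IH] S; first by rewrite max_card.
exact: card_Sd.
Qed.

Section Iterated.
Variable K : complex.

Definition sdn_vertex m (w : vert (Sdn K m)) : vert K -> R := sdn_coord m (vertex_pt w).

Lemma sd_coord_vertex (L : complex) (s : simplex L) v :
  sd_coord (vertex_pt (s : vert (Sd L))) v = (v \in val s)%:R / #|val s|%:R.
Proof.
rewrite /sd_coord big_mkcond (bigD1 s)//= big1 ?addr0 /vertex_pt ?eqxx.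
  by case: ifP; rewrite ?mul0r.
by move=> t ts; rewrite (negPf ts) mul0r if_same.
Qed.

Lemma sd_coord_linear (L : complex) (y : vert (Sd L) -> R) v :
  sd_coord y v = \sum_(s : simplex L) y s * ((v \in val s)%:R / #|val s|%:R).
Proof.
rewrite /sd_coord big_mkcond; apply: eq_bigr => s _.
by case: ifP => _; rewrite ?mul1r ?mul0r ?mulr0.
Qed.

Lemma sdn_coordE m (y : vert (Sdn K m) -> R) v :
  sdn_coord m y v = \sum_w y w * sdn_vertex w v.
Proof.
rewrite /sdn_vertex; elim: m y => [|m IH] y /=.
  rewrite (bigD1 v)//= /vertex_pt eqxx mulr1 big1 ?addr0// => w wv.
  by rewrite eq_sym (negPf wv) mulr0.
rewrite IH; under [LHS]eq_bigr do rewrite sd_coord_linear mulr_suml.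
rewrite exchange_big /=; apply: eq_bigr => s _.
rewrite IH mulr_sumr; apply: eq_bigr => w _.
by rewrite sd_coord_vertex mulrA.
Qed.

Lemma sdn_vertexS m (s : simplex (Sdn K m)) v :
  sdn_vertex (s : vert (Sdn K m.+1)) v =
  (\sum_(w in val s) sdn_vertex w v) / #|val s|%:R.
Proof.
rewrite {1}/sdn_vertex /= sdn_coordE mulr_suml [RHS]big_mkcond; apply: eq_bigr => w _.
rewrite sd_coord_vertex; case: ifP => _; last by rewrite !mul0r.
by rewrite mul1r mulrC.
Qed.

(** Two adjacent vertices of a subdivision are barycenters of nested simplices, so [avg_close] gains
    one factor per subdivision. The number of vertices of [K] bounds the size of the simplices at
    every stage, by [card_Sdn]. *)
Lemma mesh_bound m S w w' v : S \in simps (Sdn K m) -> w \in S -> w' \in S ->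
  `|sdn_vertex w v - sdn_vertex w' v| <= (1 - #|vert K|%:R^-1) ^+ m.
Proof.
elim: m S w w' => [|m IH] S w w' SK wS w'S.
  rewrite expr0 /sdn_vertex /= /vertex_pt.
  by case: eqP; case: eqP; rewrite ?subrr ?subr0 ?sub0r ?normrN ?normr0 ?normr1 ?ler01.
case/simps_SdP: SK => _ h.
wlog ww' : w w' wS w'S / val (w : simplex (Sdn K m)) \subset val (w' : simplex (Sdn K m)).
  move=> hw; case/orP: (h _ _ wS w'S) => ?; first exact: hw.
  by rewrite distrC; exact: hw.
rewrite !sdn_vertexS exprS; apply: avg_close => //.
- exact: simplex_neq0.
- exact: card_Sdn (valP (w' : simplex _)).
- by move=> a b aw bw; exact: IH (valP (w' : simplex _)) aw bw.
Qed.

Lemma sdn_coord_close m (y : vert (Sdn K m) -> R) w v : is_pt y -> y w != 0 ->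
  `|sdn_coord m y v - sdn_vertex w v| <= (1 - #|vert K|%:R^-1) ^+ m.
Proof.
move=> [y0 y1 yc] yw.
have -> : sdn_coord m y v - sdn_vertex w v =
    \sum_u y u * (sdn_vertex u v - sdn_vertex w v).
  under eq_bigr do rewrite mulrBr.
  by rewrite sumrB -sdn_coordE -mulr_suml y1 mul1r.
apply: le_trans (ler_norm_sum _ _ _) _.
set D := leRHS; rewrite -[D]mul1r -y1 mulr_suml; apply: ler_sum => u _.
rewrite normrM ger0_norm//; have [->|yu] := eqVneq (y u) 0; first by rewrite !mul0r.
apply: ler_wpM2l => //; rewrite /D; refine (mesh_bound _ yc _ _); rewrite inE//.
Qed.

Fixpoint sdn_inv (x : vert K -> R) m : vert (Sdn K m) -> R :=
  if m is m'.+1 return vert (Sdn K m) -> R then sd_inv (@sdn_inv x m') else x.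

Lemma sdn_inv_pt m x : is_pt x -> is_pt (@sdn_inv x m).
Proof. by move=> xp; elim: m => //= m IH; exact: sd_inv_pt. Qed.

Lemma sdn_invK m x : is_pt x -> sdn_coord m (@sdn_inv x m) = x.
Proof. by move=> xp; elim: m => //= m IH; rewrite sd_invK//; exact: sdn_inv_pt. Qed.

Lemma sdn_coord_pt m (y : vert (Sdn K m) -> R) : is_pt y -> is_pt (sdn_coord m y).
Proof. by elim: m y => //= m IH y yp; apply: IH; exact: sd_coord_pt. Qed.

Lemma sdn_coordK m (y : vert (Sdn K m) -> R) : is_pt y -> @sdn_inv (sdn_coord m y) m = y.
Proof.
elim: m y => //= m IH y yp; rewrite IH ?sd_coordK//; exact: sd_coord_pt.
Qed.

End Iterated.
End Mesh.

(** * Iterated subdivision *)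

Section VertexCarrier.
Variable K : complex.

(* The vertices of the simplex of K that carries a vertex of Sd^m K. *)
Fixpoint vcar m : vert (Sdn K m) -> {set vert K} :=
  if m is m'.+1 return vert (Sdn K m) -> {set vert K}
  then fun s : simplex (Sdn K m') => \bigcup_(w in val s) vcar w
  else fun w => [set w].

Lemma carrier_sdn_coord (R : realFieldType) m (y : vert (Sdn K m) -> R) : is_pt y ->
  carrier (sdn_coord m y) = \bigcup_(w in carrier y) vcar w.
Proof.
elim: m y => [|m IH] y yp.
  apply/setP => v; apply/idP/bigcupP => [vy|[w wy]]; last by move=> /set1P ->.
  by exists v; rewrite // set11.
rewrite /= IH; last exact: sd_coord_pt.
case: yp => y0 _ _; rewrite sd_coord_carrier// /sdtop.
apply/setP => v; apply/bigcupP/bigcupP => [[w /bigcupP[s sy ws] vw]|[s sy /bigcupP[w ws vw]]].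
  by exists s => //; apply/bigcupP; exists w.
by exists w => //; apply/bigcupP; exists s.
Qed.

Lemma carrier_sdn_vertex (R : realFieldType) m (w : vert (Sdn K m)) :
  carrier (sdn_vertex R w) = vcar w.
Proof.
rewrite /sdn_vertex carrier_sdn_coord; last exact: vertex_pt_pt.
by rewrite vertex_pt_carrier big_set1.
Qed.

Lemma vcar_simps m (w : vert (Sdn K m)) : vcar w \in simps K.
Proof.
rewrite -(carrier_sdn_vertex rat).
by have [] := sdn_coord_pt (vertex_pt_pt rat w).
Qed.

(* The weight of Sd^m K when each step takes the largest vertex weight of a
   simplex ([wI]), resp. the smallest ([wII]). *)
Fixpoint wI (a : vert K -> rat) m : vert (Sdn K m) -> rat :=
  if m is m'.+1 return vert (Sdn K m) -> rat
  then fun s : simplex (Sdn K m') => mx (@wI a m') (val s) else a.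

Definition wII (a : vert K -> rat) m (w : vert (Sdn K m)) : rat :=
  (wI (fun v => (a v)^-1) w)^-1.

Lemma mx_le (V : finType) (a : V -> rat) (S : {set V}) c :
  0 <= c -> (forall v, v \in S -> a v <= c) -> mx a S <= c.
Proof. by move=> c0 h; rewrite /mx; elim/big_ind: _ => // p q; rewrite ge_max => -> ->. Qed.

Lemma mx_ge0 (V : finType) (a : V -> rat) (S : {set V}) : 0 <= mx a S.
Proof.
rewrite /mx; elim/big_rec: _ => // v q _ q0; rewrite le_max q0 orbT; exact: isT.
Qed.

Lemma wIE (a : vert K -> rat) m (w : vert (Sdn K m)) :
  (forall v, 0 < a v) -> wI a w = mx a (vcar w).
Proof.
move=> a0; elim: m w => [|m IH] w /=; first by rewrite mx1.
have IH' : wI a (m := m) = fun w => mx a (vcar w) by apply/funext.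
rewrite IH'; apply/le_anti/andP; split.
  apply: mx_le => [|u uw]; first exact: mx_ge0.
  apply: mx_le => [|v vu]; first exact: mx_ge0.
  by apply: mx_ge; apply/bigcupP; exists u.
apply: mx_le => [|v /bigcupP[u uw vu]]; first exact: mx_ge0.
by apply: le_trans (mx_ge a vu) _; exact: (mx_ge (fun w => mx a (vcar w))).
Qed.

Lemma wIIE (a : vert K -> rat) m (w : vert (Sdn K m)) :
  (forall v, 0 < a v) -> wII a w = mn a (vcar w).
Proof. by move=> a0; rewrite /wII wIE// => v; rewrite invr_gt0. Qed.

Lemma sd_weight_wI (a : vert K -> rat) : wcpx (simps K) a ->
  forall m, wcpx (simps (Sdn K m)) (wI a (m := m)) /\
    sd_weight (wI a (m := m)) (wI a (m := m.+1)).
Proof.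
move=> wK; elim=> [|m [wm sm]]; first by split=> //; exact: sd_weight_mx.
have wm1 : wcpx (simps (Sdn K m.+1)) (wI a (m := m.+1)) by exact: wcpx_Sd sm.
by split=> //; exact: sd_weight_mx.
Qed.

Lemma wIIS (a : vert K -> rat) m :
  wII a (m := m.+1) = fun s : simplex (Sdn K m) => mn (wII a (m := m)) (val s).
Proof.
apply/funext => s; rewrite /wII /mn /=; congr (mx _ _)^-1.
by apply/funext => w; rewrite invrK.
Qed.

Lemma wII0 (a : vert K -> rat) : wII a (m := 0) = a.
Proof. by apply/funext => v; rewrite /wII /= invrK. Qed.

Lemma sd_weight_wII (a : vert K -> rat) : wcpx (simps K) a ->
  forall m, wcpx (simps (Sdn K m)) (wII a (m := m)) /\
    sd_weight (wII a (m := m)) (wII a (m := m.+1)).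
Proof.
move=> wK; elim=> [|m [wm sm]].
  by rewrite wIIS wII0; split=> //; exact: sd_weight_mn.
have wm1 : wcpx (simps (Sdn K m.+1)) (wII a (m := m.+1)) by exact: wcpx_Sd sm.
by split=> //; rewrite (wIIS a m.+1); exact: sd_weight_mn.
Qed.

Fixpoint esdn m : ealg (vert K) -> ealg (vert (Sdn K m)) :=
  if m is m'.+1 return ealg (vert K) -> ealg (vert (Sdn K m))
  then fun c => esd (esdn m' c) else id.

Section Tower.
Variable al : forall m, vert (Sdn K m) -> rat.
Hypothesis wal : forall m, wcpx (simps (Sdn K m)) (@al m).
Hypothesis sal : forall m, sd_weight (@al m) (@al m.+1).

Definition omn m := om_of (simps (Sdn K m)) (@al m).
Arguments omn : clear implicits.

Lemma cmap_esdn m : cmap (omn 0) (omn m) (@esdn m).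
Proof.
elim: m => [|m IH]; first exact: cmap_id.
exact: cmap_comp IH (cmap_esd (wal m) (sal m)).
Qed.

Lemma exists_collapse (L : complex) (a : vert L -> rat) (b : vert (Sd L) -> rat) :
  wcpx (simps L) a -> sd_weight a b ->
  exists pi : vert (Sd L) -> vert L,
    (forall s : simplex L, pi s \in val s) /\ (forall s : simplex L, dvdq (a (pi s)) (b s)).
Proof.
move=> [F0 Ff a0 ch] [_ _ _ bmin _].
have /choice[pi hpi] : forall s : simplex L, exists u, u \in val s /\ dvdq (a u) (b s).
  move=> s; have [u us um] := exists_min a0 (simplex_neq0 s) (ch _ (valP s)).
  by exists u; split=> //; exact: bmin.
by exists pi; split=> s; case: (hpi s).
Qed.

Lemma tower_equivalence m : exists p : vert (Sdn K m) -> vert K,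
  [/\ forall w, p w \in vcar w, forall w, dvdq (@al 0 (p w)) (@al m w),
      cmap (omn m) (omn 0) (epush p),
      homotopic (omn 0) (omn 0) (epush p \o @esdn m) id &
      homotopic (omn m) (omn m) (@esdn m \o epush p) id].
Proof.
elim: m => [|m [p [pc pd pm h1 h2]]].
  exists id; split.
  - by move=> w; rewrite set11.
  - by move=> w; exact: dvdq_refl.
  - by apply: cmap_epush => // [S|S v _ _]; rewrite ?imset_id//; exact: dvdq_refl.
  - by apply: eq_homotopic (@homotopic_refl _ _ _ _ id) => // c; rewrite /= epush_id.
  - by apply: eq_homotopic (@homotopic_refl _ _ _ _ id) => // c; rewrite /= epush_id.
have [pi [pim pid]] := exists_collapse (wal m) (sal m).
have cpi := cmap_pi (wal m) (sal m) pim pid.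
have cE := cmap_esd (wal m) (sal m).
have pE : epush (p \o pi) =1 epush p \o epush pi.
  by move=> c; rewrite /= epush_comp.
exists (p \o pi); split.
- by move=> s; apply/bigcupP; exists (pi s); [exact: pim|exact: pc].
- by move=> s; apply: dvdq_trans (pd _) (pid _).
- have : cmap (omn m.+1) (omn 0) (epush p \o epush pi) by exact: cmap_comp pm.
  by rewrite (_ : epush (p \o pi) = epush p \o epush pi)//; apply/funext.
- apply: homotopic_trans h1.
  apply: (@eq_homotopic _ _ _ _ ((epush p \o (epush pi \o @esd _)) \o @esdn m) _
    ((epush p \o id) \o @esdn m)) => //.
    by move=> c; rewrite /= epush_comp.
  apply: homotopic_compr; first exact: cmap_esdn.
  apply: homotopic_compl pm _; exact: (pi_esd_homotopic (wal m) (sal m) pim pid).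
- apply: homotopic_trans (esd_pi_homotopic (wal m) (sal m) pim pid).
  apply: (@eq_homotopic _ _ _ _ ((@esd _ \o (@esdn m \o epush p)) \o epush pi) _
    ((@esd _ \o id) \o epush pi)) => //.
    by move=> c; rewrite /= epush_comp.
  by apply: homotopic_compr cpi _; apply: homotopic_compl cE _.
Qed.

End Tower.
End VertexCarrier.

(** * Integral chains as lattices of rational chains *)

Definition wtq (t : wtype) (n : nat) : rat := if t is Ascending then n%:R else n%:R^-1.

Lemma wtq_gt0 t n : (0 < n)%N -> 0 < wtq t n.
Proof. by case: t => n0 /=; rewrite ?invr_gt0 ltr0n. Qed.

Lemma wtq_opposite t n : wtq (opposite t) n = (wtq t n)^-1.
Proof. by case: t => //=; rewrite invrK. Qed.

Lemma dvdq_nat m n : dvdq m%:R n%:R <-> (m %| n)%N.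
Proof.
split=> [[k e]|/dvdnP[k ->]]; last by exists k%:Z; rewrite natrM.
have : n%:Z = k * m%:Z by apply/eqP; rewrite -(eqr_int rat) intrM; apply/eqP; exact: e.
by move=> /(congr1 absz); rewrite abszM /= => ->; exact: dvdn_mull.
Qed.

Lemma dvdq_wtq t m n : (0 < m)%N -> (0 < n)%N ->
  dvdq (wtq t m) (wtq t n) <-> if t is Ascending then (m %| n)%N else (n %| m)%N.
Proof.
move=> m0 n0; case: t => /=; first exact: dvdq_nat.
by rewrite dvdqVE ?ltr0n//; exact: dvdq_nat.
Qed.

Lemma wratio_wtq t m n : (0 < m)%N -> (0 < n)%N -> dvdq (wtq t n) (wtq t m) ->
  (wratio t m n)%:~R * wtq t n = wtq t m.
Proof.
move=> m0 n0 /(dvdq_wtq _ n0 m0); rewrite /wratio; case: t => /= d.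
  by rewrite -[LHS]natrM divnK.
have nz : n%:R != 0 :> rat by rewrite pnatr_eq0 -lt0n.
have mz : m%:R != 0 :> rat by rewrite pnatr_eq0 -lt0n.
apply: (mulIf nz); rewrite mulfVK//; apply: (mulfI mz).
by rewrite mulrA divff// mul1r -[LHS]natrM mulnC divnK.
Qed.

(** The integral chain groups have no empty simplex; dropping its coefficient turns the augmented
    boundary into the ordinary one. *)
Definition trunc (V : finType) (c : ealg V) : ealg V :=
  [ffun S : {set V} => if S == set0 then 0 else c S].

Lemma trunc_linear (V : finType) : linear (@trunc V).
Proof.
move=> k x y; apply/ffunP => S; rewrite !ffunE; case: ifP => //.
by rewrite /GRing.scale /= mulr0 addr0.
Qed.
HB.instance Definition _ (V : finType) :=
  GRing.isLinear.Build _ _ _ _ (@trunc V) (@trunc_linear V).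

Lemma truncZ (V : finType) k (c : ealg V) : trunc (k *: c) = k *: trunc c.
Proof. exact: linearZ. Qed.

Lemma trunc_sum (V : finType) (I : Type) (r : seq I) (P : pred I) (F : I -> ealg V) :
  trunc (\sum_(i <- r | P i) F i) = \sum_(i <- r | P i) trunc (F i).
Proof. exact: linear_sum. Qed.

Definition vertex_weighted (t : wtype) (K : complex) (xi : weight K) (a : vert K -> rat) :=
  wcpx (simps K) a /\ forall S, S \in simps K -> (0 < xi S)%N /\ wtq t (xi S) = mx a S.

Section VertexWeighted.
Variables (t : wtype) (K : complex) (xi : weight K) (a : vert K -> rat).
Hypothesis vw : vertex_weighted t xi a.
Implicit Types (S T : {set vert K}).

Lemma vw_gt0 S : S \in simps K -> (0 < xi S)%N.
Proof. by case: vw => _ h /h[]. Qed.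

Lemma vw_mx S : S \in simps K -> wtq t (xi S) = mx a S.
Proof. by case: vw => _ h /h[]. Qed.

Lemma vw_om S : S \in simps K -> om_of (simps K) a S = wtq t (xi S).
Proof. by move=> SK; rewrite /om_of SK vw_mx. Qed.

Lemma vw_vertex v : wtq t (xi [set v]) = a v.
Proof. by case: vw => -[_ _ a0 _] _; rewrite vw_mx ?simps_vert// mx1. Qed.

Lemma vw_face S T : S \in simps K -> T \subset S -> T != set0 ->
  dvdq (wtq t (xi T)) (wtq t (xi S)).
Proof.
move=> SK TS T0; case: (vw) => wK _; have := om_of_mono wK SK TS T0.
by rewrite !vw_om//; exact: simps_face SK TS T0.
Qed.

Lemma vw_sdw : vertex_weighted t (sdw xi) (fun s : simplex K => mx a (val s)).
Proof.
case: (vw) => wK _; have sw := sd_weight_mx wK; split; first exact: wcpx_Sd sw.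
move=> T TK; have tK := sdtop_simps TK; split; first exact: vw_gt0.
have [s sT sE] := sdtop_mem TK; have -> : sdw xi T = xi (sdtop T) by [].
rewrite vw_mx// -sE.
apply/le_anti/andP; split; first exact: (mx_ge (fun s : simplex K => mx a (val s))).
apply: mx_le => [|s' s'T]; first exact: mx_ge0.
apply: mx_le => [|v vs']; first exact: mx_ge0.
apply: mx_ge; rewrite sE; apply/bigcupP; by exists s'.
Qed.

Lemma vw_inversion : vertex_weighted (opposite t) (inversion t xi) (fun v => (a v)^-1).
Proof.
case: (vw) => -[F0 Ff a0 ch] _.
have x0 v : (0 < xi [set v])%N by apply: vw_gt0; exact: simps_vert.
have aV v : wtq (opposite t) (xi [set v]) = (a v)^-1 by rewrite wtq_opposite vw_vertex.
split.
  split=> // [v|S SK]; first by rewrite invr_gt0.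
  exact/dvd_chainV/ch.
move=> S SK; have S0 := simps_neq0 SK.
have [u uS um] := exists_min a0 S0 (ch _ SK).
have um' v : v \in S -> if t is Ascending then (xi [set u] %| xi [set v])%N
    else (xi [set v] %| xi [set u])%N.
  move=> vS; have := um v vS; rewrite -!vw_vertex.
  by move=> /(dvdq_wtq _ (x0 u) (x0 v)); case: (t).
(* Both the gcd (ascending) and the lcm (descending) are attained at the vertex with the smallest
   rational weight [a u], that is, with the largest inverse. *)
have -> : inversion t xi S = xi [set u].
  rewrite /inversion; case: (t) um' => um'; apply/eqP; rewrite eqn_dvd; apply/andP; split.
  - exact: (biggcdn_inf u).
  - by apply/dvdn_biggcdP => v; exact: um'.
  - by apply/dvdn_biglcmP => v; exact: um'.
  - exact: (@biglcmn_sup _ u).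
split=> //; rewrite aV; apply/le_anti/andP; split.
  exact: (mx_ge (fun v => (a v)^-1)).
apply: mx_le => [|v vS]; first by rewrite invr_ge0 ltW.
by rewrite lef_pV2 ?posrE//; apply: dvdq_le => //; exact: um.
Qed.

Definition emb (c : chain K) : ealg (vert K) :=
  \sum_(s : simplex K) (c s)%:~R *: (wtq t (xi (val s)) *: ebasis (val s)).

Lemma emb_val c (s : simplex K) : emb c (val s) = (c s)%:~R * wtq t (xi (val s)).
Proof.
rewrite /emb sum_ffunE (bigD1 s)//= !ffunE eqxx /GRing.scale /= mulr1.
rewrite big1 ?addr0// => s' ss'; rewrite !ffunE /GRing.scale /=.
by rewrite (inj_eq val_inj) eq_sym (negPf ss') !mulr0.
Qed.

Lemma emb_out c S : S \notin simps K -> emb c S = 0.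
Proof.
move=> SK; rewrite /emb sum_ffunE big1// => s _; rewrite !ffunE /GRing.scale /=.
by case: eqP => [e|_]; rewrite ?mulr0//; move: SK; rewrite e (valP s).
Qed.

Lemma emb_inlat c : inlat (om_of (simps K) a) (emb c).
Proof.
move=> S; case: (boolP (S \in simps K)) => SK; last by rewrite emb_out//; exact: dvdq0.
by rewrite (emb_val c (exist _ S SK)) vw_om//; exists (c (exist _ S SK)).
Qed.

Lemma wtq_neq0 S : S \in simps K -> wtq t (xi S) != 0.
Proof. by move=> /vw_gt0/(wtq_gt0 t); rewrite lt_def => /andP[]. Qed.

Lemma emb_inj : injective emb.
Proof.
move=> c d e; apply/ffunP => s; have := congr1 (fun z : ealg _ => z (val s)) e.
rewrite !emb_val => /(mulIf (wtq_neq0 (valP s))) /eqP.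
by rewrite eqr_int => /eqP.
Qed.

Lemma emb_surj z : inlat (om_of (simps K) a) z -> exists c, emb c = z.
Proof.
move=> zl; have /choice[f hf] : forall s : simplex K, exists k : int,
    z (val s) = k%:~R * wtq t (xi (val s)).
  by move=> s; have := zl (val s); rewrite vw_om ?(valP s).
exists [ffun s => f s]; apply/ffunP => S; case: (boolP (S \in simps K)) => SK.
  by rewrite (emb_val _ (exist _ S SK)) ffunE -hf.
by rewrite emb_out//; apply/esym/dvd0q; have := zl S; rewrite /om_of (negPf SK).
Qed.

Lemma embB c d : emb (c - d) = emb c - emb d.
Proof.
rewrite /emb -sumrB; apply: eq_bigr => s _.
by rewrite !ffunE intrB scalerBl.
Qed.

Lemma emb0 : emb 0 = 0.
Proof. by rewrite -(subrr 0) embB subrr. Qed.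

Lemma embD c d : emb (c + d) = emb c + emb d.
Proof. by rewrite -[d in LHS]opprK embB -[X in _ - X]opprK -[- - _]opprK -[- emb _]sub0r -emb0 -embB sub0r !opprK. Qed.

Lemma emb_sum (I : Type) (r : seq I) (P : pred I) (F : I -> chain K) :
  emb (\sum_(i <- r | P i) F i) = \sum_(i <- r | P i) emb (F i).
Proof. exact: (big_morph _ embD emb0). Qed.

Lemma embMz c (k : int) : emb (c *~ k) = k%:~R *: emb c.
Proof.
rewrite /emb scaler_sumr; apply: eq_bigr => s _.
by rewrite [RHS]scalerA -intrM ffunMzE mulrzz mulrC.
Qed.

Lemma emb_basis (s : simplex K) : emb (basis s) = wtq t (xi (val s)) *: ebasis (val s).
Proof.
rewrite /emb (bigD1 s)//= ffunE eqxx scale1r big1 ?addr0// => s' ss'.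
by rewrite ffunE (negPf ss') scale0r.
Qed.

Lemma emb_linext (L : complex) (G : ealg (vert L) -> ealg (vert K)) (eL : chain L -> ealg (vert L))
    (g : simplex L -> chain K) (c : chain L) :
  linear G -> (forall c, eL c = \sum_s (c s)%:~R *: eL (basis s)) ->
  (forall s, c s != 0 -> emb (g s) = G (eL (basis s))) ->
  emb (linext g c) = G (eL c).
Proof.
move=> lG eLE h; rewrite /linext emb_sum eLE.
pose G' : {linear ealg (vert L) -> ealg (vert K)} :=
  HB.pack G (GRing.isLinear.Build _ _ _ _ G lG).
rewrite -[G]/(G' : _ -> _) linear_sum; apply: eq_bigr => s _.
rewrite embMz linearZ /=; have [->|cs] := eqVneq (c s) 0; first by rewrite !scale0r.
by rewrite h.
Qed.

Lemma emb_decomp c : emb c = \sum_s (c s)%:~R *: emb (basis s).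
Proof. by rewrite {1}/emb; apply: eq_bigr => s _; rewrite emb_basis. Qed.

Lemma emb_oriented (l : seq (vert K)) : emb (oriented l) =
  if [set v in l] \in simps K then wtq t (xi [set v in l]) *: orient l else 0.
Proof.
rewrite /oriented orientE; case: ifP => ul; last by rewrite emb0 scaler0 if_same.
case: insubP => [s sK sE|/negPf ->]; last exact: emb0.
rewrite embMz emb_basis sK -sE [RHS]scalerA [LHS]scalerA mulrC.
by rewrite rmorphXn /= rmorphN1.
Qed.

Lemma emb_bd c : emb (bd t xi c) = trunc (dl (emb c)).
Proof.
apply: (emb_linext (G := fun c => trunc (dl c)) (eL := emb)).
- by move=> k x y; rewrite !linearP.
- exact: emb_decomp.
move=> s _.
rewrite emb_basis -orient_enum dlZ dl_orient truncZ trunc_sum.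
rewrite scaler_sumr emb_sum -cardE; apply: eq_bigr => j _.
rewrite embMz emb_oriented truncZ; set f := face _ _.
have fs : [set v in f] \subset val s.
  apply/subsetP => v; rewrite inE /f /face mem_cat => /orP[/mem_take|/mem_drop];
  by rewrite mem_enum.
have [f0|f0] := eqVneq f [::].
  rewrite f0 /= set_nil (negPf (simps_n0 K)) !scaler0 (_ : trunc _ = 0) ?scaler0//.
  by apply/ffunP => S; rewrite !ffunE; case: eqP.
have fK : [set v in f] \in simps K.
  apply: simps_face (valP s) fs _; case: (f) f0 => // v f' _.
  by apply/set0Pn; exists v; rewrite inE mem_head.
have -> : trunc (orient f) = orient f.
  apply/ffunP => S; rewrite ffunE; case: eqP => // ->.
  by rewrite (homog_set0 _ (@homog_orient _ f))// lt0n size_eq0.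
rewrite fK !scalerA; congr (_ *: _).
rewrite rmorphM /= rmorphXn /= rmorphN1 -mulrA wratio_wtq ?vw_gt0 ?(valP s)//.
  by rewrite mulrC.
exact: vw_face (valP s) fs (simps_neq0 fK).
Qed.

Lemma emb_dim n c : (c \in @dim_pred K n) <-> homog n.+1 (emb c).
Proof.
split=> [/forallP h S|h].
  case: (boolP (S \in simps K)) => SK; last by rewrite emb_out ?eqxx.
  rewrite (emb_val c (exist _ S SK)) mulf_eq0 negb_or intr_eq0 => /andP[cs _].
  by have := h (exist _ S SK); rewrite cs /= => /eqP.
apply/forallP => s; apply/implyP => cs; apply/eqP/h; rewrite emb_val mulf_eq0 negb_or.
by rewrite intr_eq0 cs wtq_neq0 ?(valP s).
Qed.

Lemma emb_cycle n c : (c \in @cycle_pred t K xi n) <-> Zc (om_of (simps K) a) n.+1 (emb c).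
Proof.
have bdE : bd t xi c == 0 <-> forall S, S != set0 -> dl (emb c) S = 0.
  split=> [/eqP b0 S S0|h].
    have := congr1 emb b0; rewrite emb_bd emb0 => /ffunP/(_ S).
    by rewrite [LHS]ffunE [RHS]ffunE (negPf S0).
  apply/eqP/emb_inj; rewrite emb_bd emb0; apply/ffunP => S; rewrite ffunE [RHS]ffunE.
  by case: ifPn => // /h.
split=> [/andP[hc hb]|[_ hc hb]].
  by split; [exact: emb_inlat|exact/emb_dim|exact/bdE].
by apply/andP; split; [exact/emb_dim|exact/bdE].
Qed.

Lemma emb_boundary n c : (exists2 d, d \in @dim_pred K n.+1 & bd t xi d = c) <->
  Bc (om_of (simps K) a) n.+1 (emb c).
Proof.
have tr y : homog n.+2 y -> trunc (dl y) = dl y.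
  move=> hy; apply/ffunP => S; rewrite [LHS]ffunE; case: eqP => // ->.
  by apply/esym/(homog_set0 (ltn0Sn n)); exact: homog_dl.
split=> [[d hd <-]|[y [yl yh yd]]].
  exists (emb d); split; [exact: emb_inlat|exact/emb_dim|].
  by rewrite emb_bd tr//; exact/emb_dim.
have [d dE] := emb_surj yl; exists d; first by apply/emb_dim; rewrite dE.
by apply: emb_inj; rewrite emb_bd dE tr.
Qed.

End VertexWeighted.

Lemma emb_push (t : wtype) (K K' : complex) (mu : weight K) (mu' : weight K') a a'
    (rho : vert K -> vert K') (c : chain K) :
  vertex_weighted t mu a -> vertex_weighted t mu' a' -> simplicial rho ->
  (forall S, S \in simps K -> dvdq (wtq t (mu' (rho @: S))) (wtq t (mu S))) ->
  emb t mu' (push t mu mu' rho c) = epush rho (emb t mu c).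
Proof.
move=> vw vw' sr d; apply: (@emb_linext t K' mu' K (epush rho) (emb t mu)).
- by move=> k x y; rewrite linearP.
- exact: emb_decomp.
move=> s _; rewrite embMz emb_oriented emb_basis epushZ epush_ebasis.
have -> : [set v in map rho (enum (val s))] = rho @: val s.
  apply/setP => v; rewrite inE; apply/mapP/imsetP => [[x]|[x xS ->]].
    by rewrite mem_enum => xS ->; exists x.
  by exists x; rewrite ?mem_enum.
have sK := valP s; have rK := sr _ sK.
by rewrite rK scalerA wratio_wtq ?(vw_gt0 vw)// ?(vw_gt0 vw')//; exact: d.
Qed.

Section EmbSubdiv.
Variables (t : wtype) (K : complex) (xi : weight K) (eta : weight (Sd K)).
Variables (a : vert K -> rat) (b : vert (Sd K) -> rat).
Hypothesis vwK : vertex_weighted t xi a.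
Hypothesis vwS : vertex_weighted t eta b.
Hypothesis eta_vertex : forall s : simplex K, #|val s| = 1%N ->
  eta [set (s : vert (Sd K))] = xi (val s).
Hypothesis eta_cone : forall (s : simplex K) (T : {set vert (Sd K)}), T \in simps (Sd K) ->
  (forall s' : simplex K, s' \in T -> val s' \proper val s) ->
  eta ((s : vert (Sd K)) |: T) = eta T.

(** [cone] carries no weight coefficient, so it corresponds to [wedge] where adding [b_s] leaves the
    weight unchanged; [eta_cone] grants this over the proper faces of [s]. *)
Lemma emb_cone (s : simplex K) (c : chain (Sd K)) :
  (forall T : simplex (Sd K), c T != 0 ->
    forall s' : simplex K, s' \in val T -> val s' \proper val s) ->
  emb t eta (cone (s : vert (Sd K)) c) = wedge (s : vert (Sd K)) (emb t eta c).
Proof.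
move=> h; apply: (@emb_linext t (Sd K) eta (Sd K) (wedge (s : vert (Sd K))) (emb t eta)).
- by move=> k x y; rewrite linearP.
- exact: emb_decomp.
move=> T cT; rewrite emb_oriented emb_basis linearZ /= orient_enum.
have -> : [set v in (s : vert (Sd K)) :: enum (val T)] = (s : vert (Sd K)) |: val T.
  by apply/setP => v; rewrite !inE mem_enum.
have TK := valP T; rewrite (eta_cone TK (h _ cT)).
suff -> : ((s : vert (Sd K)) |: val T) \in simps (Sd K) by [].
have /simps_SdP[T0 hT] := TK.
apply/simps_SdP; split; first by apply/set0Pn; exists s; rewrite setU11.
move=> s1 s2 /setU1P[->|s1T] /setU1P[->|s2T]; rewrite ?subxx//.
- by rewrite [val s2 \subset _]proper_sub ?orbT// (h _ cT).
- by rewrite [val s1 \subset _]proper_sub// (h _ cT).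
- exact: hT.
Qed.

Lemma emb_subdiv_simplex n (s : simplex K) : #|val s| = n.+1 ->
  emb t eta (subdiv_simplex (bd t xi) n s) = esd (emb t xi (basis s)).
Proof.
elim: n s => [|n IH] s sn.
  rewrite /= emb_oriented emb_basis esdZ esd_simplex.
  have -> : [set v in [:: (s : vert (Sd K))]] = [set (s : vert (Sd K))].
    by apply/setP => v; rewrite !inE.
  rewrite simps_vert eta_vertex//; congr (_ *: wedge _ _).
  have /cards1P[v ->] : #|val s| == 1%N by rewrite sn.
  rewrite -[ebasis [set v]]orient_enum enum_set1 dl_orient /= big_ord1.
  by rewrite expr0 scale1r esd_empty.
have lin0 : linear (@esd K) by move=> k x y; rewrite linearP.
set c := linext (subdiv_simplex (bd t xi) n) (bd t xi (basis s)).
have homb : homog n.+1 (emb t xi (bd t xi (basis s))).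
  rewrite (emb_bd vwK) emb_basis => S; rewrite ffunE; have [_|_] := eqVneq S set0.
    by rewrite eqxx.
  have hs : homog n.+2 (wtq t (xi (val s)) *: ebasis (val s)).
    by apply: homogZ; rewrite -sn; exact: homog_ebasis.
  exact: (homog_dl hs).
have cE : emb t eta c = wtq t (xi (val s)) *: esd (dl (ebasis (val s))).
  rewrite /c (emb_linext lin0 (@emb_decomp t K xi)) => [|s' cs']; last first.
    apply: IH; have := emb_dim vwK n (bd t xi (basis s)).
    by move=> [_ /(_ homb)/forallP/(_ s')]; rewrite cs' => /eqP.
  rewrite (emb_bd vwK) emb_basis dlZ truncZ esdZ; congr (_ *: esd _).
  apply/ffunP => S; rewrite ffunE; case: eqP => // ->.
  have hs : homog n.+2 (ebasis (val s)) by rewrite -sn; exact: homog_ebasis.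
  by apply/esym/(homog_set0 (ltn0Sn n)); exact: (homog_dl hs).
rewrite [subdiv_simplex _ _ _]/= -/c emb_cone.
  by rewrite cE emb_basis esdZ esd_simplex linearZ.
(* What is coned off comes from the boundary of [s], so it lies in subdivisions of proper faces by
   [esd_supp]. *)
move=> T cT s' s'T.
have : emb t eta c (val T) != 0.
  by rewrite emb_val mulf_eq0 negb_or intr_eq0 cT (wtq_neq0 vwS) ?(valP T).
rewrite cE dl_ebasis esd_sum ffunE mulf_eq0 negb_or => /andP[_].
rewrite sum_ffunE => nz.
have [v vs nzv] : exists2 v, v \in val s & esd (sgn v (val s) *: ebasis (val s :\ v)) (val T) != 0.
  apply: contrapT => h0; move/negP: nz; apply; rewrite big1// => v vs.
  by apply/eqP/negPn/negP => h1; apply: h0; exists v.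
have svK : val s :\ v \in simps K.
  apply: simps_face (valP s) (subD1set _ _) _; rewrite -card_gt0.
  by have := cardsD1 v (val s); rewrite vs sn add1n => -[<-].
move: nzv; rewrite esdZ ffunE mulf_eq0 negb_or => /andP[_ nzv].
have := esd_supp svK (val T); case: ifP => [|_ /dvd0q e]; last by rewrite e eqxx in nzv.
move=> /sdfacesP[_ /(_ s' s'T) h] _.
by apply: sub_proper_trans h _; rewrite properD1.
Qed.

Lemma emb_subdiv c : emb t eta (subdiv (bd t xi) c) = esd (emb t xi c).
Proof.
apply: (@emb_linext t (Sd K) eta K (@esd K) (emb t xi)).
- by move=> k x y; rewrite linearP.
- exact: emb_decomp.
move=> s _; apply: emb_subdiv_simplex; rewrite prednK// card_gt0; exact: simplex_neq0.
Qed.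

End EmbSubdiv.

Lemma vw_const1 (K : complex) :
  vertex_weighted Ascending (fun=> 1%N : nat) (fun _ : vert K => 1).
Proof.
split; last first.
  move=> S SK; split=> //=; have a0 : forall v : vert K, 0 < 1 :> rat by [].
  by have [v _ ->] := mx_mem a0 (simps_neq0 SK).
split=> //; [exact: simps_n0|by move=> S T; exact: simps_face|].
by move=> S _ u v _ _; left; exact: dvdq_refl.
Qed.

(** The weight of a chain is that of its largest member, so adding [b_s] changes it and [emb_cone]
    does not apply to [sdw xi]. Instead the case of constant weight 1 is rescaled: every simplex
    occurring in the subdivision of [s] contains [b_s], so all of them have weight [xi s]. *)
Lemma emb_sd (t : wtype) (K : complex) (xi : weight K) a c : vertex_weighted t xi a ->
  emb t (sdw xi) (sd_chain c) = esd (emb t xi c).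
Proof.
move=> vw; have vw1 := vw_const1 K; have vwS1 := vw_const1 (Sd K).
apply: (@emb_linext t (Sd K) (sdw xi) K (@esd K) (emb t xi)).
- by move=> k x y; rewrite linearP.
- exact: emb_decomp.
move=> s _; set g := subdiv_simplex _ _ _.
have gE : emb Ascending (fun=> 1%N) g = esd (ebasis (val s)).
  have := emb_subdiv_simplex vw1 vwS1 (fun _ _ => erefl) (fun _ _ _ _ => erefl) (n := #|val s|.-1) (s := s).
  rewrite -/(bd1 (K := K)) -/g emb_basis /= scale1r; apply.
  by rewrite prednK// card_gt0; exact: simplex_neq0.
rewrite emb_basis esdZ -gE; apply/ffunP => T; rewrite [RHS]ffunE /GRing.scale /=.
case: (boolP (T \in simps (Sd K))) => TK; last first.
  by rewrite (@emb_out _ (Sd K) _ _ _ TK) (@emb_out _ (Sd K) _ _ _ TK) mulr0.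
set T' : simplex (Sd K) := exist _ T TK; rewrite -[T]/(val T').
rewrite (@emb_val _ (Sd K)) (@emb_val _ (Sd K)) /= mulr1 mulrC.
have [->|gT] := eqVneq (g T') 0; first by rewrite !mulr0.
congr (wtq t _ * _).
have : esd (ebasis (val s)) T != 0.
  by rewrite -gE -[T]/(val T') (@emb_val _ (Sd K)) /= mulr1 intr_eq0.
move=> nz; have sT : (s : vert (Sd K)) \in T.
  by move: nz; rewrite esd_simplex ffunE; case: ifP => //; rewrite eqxx.
have := esd_supp (valP s) T; case: ifP => [|_ /dvd0q e]; last by rewrite e eqxx in nz.
move=> /sdfacesP[_ h] _; suff e : sdtop T = val s by rewrite -[sval s]e.
apply/eqP; rewrite eqEsubset; apply/andP; split; last exact: (bigcup_sup s).
by apply/bigcupsP => s'; exact: h.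
Qed.

(** For the inversion, the weight of a chain is determined by its smallest member, so adding a
    larger [b_s] does not change it; this is the condition of [emb_cone]. *)
Lemma emb_hsd (t : wtype) (K : complex) (xi : weight K) a c : vertex_weighted t xi a ->
  emb (opposite t) (inversion t (sdw xi)) (hsd_chain t xi c) =
  esd (emb (opposite t) (inversion t xi) c).
Proof.
move=> vw; apply: emb_subdiv (vw_inversion vw) (vw_inversion (vw_sdw vw)) _ _ _.
  move=> s /eqP/cards1P[v sv]; rewrite inversionE sv inversionE /sdw big_set1.
  by rewrite sv.
move=> s T TK h; have /simps_SdP[/set0Pn[s0 s0T] _] := TK.
have vE (s1 : simplex K) : sdw xi [set (s1 : vert (Sd K))] = xi (val s1).
  by rewrite /sdw big_set1.
have d : if t is Ascending then (xi (val s0) %| xi (val s))%N else (xi (val s) %| xi (val s0))%N.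
  have := vw_face vw (valP s) (proper_sub (h _ s0T)) (simplex_neq0 s0).
  move/(dvdq_wtq _ (vw_gt0 vw (valP s0)) (vw_gt0 vw (valP s))).
  by case: (t).
have sT : (s : vert (Sd K)) \notin T.
  by apply/negP => /h; rewrite properxx.
rewrite /inversion; case: (t) d => d; rewrite big_setU1//= vE.
  apply/gcdn_idPr; apply: dvdn_trans d; rewrite -vE; exact: (biggcdn_inf s0).
apply/eqP; rewrite eqn_dvd dvdn_lcmr andbT dvdn_lcm dvdnn andbT.
by apply: dvdn_trans d _; rewrite -vE; exact: (@biglcmn_sup _ s0).
Qed.

Section Iterates.
Variables (t : wtype) (K : complex) (xi : weight K) (a : vert K -> rat).
Hypothesis vw : vertex_weighted t xi a.

Lemma vw_sdwn m : vertex_weighted t (sdwn xi m) (wI a (m := m)).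
Proof. by elim: m => // m IH; exact: vw_sdw IH. Qed.

Lemma emb_sdn m c : emb t (sdwn xi m) (sdn_chain m c) = esdn m (emb t xi c).
Proof. by elim: m => //= m IH; rewrite (emb_sd _ (vw_sdwn m)) IH. Qed.

Lemma emb_hsdn m c :
  emb (opposite t) (inversion t (sdwn xi m)) (hsdn_chain t xi m c) =
  esdn m (emb (opposite t) (inversion t xi) c).
Proof. by elim: m => //= m IH; rewrite (emb_hsd _ (vw_sdwn m)) IH. Qed.

End Iterates.

(** * From lattices to homology groups *)

Section HomologyMaps.
Variables (t1 t2 : wtype) (K1 K2 : complex) (mu1 : weight K1) (mu2 : weight K2).
Variables (a1 : vert K1 -> rat) (a2 : vert K2 -> rat).
Hypotheses (vw1 : vertex_weighted t1 mu1 a1) (vw2 : vertex_weighted t2 mu2 a2).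
Variables (phi : chain K1 -> chain K2) (F : ealg (vert K1) -> ealg (vert K2)).
Hypothesis phiF : forall c, emb t2 mu2 (phi c) = F (emb t1 mu1 c).
Hypothesis cF : cmap (om_of (simps K1) a1) (om_of (simps K2) a2) F.

Lemma chain_mapB : {morph phi : c d / c - d}.
Proof.
move=> c d; apply: (emb_inj vw2); rewrite embB !phiF embB linearB_of//.
by case: cF.
Qed.

Lemma chain_map_dim k c : c \in @dim_pred K1 k -> phi c \in @dim_pred K2 k.
Proof.
move=> /(emb_dim vw1) h; apply/(emb_dim vw2); rewrite phiF.
by case: cF => _ _ _ hF _; apply: hF => //; exact: emb_inlat.
Qed.

Lemma chain_map_bd c : phi (bd t1 mu1 c) = bd t2 mu2 (phi c).
Proof.
case: (cF) => lF F0 iF _ dF; apply: (emb_inj vw2).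
rewrite phiF !(emb_bd vw1) (emb_bd vw2) phiF dF; last exact: emb_inlat.
(* The coefficient of the empty simplex is split off: [F] fixes that simplex, and lattice chains
   vanish on it, so [F] commutes with [trunc] here. *)
set x := dl _; have xE : x = trunc x + x set0 *: ebasis set0.
  apply/ffunP => S; rewrite !ffunE /GRing.scale /=.
  by case: eqP => [->|_]; rewrite ?mulr1 ?mulr0 ?add0r ?addr0.
have i : inlat (om_of (simps K2) a2) (F (trunc x)).
  by apply: iF; rewrite /x -(emb_bd vw1); exact: emb_inlat.
have z : F (trunc x) set0 = 0.
  by apply: dvd0q; have := i set0; rewrite /om_of (negPf (simps_n0 K2)).
have lD u v : F (u + v) = F u + F v by have := lF 1 u v; rewrite !scale1r.
have FE : F x = F (trunc x) + x set0 *: ebasis set0.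
  by rewrite [X in F X]xE lD linearZ_of// F0.
rewrite FE; apply/ffunP => S; rewrite !ffunE /GRing.scale /=.
by case: eqP => [->|_]; rewrite ?z// mulr0 addr0.
Qed.

Lemma chain_map_cycle n (z : Defs.cycle t1 mu1 n) : phi z \in @cycle_pred t2 K2 mu2 n.
Proof.
apply/(emb_cycle vw2); rewrite phiF; apply: (cmap_Zc cF).
by apply/(emb_cycle vw1); exact: (valP z).
Qed.

Lemma hmap_hclass n (z : Defs.cycle t1 mu1 n) (z' : Defs.cycle t2 mu2 n) :
  phi z = z' -> hmap t1 t2 mu1 mu2 phi (hclass z) = hclass z'.
Proof.
apply: hmapE; [exact: chain_mapB|exact: chain_map_dim|exact: chain_map_bd].
Qed.

End HomologyMaps.

Lemma hclass_surj (t : wtype) (K : complex) (mu : weight K) n (x : homology t mu n) :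
  exists z, x = hclass z.
Proof. by exists (repr (x : Quotient.quot (@boundary_pred t K mu n))); rewrite /hclass reprK. Qed.

Lemma hclass_eq (t : wtype) (K : complex) (mu : weight K) a n (z w : Defs.cycle t mu n) :
  vertex_weighted t mu a ->
  hclass z = hclass w <-> Bc (om_of (simps K) a) n.+1 (emb t mu z - emb t mu w).
Proof.
move=> vw; rewrite -embB.
have -> : val z - val w = val (z - w) by rewrite raddfB.
split.
  move=> e; have : (z - w) \in @boundary_pred t K mu n.
    by rewrite Quotient.idealrBE; apply/eqP.
  by move=> /asboolP h; apply/(emb_boundary vw).
move=> /(emb_boundary vw) h.
have : (z - w) \in @boundary_pred t K mu n by apply/asboolP.
by rewrite Quotient.idealrBE => /eqP.
Qed.

Lemma hclassD (t : wtype) (K : complex) (mu : weight K) n (z w : Defs.cycle t mu n) :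
  hclass (z + w) = hclass z + hclass w.
Proof. by rewrite /hclass Quotient.pi_add. Qed.

(** Homology in degree [n] is computed by lattice cycles of degree [n.+1]; hence the hypotheses
    concern positive degrees. *)
Lemma hom_iso_hmap_comp (t t1 t2 : wtype) (K K1 K2 : complex)
    (mu : weight K) (mu1 : weight K1) (mu2 : weight K2) a a1 a2
    (phi1 : chain K -> chain K1) (phi2 : chain K1 -> chain K2) F1 F2 :
  vertex_weighted t mu a -> vertex_weighted t1 mu1 a1 -> vertex_weighted t2 mu2 a2 ->
  (forall c, emb t1 mu1 (phi1 c) = F1 (emb t mu c)) ->
  (forall c, emb t2 mu2 (phi2 c) = F2 (emb t1 mu1 c)) ->
  cmap (om_of (simps K) a) (om_of (simps K1) a1) F1 ->
  cmap (om_of (simps K1) a1) (om_of (simps K2) a2) F2 ->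
  (forall n z, (0 < n)%N -> Zc (om_of (simps K) a) n z ->
    Bc (om_of (simps K2) a2) n (F2 (F1 z)) -> Bc (om_of (simps K) a) n z) ->
  (forall n z', (0 < n)%N -> Zc (om_of (simps K2) a2) n z' ->
    exists2 z, Zc (om_of (simps K) a) n z & Bc (om_of (simps K2) a2) n (F2 (F1 z) - z')) ->
  forall n, hom_iso (hmap t1 t2 mu1 mu2 phi2 \o hmap t t1 mu mu1 phi1
    : homology t mu n -> homology t2 mu2 n).
Proof.
move=> vw vw1 vw2 e1 e2 c1 c2 inj surj n; set f := (_ \o _).
have fE (z : Defs.cycle t mu n) : exists2 z'' : Defs.cycle t2 mu2 n,
    f (hclass z) = hclass z'' & emb t2 mu2 z'' = F2 (F1 (emb t mu z)).
  pose z1 : Defs.cycle t1 mu1 n := Defs.Cycle (chain_map_cycle vw vw1 e1 c1 z).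
  pose z2 : Defs.cycle t2 mu2 n := Defs.Cycle (chain_map_cycle vw1 vw2 e2 c2 z1).
  exists z2; last by rewrite e2 e1.
  rewrite /f /= (hmap_hclass vw vw1 e1 c1 (z' := z1))//.
  by rewrite (hmap_hclass vw1 vw2 e2 c2 (z' := z2)).
have lF x y : F2 (F1 (x + y)) = F2 (F1 x) + F2 (F1 y).
  case: c1 => l1 _ _ _ _; case: c2 => l2 _ _ _ _.
  by have := l1 1 x y; have := l2 1 (F1 x) (F1 y); rewrite !scale1r => <- <-.
have fD : {morph f : x y / x + y}.
  move=> x y; have [z ->] := hclass_surj x; have [w ->] := hclass_surj y.
  rewrite -hclassD; have [u -> uE] := fE (z + w).
  have [z' -> zE] := fE z; have [w' -> wE] := fE w; rewrite -hclassD.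
  congr hclass; apply/val_inj/(emb_inj vw2); rewrite uE raddfD /= embD lF -zE -wE.
  by rewrite -embD.
split=> //.
have finj : injective f.
  move=> x y; have [z ->] := hclass_surj x; have [w ->] := hclass_surj y.
  have [z' -> zE] := fE z; have [w' -> wE] := fE w => /(hclass_eq _ _ vw2) B.
  apply/(hclass_eq _ _ vw); apply: inj => //.
    by apply: ZcB; apply/(emb_cycle vw); exact: valP.
  have -> : F2 (F1 (emb t mu z - emb t mu w)) = emb t2 mu2 z' - emb t2 mu2 w'; last exact: B.
  have := lF (emb t mu z - emb t mu w) (emb t mu w).
  by rewrite subrK zE wE => ->; rewrite addrK.
have fsurj y : exists x, f x = y.
  have [w ->] := hclass_surj y.
  have Zw : Zc (om_of (simps K2) a2) n.+1 (emb t2 mu2 w).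
    by apply/(emb_cycle vw2); exact: valP.
  have [z Zz Bz] := surj _ _ (ltn0Sn n) Zw.
  have [c cE] : exists c, emb t mu c = z by case: Zz => il _ _; exact: emb_surj vw _ il.
  have cc : c \in @cycle_pred t K mu n by apply/(emb_cycle vw); rewrite cE.
  pose zc : Defs.cycle t mu n := Defs.Cycle cc.
  exists (hclass zc); have [z' -> zE] := fE zc.
  by apply/(hclass_eq _ _ vw2); rewrite zE /= cE.
have [g gE] := choice fsurj.
by exists g => x; [apply: finj; rewrite gE|exact: gE].
Qed.

Section Weights.
Variables (t : wtype) (K : complex) (xi : weight K).
Hypothesis dxi : is_divisible t xi.

Definition vwt (v : vert K) : rat := wtq t (xi [set v]).

Lemma divisible_vertex_weighted : vertex_weighted t xi vwt.
Proof.
have [[x0 xf] xd] := dxi.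
have v0 v : (0 < xi [set v])%N by exact/x0/simps_vert.
have a0 v : 0 < vwt v by exact: wtq_gt0.
have pw (e : rel (vert K)) (s : seq (vert K)) : reflexive e -> pairwise e s ->
    forall u v, u \in s -> v \in s -> e u v || e v u.
  move=> re; elim: s => //= w s IH /andP[/allP ws ps] u v; rewrite !inE.
  move=> /orP[/eqP ->|us] /orP[/eqP ->|vs]; rewrite ?re ?ws ?orbT//.
  exact: IH.
have ch S : S \in simps K -> dvd_chain vwt S.
  move=> /xd[v [r [vr p _]]] u w uS wS.
  have tr : transitive (fun u w => xi [set u] %| xi [set w])%N.
    by move=> b c d; exact: dvdn_trans.
  have re : reflexive (fun u w => xi [set u] %| xi [set w])%N by move=> b.
  rewrite path_pairwise// in p.
  have ur : u \in v :: r by rewrite (perm_mem vr) mem_enum.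
  have wr : w \in v :: r by rewrite (perm_mem vr) mem_enum.
  rewrite /vwt !dvdq_wtq//.
  by case/orP: (pw _ _ re p _ _ ur wr) => ->; case: (t); auto.
split.
  split=> //; first exact: simps_n0.
  by move=> S T; exact: simps_face.
move=> S SK; split; first exact: x0.
apply/le_anti/andP; split; last first.
  apply: mx_le => [|v vS]; first by rewrite ltW// wtq_gt0// x0.
  apply: dvdq_le; [exact: a0|exact/wtq_gt0/x0|].
  apply/(dvdq_wtq t (v0 v) (x0 _ SK)).
  have := xf S [set v] SK (simps_vert v).
  by rewrite sub1set vS => /(_ isT); case: (t).
have [v [r [vr _ ->]]] := xd S SK.
have : (if t is Ascending then last v r else v) \in S.
  rewrite -mem_enum -(perm_mem vr); case: (t); first exact: mem_last.
  exact: mem_head.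
by move=> /(mx_ge vwt); rewrite /vwt; case: (t).
Qed.

End Weights.

(* Imported only here because it redefines the notations for finite sets. *)
From mathcomp Require Import all_classical all_reals all_analysis.
Import numFieldNormedType.Exports.

(** * Compactness and simplicial approximation *)

Local Open Scope classical_set_scope.

Section Coordinates.
Variables (R : realType) (X : topologicalType).

(** Continuity of the inverse comes from compactness of [X], through [coordinates_basis]. *)
Definition coordinates (K : complex) (h : X -> vert K -> R) : Prop :=
  [/\ forall x, is_pt (h x), forall p : vert K -> R, is_pt p -> exists x, h x = p,
      injective h & forall v, continuous (fun x => h x v)].

(** The explicit formula for [sd_inv], built from minima and maxima, gives continuity; the rest is
    that [sd_coord] and [sd_inv] are mutually inverse. *)
Lemma coordinates_sd (K : complex) (h : X -> vert K -> R) :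
  coordinates h -> coordinates (fun x => sd_inv (h x)).
Proof.
move=> [hp hs hi hc]; split.
- by move=> x; exact: sd_inv_pt.
- move=> p pp; have [x hx] := hs _ (sd_coord_pt pp).
  by exists x; rewrite hx sd_coordK.
- by move=> x y /(congr1 (@sd_coord _ _)); rewrite !sd_invK//; exact: hi.
- move=> s.
  have cmin : continuous (fun x => \big[Num.min/1]_(v in val (s : simplex K)) h x v).
    have m : continuous (fun xy : R * R => Num.min xy.1 xy.2) by exact: min_continuous.
    by move=> x; apply: (continuous_big m) => v _; exact: hc.
  have cmax : continuous
      (fun x => \big[Num.max/0]_(v in ~: val (s : simplex K)) h x v).
    have m : continuous (fun xy : R * R => Num.max xy.1 xy.2) by exact: max_continuous.
    by move=> x; apply: (continuous_big m) => v _; exact: hc.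
  have cd : continuous (fun x => \big[Num.min/1]_(v in val (s : simplex K)) h x v
      - \big[Num.max/0]_(v in ~: val (s : simplex K)) h x v).
    by move=> x; apply: cvgB; [exact: cmin|exact: cmax].
  move=> x; apply: cvgM; first exact: cvg_cst.
  have mm (f g : X -> R) : continuous f -> continuous g ->
      continuous (fun x => Num.max (f x) (g x)) by exact: max_fun_continuous.
  by apply: (mm (fun=> 0)) => // y; exact: cvg_cst.
Qed.

Lemma coordinates_sdn (K : complex) (h : X -> vert K -> R) m :
  coordinates h -> coordinates (fun x => sdn_inv (h x) (m := m)).
Proof.
by move=> hh; elim: m => [//|m IH]; exact: (coordinates_sd IH).
Qed.

Hypothesis cX : compact [set: X].

Lemma near_coordinate (K : complex) (h : X -> vert K -> R) v z (c d : R) :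
  coordinates h -> d < `|h z v - c| -> \forall z' \near z, d < `|h z' v - c|.
Proof.
move=> [_ _ _ hc] dz.
have cf : (fun z' => `|h z' v - c|) @ z --> `|h z v - c|.
  by apply: cvg_norm; apply: cvgB; [exact: hc|exact: cvg_cst].
exact: (cf [set t | d < t] (lt_nbhsr dz)).
Qed.

(** A point [z] other than [x] differs from it in some coordinate, and half of that difference
    persists near [z]; near [x] itself one is inside [U]. Compactness turns this into one radius. *)
Lemma coordinates_basis (K : complex) (h : X -> vert K -> R) : coordinates h ->
  forall x (U : set X), nbhs x U ->
  exists2 e, 0 < e & forall z, (forall v, `|h z v - h x v| < e) -> U z.
Proof.
move=> hh x U Ux; have [hp hs hi hc] := hh.
have H : \forall e \near 0^'+, [set: X] `<=`
    (fun z => U z \/ exists v, e <= `|h z v - h x v|).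
  move/compact_near_coveringP : cX; apply => z _.
  have [e|nzx] := pselect (h z = h x).
    rewrite (hi _ _ e); exists (U, setT) => /=; first by split=> //; exact: filterT.
    by case=> a b [/= Ua _]; left.
  have [v vzx] : exists v, h z v != h x v.
    apply: contrapT => h1; apply: nzx; apply/funext => v.
    by apply/eqP/negPn/negP => h2; apply: h1; exists v.
  have d0 : 0 < `|h z v - h x v| / 2 by rewrite divr_gt0// normr_gt0 subr_eq0.
  exists ([set z' | `|h z v - h x v| / 2 < `|h z' v - h x v|],
          [set e | e < `|h z v - h x v| / 2]) => /=.
    split; last exact: nbhs_right_lt.
    apply: near_coordinate => //; rewrite ltr_pdivrMr// ltr_pMr ?ltr1n//.
    by rewrite normr_gt0 subr_eq0.
  case=> a b [/= ha hb]; right; exists v; exact/ltW/(lt_trans hb).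
near (0 : R)^'+ => e; exists e; first by near: e; exact: nbhs_right_gt.
have He : [set: X] `<=` (fun z => U z \/ exists v, e <= `|h z v - h x v|).
  by near: e; exact: H.
by move=> z zx; have [//|[v]] := He z Logic.I; rewrite leNgt zx.
Unshelve. all: by end_near. Qed.

(** A Lebesgue number for a cover whose admissible members depend on the centre of the ball. As
    admissibility is an open condition, the usual argument with half the radius goes through. *)
Lemma lebesgue_number (K : complex) (k : X -> vert K -> R) (I : Type)
    (U : I -> set X) (ok : X -> I -> Prop) : coordinates k ->
  (forall i, open (U i)) ->
  (forall x i, ok x i -> \forall z \near x, ok z i) ->
  (forall x, exists2 i, ok x i & U i x) ->
  exists2 e, 0 < e & forall x, exists2 i, ok x i &
    forall z, (forall v, `|k z v - k x v| < e) -> U i z.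
Proof.
move=> hk oU oko hx; have [_ _ _ kc] := hk.
have H : \forall e \near 0^'+, [set: X] `<=` (fun x => exists2 i, ok x i &
    forall z, (forall v, `|k z v - k x v| < e) -> U i z).
  move/compact_near_coveringP : cX; apply => x _.
  have [i oki Ui] := hx x.
  have [d d0 hd] : exists2 d, 0 < d & forall z, (forall v, `|k z v - k x v| < d) -> U i z.
    by apply: coordinates_basis => //; apply: open_nbhs_nbhs; split => //; exact: oU.
  have d20 : 0 < d / 2 by rewrite divr_gt0.
  exists ([set z | ok z i /\ forall v, `|k z v - k x v| < d / 2],
          [set e | e < d / 2]) => /=.
    split; last exact: nbhs_right_lt.
    apply: filterI; first exact: oko.
    apply: filter_forall => v.
    have cf : (fun z' => `|k z' v - k x v|) @ x --> `|k x v - k x v|.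
      by apply: cvg_norm; apply: cvgB; [exact: kc|exact: cvg_cst].
    rewrite subrr normr0 in cf.
    exact: (cf [set t | t < d / 2] (lt_nbhsl d20)).
  case=> z e [/= [okz zx] ed]; exists i => // w wz; apply: hd => v.
  rewrite -(subrKA (k z v)) (splitr d); apply: le_lt_trans (ler_normD _ _) _.
  by apply: ltrD => //; exact: lt_trans (wz v) ed.
near (0 : R)^'+ => e; exists e; first by near: e; exact: nbhs_right_gt.
have He : [set: X] `<=` (fun x => exists2 i, ok x i &
    forall z, (forall v, `|k z v - k x v| < e) -> U i z).
  by near: e; exact: H.
by move=> x; exact: He.
Unshelve. all: by end_near. Qed.

End Coordinates.

Section Realization.
Variables (R : realType) (K : complex).

Lemma compact_realization : compact (realization R K).
Proof.
pose cube := [set x : {ptws vert K -> R} | forall v, `[0, 1]%classic (x v)].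
have ccube : compact cube.
  have := @tychonoff (vert K) (fun=> R : topologicalType) (fun=> `[0, 1]%classic).
  by apply => v; exact: segment_compact.
have pc v : continuous (fun x : {ptws vert K -> R} => x v).
  exact: (@proj_continuous (vert K) (fun=> R) v).
apply: (subclosed_compact _ ccube); last first.
  move=> x [x0 x1 _] v /=; rewrite in_itv /= x0 -x1 (bigD1 v)//= lerDl.
  exact: sumr_ge0.
move=> x clx.
have near_pt (P : set {ptws vert K -> R}) : nbhs x P -> exists y, realization R K y /\ P y.
  by move=> /clx[y [yr yP]]; exists y.
have sc : continuous (fun x : {ptws vert K -> R} => \sum_v x v).
  have m : continuous (fun xy : R * R => xy.1 + xy.2) by exact: add_continuous.
  by move=> y; apply: (continuous_big m) => v _; exact: pc.
have xge0 v : 0 <= x v.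
  rewrite leNgt; apply/negP => xv.
  have [y [[y0 _ _] /=]] := near_pt _ (pc v x [set t | t < 0] (lt_nbhsl xv)).
  by rewrite ltNge y0.
have x1 : \sum_v x v = 1.
  apply: contrapT => /eqP; rewrite neq_lt => /orP[] s1.
    have [y [[_ y1 _] /=]] := near_pt _ (sc x [set t | t < 1] (lt_nbhsl s1)).
    by rewrite y1 ltxx.
  have [y [[_ y1 _] /=]] := near_pt _ (sc x [set t | 1 < t] (lt_nbhsr s1)).
  by rewrite y1 ltxx.
split => //.
(* Coordinates positive at the limit stay positive nearby, so the carrier of the limit is a face of
   the carrier of some point of the realization. *)
have : nbhs (x : {ptws vert K -> R}) [set y | forall v, 0 < x v -> 0 < y v].
  have h (v : vert K) : nbhs (x : {ptws vert K -> R}) [set y | 0 < x v -> 0 < y v].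
    case: (boolP (0 < (x v : R))) => xv; last first.
      apply: (@filterS _ (nbhs (x : {ptws vert K -> R})) _ setT) => [y _|].
        by [].
      exact: filterT.
    have n : nbhs (x : {ptws vert K -> R}) [set y | 0 < y v].
      exact: (pc v x [set t | 0 < t] (lt_nbhsr xv)).
    apply: (@filterS _ (nbhs (x : {ptws vert K -> R})) _ [set y | 0 < y v]) => [y yv _|].
      exact: yv.
    exact: n.
  exact: (@filter_forall _ _ (fun v => [set y : {ptws vert K -> R} | 0 < x v -> 0 < y v]) (nbhs (x : {ptws vert K -> R})) _ h).
move=> /near_pt[y [[y0 y1 yc] xy]].
refine (simps_face yc _ _).
  apply/fintype.subsetP => v; rewrite !inE => xv.
  by rewrite gt_eqF// xy// lt_def xv xge0.
apply: contra_eq_neq x1 => c0; rewrite big1 1?eq_sym ?oner_neq0// => v _.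
by apply/eqP; have := finset.in_set0 v; rewrite -c0 inE => /negbT; rewrite negbK.
Qed.

Section Homeo.
Variables (X : topologicalType) (g : X -> realization R K).
Hypothesis hg : homeomorphism g.

Lemma homeo_coordinates : coordinates (fun x => set_val (g x)).
Proof.
have [k [gk kg cg ck]] := hg; split.
- by move=> x; have [p0 p1 p2] := set_valP (g x).
- move=> p [p0 p1 p2].
  have pr : realization R K p by [].
  exists (k (exist _ p (mem_set pr))).
  by rewrite kg.
- by move=> x y /val_inj/(can_inj gk).
- move=> v x.
  have pc : continuous (fun x : {ptws vert K -> R} => x v).
    exact: (@proj_continuous (vert K) (fun=> R) v).
  have c1 : {for x, continuous (fun x => set_val (g x) : {ptws vert K -> R})}.
    apply: (@continuous_comp X (realization R K) {ptws vert K -> R} g set_val).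
      exact: cg.
    exact: initial_continuous.
  exact: (@continuous_comp X {ptws vert K -> R} R _ (fun y => y v) x c1 (pc _)).
Qed.

Lemma homeo_compact : compact [set: X].
Proof.
have [k [gk kg cg ck]] := hg.
move=> F FF _.
pose h (x : X) : {ptws vert K -> R} := set_val (g x).
have [p [pr clp]] : realization R K `&` cluster (h @ F) !=set0.
  apply: compact_realization.
  have FT : F setT by exact: filterT.
  by apply: (@filterS _ F _ setT) FT => x _; exact: (set_valP (g x)).
pose q : realization R K := exist _ p (mem_set pr).
exists (k q); split=> // A B FA nB.
have : nbhs q (k @^-1` B) by exact: ck.
move=> [_ [[V oV <-]] /= Vq VB].
have nV : nbhs p V by apply: open_nbhs_nbhs; split.
have hA : (h @ F) (h @` A).
  by apply: (@filterS _ F _ A) FA => x Ax; exists x.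
have [_ [[x Ax <-] Vx]] := clp _ _ hA nV.
by exists x; split=> //; have := VB (g x) Vx; rewrite /= gk.
Qed.

End Homeo.
End Realization.

Lemma mesh_small (R : realType) (n : nat) (e : R) : (0 < n)%N -> 0 < e ->
  exists m, (1 - n%:R^-1) ^+ m < e.
Proof.
move=> n0 e0; set q := 1 - _.
have q1 : `|q| < 1.
  rewrite ger0_norm /q; last by rewrite subr_ge0 invf_le1 ?ltr0n// ler1n.
  by rewrite gtrDl oppr_lt0 invr_gt0 ltr0n.
have /cvgrPdist_lt/(_ _ e0)[m _ /(_ m (leqnn m))] := cvg_expr q1.
rewrite /= sub0r normrN => h; exists m; exact: le_lt_trans (ler_norm _) h.
Qed.

(** * Approximation and refinement under weight conditions *)

Section Approximation.
Variables (R : realType) (X : topologicalType) (K K' : complex).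
Variables (h : X -> vert K -> R) (h' : X -> vert K' -> R).
Variables (a : vert K -> rat) (a' : vert K' -> rat).
Hypothesis cX : compact [set: X].
Hypothesis hh : coordinates h.
Hypothesis hh' : coordinates h'.
Hypothesis wK : wcpx (simps K) a.
Hypothesis wK' : wcpx (simps K') a'.

(** At each point, some vertex of the carrier in [K'] is light enough to be the image of a vertex of
    [K]-weight as large as the point allows. *)
Definition dominates : Prop := forall x, exists2 v' : vert K',
  h' x v' != 0 & dvdq (a' v') (mx a (carrier (h x))).

Hypothesis dom : dominates.

Lemma dominates_lebesgue (L : complex) (k : X -> vert L -> R) : coordinates k ->
  exists2 e, 0 < e & forall x, exists2 v' : vert K', dvdq (a' v') (mx a (carrier (h x))) &
    forall z, (forall v, `|k z v - k x v| < e) -> h' z v' != 0.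
Proof.
move=> hk; pose ok x v' := dvdq (a' v') (mx a (carrier (h x))).
have [hp _ _ hc] := hh; have [h'p _ _ h'c] := hh'.
apply: (@lebesgue_number _ _ cX _ _ _ (fun v' => [set z | h' z v' != 0]) ok) => //.
- move=> v'; have -> : [set z | h' z v' != 0] = h'^~ v' @^-1` [set~ 0].
    by apply/seteqP; split=> z /= /eqP.
  by apply: open_comp => [z _|]; [exact: h'c|exact/closed_openC/closed_eq].
- move=> x v' okx.
  (* Near [x] carriers can only grow, and the largest weight is then replaced by a multiple; so an
     admissible target at [x] stays admissible nearby. *)
  have near_supp (v : vert K) : \forall z \near x, h x v != 0 -> h z v != 0.
    have [e|xv] := eqVneq (h x v) 0.
      by apply: (@filterS _ (nbhs x) _ setT) => [z _|]; rewrite ?e ?eqxx//; exact: filterT.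
    have : 0 < `|h x v - 0| by rewrite subr0 normr_gt0.
    move=> /(near_coordinate hh) n; apply: (@filterS _ (nbhs x) _ _ _ _ n) => z.
    by rewrite /= subr0 normr_gt0.
  have n := @filter_forall _ _ _ _ _ near_supp.
  apply: (@filterS _ (nbhs x) _ _ _ _ (n _)) => z /= hz.
  apply: dvdq_trans okx _.
  have [_ _ xc] := hp x; have [_ _ zc] := hp z; have [F0 _ a0 ch] := wK.
  apply: mx_dvdq => //; first exact: simps_neq0.
  move=> v; rewrite inE => /hz zv; apply: dvdq_mx => //; first exact: ch.
  by rewrite inE.
- by move=> x; have [v' xv' d] := dom x; exists v'.
Qed.

Lemma vertex_point m (w : vert (Sdn K m)) : exists x, h x = sdn_vertex R w.
Proof.
by have [_ hs _ _] := hh; apply: hs; apply: sdn_coord_pt; exact: vertex_pt_pt.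
Qed.

(** The image of [w] is chosen at the point of [X] where [w] sits: the carrier of that point in [K]
    is [vcar w], whose largest weight is [wI a w]. All points with [w] in their subdivided carrier
    lie within the mesh of it, hence in the star of the chosen vertex. *)
Lemma exists_approx : exists m (rho : vert (Sdn K m) -> vert K'),
  (forall x w, sdn_inv (h x) w != 0 -> h' x (rho w) != 0) /\
  forall w, dvdq (a' (rho w)) (wI a w).
Proof.
have [e e0 he] := dominates_lebesgue hh.
have [m hm] : exists m, forall w : vert (Sdn K m), (1 - #|vert K|%:R^-1) ^+ m < e.
  have [K0|/mesh_small/(_ e0)[m hm]] := posnP #|vert K|; last by exists m.
  by exists 0%N => w; have := max_card (pred1 w); rewrite card1 /= K0.
have /choice[rho hrho] : forall w : vert (Sdn K m), exists v' : vert K',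
    (forall x, sdn_inv (h x) w != 0 -> h' x v' != 0) /\ dvdq (a' v') (wI a w).
  move=> w; have [x0 x0w] := vertex_point w; have [v' d hv'] := he x0.
  have [hp _ _ _] := hh; exists v'; split.
    move=> x xw; apply: hv' => v; apply: le_lt_trans (hm w).
    rewrite x0w -{1}(sdn_invK m (hp x)).
    by apply: sdn_coord_close => //; exact: sdn_inv_pt.
  by case: wK => _ _ a0 _; rewrite wIE// -(carrier_sdn_vertex R) -x0w.
by exists m, rho; split=> [x w|w]; case: (hrho w) => h1 h2; [exact: h1|exact: h2].
Qed.

(** An admissible vertex [v'] at [x] still belongs to the carrier in [K'] of each nearby vertex [w]
    of the subdivision. The smallest weight on that carrier, [wII a' w], therefore divides
    [a' v']. *)
Lemma exists_refinement : exists r, forall x (w : vert (Sdn K' r)),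
  sdn_inv (h' x) w != 0 -> dvdq (wII a' w) (mx a (carrier (h x))).
Proof.
have [e e0 he] := dominates_lebesgue hh'.
have [r hr] : exists r, X -> (1 - #|vert K'|%:R^-1) ^+ r < e.
  have [x0|n] := pselect (exists x : X, True); last by exists 0%N => x; exfalso; apply: n; exists x.
  have [x _] := x0; have [hp' _ _ _] := hh'.
  have K'0 : (0 < #|vert K'|)%N.
    by have [_ _ /simps_neq0/set0Pn[v _]] := hp' x; apply/card_gt0P; exists v.
  by have [r hr] := mesh_small K'0 e0; exists r.
exists r => x w xw; have [v' d hv'] := he x.
have [hp' hs' _ _] := hh'; have [_ _ a'0 ch'] := wK'.
have [z zw] : exists z, h' z = sdn_vertex R w.
  by apply: hs'; apply: sdn_coord_pt; exact: vertex_pt_pt.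
apply: dvdq_trans d; rewrite wIIE//.
apply: mn_dvdq => //; first exact/ch'/vcar_simps.
rewrite -(carrier_sdn_vertex R) -zw inE; apply: hv' => v.
rewrite distrC zw -{1}(sdn_invK r (hp' x)); apply: le_lt_trans (hr x).
by apply: sdn_coord_close => //; exact: sdn_inv_pt.
Qed.

End Approximation.

Local Close Scope classical_set_scope.

(** * Weighted triangulations of a compact space *)

Lemma coordinates_simplex (R : realType) (X : topologicalType) (K : complex)
    (h : X -> vert K -> R) (S : {set vert K}) : coordinates h -> S \in simps K ->
  exists x, carrier (h x) = S.
Proof.
move=> [_ hs _ _] SK; pose p : vert K -> R := fun v => (v \in S)%:R / #|S|%:R.
have S0 : 0 < #|S|%:R :> R by rewrite ltr0n card_gt0; exact: simps_neq0.
have cp : carrier p = S.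
  apply/finset.setP => v; rewrite inE /p mulf_eq0 invr_eq0 (gt_eqF S0) orbF.
  by rewrite pnatr_eq0 eqb0 negbK.
have pp : is_pt p.
  split; last by rewrite cp.
    by move=> v; rewrite divr_ge0// ler0n.
  rewrite -mulr_suml -natr_sum (_ : \sum_v _ = #|S|)%N ?divff ?gt_eqF//.
  by rewrite -sum1_card [RHS]big_mkcond; apply: eq_bigr => v _; case: ifP.
by have [x hx] := hs _ pp; exists x; rewrite hx.
Qed.

Section WeightedTriangulations.
Variables (R : realType) (X : topologicalType).
Hypothesis cX : compact [set: X]%classic.

(** All triangulations are taken on one space; the homeomorphism of the theorem is absorbed into the
    coordinates of the second one, so that approximations are approximations of the identity. *)
Record wtri := WTri {
  tcx : complex; twt : vert tcx -> rat; tco : X -> vert tcx -> R;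
  tcoP : coordinates tco; twtP : wcpx (simps tcx) twt }.
Implicit Types T L N : wtri.

Definition tom T := om_of (simps (tcx T)) (@twt T).
Arguments tom : clear implicits.
Definition tcar T x := carrier (@tco T x).
Definition tmx T x := mx (@twt T) (tcar T x).
Definition tchain T := ealg (vert (tcx T)).

(** Simplicial approximation of the identity, read pointwise on carriers, with the weight condition
    on vertices. Simpliciality follows from [follows_contiguous]. *)
Definition follows L T (rho : vert (tcx L) -> vert (tcx T)) : Prop :=
  (forall x w, w \in tcar L x -> rho w \in tcar T x) /\
  (forall w, dvdq (@twt T (rho w)) (@twt L w)).

Lemma tcar_simps T x : tcar T x \in simps (tcx T).
Proof. by have [hp _ _ _] := @tcoP T; have [] := hp x. Qed.

Lemma tcar_dvd T x v : v \in tcar T x -> dvdq (twt v) (tmx T x).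
Proof.
have [_ _ a0 ch] := @twtP T => vx; apply: dvdq_mx => //; exact/ch/tcar_simps.
Qed.

Lemma tmx_dvd T x q : (forall v, v \in tcar T x -> dvdq (@twt T v) q) -> dvdq (tmx T x) q.
Proof.
have [_ _ a0 _] := @twtP T => h; apply: mx_dvdq => //.
exact/simps_neq0/tcar_simps.
Qed.

Lemma follows_comp L T T' (r : vert (tcx L) -> vert (tcx T))
    (r' : vert (tcx T) -> vert (tcx T')) :
  follows r -> follows r' -> follows (r' \o r).
Proof.
move=> [c d] [c' d']; split=> [x w wx|w] /=; first exact/c'/c.
exact: dvdq_trans (d' _) (d _).
Qed.

(** Every simplex of [L] is the carrier of some point, and both images lie in the carrier of that
    point in [T]. *)
Lemma follows_contiguous L T (r0 r1 : vert (tcx L) -> vert (tcx T)) S :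
  follows r0 -> follows r1 -> S \in simps (tcx L) ->
  (r0 @: S) :|: (r1 @: S) \in simps (tcx T).
Proof.
move=> [c0 _] [c1 _] SL; have [x xS] := coordinates_simplex (@tcoP L) SL.
apply: (simps_face (tcar_simps T x)).
  rewrite finset.subUset; apply/andP; split; apply/fintype.subsetP => _ /imsetP[v vS ->].
    by apply: c0; rewrite /tcar xS.
  by apply: c1; rewrite /tcar xS.
case/set0Pn: (simps_neq0 SL) => v vS; apply/set0Pn; exists (r0 v).
by rewrite inE imset_f.
Qed.

Lemma follows_homotopic L T (r0 r1 : vert (tcx L) -> vert (tcx T)) :
  follows r0 -> follows r1 -> homotopic (tom L) (tom T) (epush r0) (epush r1).
Proof.
move=> f0 f1; apply: (contiguous_homotopic (@twtP L) (@twtP T)) => [S SL|S v _ _|S v _ _].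
- exact: follows_contiguous.
- by case: f0.
- by case: f1.
Qed.

Lemma follows_cmap L T (r : vert (tcx L) -> vert (tcx T)) :
  follows r -> cmap (tom L) (tom T) (epush r).
Proof.
move=> f; apply: (cmap_epush (@twtP L) (@twtP T)) => [S SL|S v _ _]; last by case: f.
by rewrite -[r @: S]finset.setUid; exact: follows_contiguous.
Qed.

Definition refines T L (E : tchain T -> tchain L) (p : vert (tcx L) -> vert (tcx T)) : Prop :=
  [/\ follows p, cmap (tom T) (tom L) E,
      homotopic (tom T) (tom T) (epush p \o E) id &
      homotopic (tom L) (tom L) (E \o epush p) id].

(** At each point the largest weights of [T] and [L] divide each other, so the existence of
    approximations is governed by the same condition for both. This holds for [sdI], but can fail
    for [sdII]. *)
Definition tight T L : Prop :=
  (forall x, dvdq (tmx T x) (tmx L x)) /\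
  (forall x w, w \in tcar L x -> dvdq (@twt L w) (tmx T x)).

Lemma refines_id T : refines (id : tchain T -> tchain T) id.
Proof.
split; [by split=> // w; exact: dvdq_refl|exact: cmap_id| |];
  by apply: eq_homotopic (@homotopic_refl _ _ _ _ id) => // c; rewrite /= epush_id.
Qed.

Lemma tight_id T : tight T T.
Proof. by split=> [x|x w]; [exact: dvdq_refl|exact: tcar_dvd]. Qed.

(** The induced map, push forward after [m] subdivisions, is the case [L = sdI T m]. *)
Definition is_approx T T' (F : tchain T -> tchain T') : Prop :=
  exists L (E : tchain T -> tchain L) p (rho : vert (tcx L) -> vert (tcx T')),
    [/\ refines E p, tight T L, follows rho & F =1 epush rho \o E].

Lemma approx_cmap T T' (F : tchain T -> tchain T') : is_approx F -> cmap (tom T) (tom T') F.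
Proof.
move=> [L [E [p [rho [[_ cE _ _] _ fr eF]]]]].
have -> : F = epush rho \o E by apply/funext.
exact: cmap_comp cE (follows_cmap fr).
Qed.

Lemma approx_id T : is_approx (id : tchain T -> tchain T).
Proof.
exists T, id, id, id; split; [exact: refines_id|exact: tight_id| |].
  by have [] := refines_id T.
by move=> c; rewrite /= epush_id.
Qed.

Lemma approx_follows T T' T'' (F : tchain T -> tchain T') (r : vert (tcx T') -> vert (tcx T'')) :
  is_approx F -> follows r -> is_approx (epush r \o F).
Proof.
move=> [L [E [p [rho [rE tL fr eF]]]]] frr.
exists L, E, p, (r \o rho); split=> //; first exact: follows_comp.
by move=> c; rewrite /= eF /= epush_comp.
Qed.

(** [tdom] ensures that an approximation from [T] to [T'] exists; the stronger [tdom_all] is what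
    [approx_comp] needs. *)
Definition tdom T T' : Prop := forall x, exists2 v', v' \in tcar T' x &
  dvdq (@twt T' v') (tmx T x).
Definition tdom_all T T' : Prop := forall x v', v' \in tcar T' x ->
  dvdq (@twt T' v') (tmx T x).

Lemma tdom_allW T T' : tdom_all T T' -> tdom T T'.
Proof.
by move=> h x; case/set0Pn: (simps_neq0 (tcar_simps T' x)) => v vx; exists v; last exact: h.
Qed.

Definition sdI T m : wtri :=
  @WTri (Sdn (tcx T) m) (wI (@twt T) (m := m)) (fun x => sdn_inv (tco x) (m := m))
    (coordinates_sdn m (@tcoP T)) (proj1 (sd_weight_wI (@twtP T) m)).

Definition sdII T m : wtri :=
  @WTri (Sdn (tcx T) m) (wII (@twt T) (m := m)) (fun x => sdn_inv (tco x) (m := m))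
    (coordinates_sdn m (@tcoP T)) (proj1 (sd_weight_wII (@twtP T) m)).

Lemma tcar_sdn T m (x : X) : tcar T x =
  \bigcup_(w in carrier (sdn_inv (@tco T x) (m := m))) vcar w.
Proof.
have [hp _ _ _] := @tcoP T; rewrite -carrier_sdn_coord; last exact: sdn_inv_pt.
by rewrite sdn_invK.
Qed.

Lemma refines_sdI T m : exists p, refines (@esdn (tcx T) m : tchain T -> tchain (sdI T m)) p.
Proof.
have h := sd_weight_wI (@twtP T).
have [p [p1 p2 p3 p4 p5]] := tower_equivalence (fun m => proj1 (h m)) (fun m => proj2 (h m)) m.
exists p; split=> //; last exact: (cmap_esdn (fun m => proj1 (h m)) (fun m => proj2 (h m))).
split=> // x w; rewrite (tcar_sdn T m) => wx.
by apply/bigcupP; exists w; last exact: p1.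
Qed.

Lemma refines_sdII T m : exists p, refines (@esdn (tcx T) m : tchain T -> tchain (sdII T m)) p.
Proof.
have h := sd_weight_wII (@twtP T).
have [p [p1 p2 p3 p4 p5]] := tower_equivalence (fun m => proj1 (h m)) (fun m => proj2 (h m)) m.
have e : om_of (simps (tcx T)) (@twt T) = @omn (tcx T) (fun m => @wII (tcx T) (@twt T) m) 0%N.
  by rewrite /omn wII0.
exists p; split.
- split=> [x w|w]; last by have := p2 w; rewrite wII0.
  rewrite (tcar_sdn T m) => wx.
  by apply/bigcupP; exists w; last exact: p1.
- have := cmap_esdn (fun m => proj1 (h m)) (fun m => proj2 (h m)) m.
  by rewrite /tom e.
- by rewrite /tom e.
- exact: p5.
Qed.

Lemma tight_sdI T m : tight T (sdI T m).
Proof.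
have [_ _ a0 ch] := @twtP T; split=> [x|x w wx].
  apply: tmx_dvd => v; rewrite (tcar_sdn T m) => /bigcupP[w wx vw].
  apply: dvdq_trans (@tcar_dvd (sdI T m) x w wx); rewrite /= wIE//.
  by apply: dvdq_mx => //; exact/ch/vcar_simps.
rewrite /= wIE//; apply: mx_dvdq => //; first exact/simps_neq0/vcar_simps.
move=> v vw; apply: tcar_dvd; rewrite (tcar_sdn T m).
by apply/bigcupP; exists w.
Qed.

Lemma exists_tight T T' : tdom T T' -> exists L (E : tchain T -> tchain L) p rho,
  [/\ refines E p, tight T L & @follows L T' rho].
Proof.
move=> d; have dom : dominates (@tco T) (@tco T') (@twt T) (@twt T').
  by move=> x; have [v' v'x dv] := d x; exists v' => //; rewrite inE in v'x.
have [m [rho [r1 r2]]] := exists_approx cX (@tcoP T) (@tcoP T') (@twtP T) dom.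
have [p rp] := refines_sdI T m.
exists (sdI T m), (@esdn (tcx T) m), p, rho; split=> //; first exact: tight_sdI.
by split=> // x w; rewrite !inE; exact: r1.
Qed.

Lemma exists_tapprox T T' : tdom T T' -> exists F : tchain T -> tchain T', is_approx F.
Proof.
by move=> /exists_tight[L [E [p [rho [rE tL fr]]]]]; exists (epush rho \o E), L, E, p, rho.
Qed.

(** Tightness allows a refinement [N] of [L1] with an approximation [th] to [L2]. The two routes
    from [N] to [T'] are contiguous, and so are the two routes from [N] to [T]; as [E2] inverts [p2]
    up to homotopy, the latter identifies [th] after [Q] and [E1] with [E2]. *)
Lemma approx_unique T T' (F1 F2 : tchain T -> tchain T') : is_approx F1 -> is_approx F2 ->
  homotopic (tom T) (tom T') F1 F2.
Proof.
move=> [L1 [E1 [p1 [r1 [[fp1 cE1 h1 h1'] t1 fr1 e1]]]]].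
move=> [L2 [E2 [p2 [r2 [[fp2 cE2 h2 h2'] t2 fr2 e2]]]]].
have d12 : tdom L1 L2.
  apply: tdom_allW => x w wx; apply: dvdq_trans (proj2 t2 _ _ wx) (proj1 t1 x).
have [N [Q [q [th [[fq cQ k k'] tN fth]]]]] := exists_tight d12.
have cr1 := follows_cmap fr1; have cr2 := follows_cmap fr2.
have cp1 := follows_cmap fp1; have cp2 := follows_cmap fp2.
have cq := follows_cmap fq; have cth := follows_cmap fth.
have cQE : cmap (tom T) (tom N) (Q \o E1) by exact: cmap_comp cE1 cQ.
have s1 : homotopic (tom T) (tom T') F1 (epush r1 \o epush q \o (Q \o E1)).
  apply: homotopic_sym.
  apply: (@eq_homotopic _ _ _ _ ((epush r1 \o (epush q \o Q)) \o E1) _ ((epush r1 \o id) \o E1)) => //.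
  by apply: homotopic_compr cE1 _; apply: homotopic_compl cr1 _.
have s2 : homotopic (tom T) (tom T') (epush r1 \o epush q \o (Q \o E1))
    (epush r2 \o epush th \o (Q \o E1)).
  apply: homotopic_compr cQE _.
  apply: (@eq_homotopic _ _ _ _ (epush (r1 \o q)) _ (epush (r2 \o th))).
  - by move=> c; rewrite /= epush_comp.
  - by move=> c; rewrite /= epush_comp.
  - by apply: follows_homotopic; exact: follows_comp.
have s3 : homotopic (tom T) (tom L2) (epush th \o (Q \o E1)) E2.
  apply: (@homotopic_trans _ _ _ _ ((E2 \o epush p2) \o (epush th \o (Q \o E1)))).
    apply: homotopic_sym.
    apply: (@eq_homotopic _ _ _ _ ((E2 \o epush p2) \o (epush th \o (Q \o E1))) _
      (id \o (epush th \o (Q \o E1)))) => //.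
    by apply: homotopic_compr h2'; exact: cmap_comp cQE cth.
  apply: (@homotopic_trans _ _ _ _ (E2 \o ((epush p1 \o epush q) \o (Q \o E1)))).
    apply: (@eq_homotopic _ _ _ _ (E2 \o ((epush p2 \o epush th) \o (Q \o E1))) _
      (E2 \o ((epush p1 \o epush q) \o (Q \o E1)))) => //.
    apply: homotopic_compl cE2 _; apply: homotopic_compr cQE _.
    apply: (@eq_homotopic _ _ _ _ (epush (p2 \o th)) _ (epush (p1 \o q))).
    - by move=> c; rewrite /= epush_comp.
    - by move=> c; rewrite /= epush_comp.
    - by apply: follows_homotopic; exact: follows_comp.
  apply: (@eq_homotopic _ _ _ _ (E2 \o ((epush p1 \o epush q) \o (Q \o E1))) _ (E2 \o id)) => //.
  apply: homotopic_compl cE2 _.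
  apply: homotopic_trans h1.
  apply: (@eq_homotopic _ _ _ _ ((epush p1 \o (epush q \o Q)) \o E1) _ ((epush p1 \o id) \o E1)) => //.
  by apply: homotopic_compr cE1 _; apply: homotopic_compl cp1 _.
apply: homotopic_trans s1 _; apply: homotopic_trans s2 _.
apply: (@eq_homotopic _ _ _ _ (epush r2 \o (epush th \o (Q \o E1))) _ (epush r2 \o E2)) => //.
exact: homotopic_compl cr2 s3.
Qed.

(** Write [G] as a push forward from a tight refinement [L'] of [T']. The condition [tdom_all]
    passes the weight bound from [T'] to [T], so [T] can be approximated directly into [L']. By
    uniqueness [F] may be replaced by this map followed by [p'], and then [E'] cancels [p']. *)
Lemma approx_comp T T' T'' (F : tchain T -> tchain T') (G : tchain T' -> tchain T'') :
  tdom_all T T' -> is_approx F -> is_approx G ->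
  exists2 H : tchain T -> tchain T'', is_approx H & homotopic (tom T) (tom T'') (G \o F) H.
Proof.
move=> d aF aG; have cG := approx_cmap aG.
case: (aG) => [L' [E' [p' [r' [[fp' cE' h1' h2'] t' fr' e']]]]].
have dL' : tdom T L'.
  apply: tdom_allW => x w wx; apply: dvdq_trans (proj2 t' _ _ wx) _.
  by apply: tmx_dvd => v'; exact: d.
have [N [Q [q [psi [rQ tN fpsi]]]]] := exists_tight dL'.
have [fq cQ k1 k2] := rQ.
exists (epush r' \o epush psi \o Q).
  exists N, Q, q, (r' \o psi); split=> //; first exact: follows_comp.
  by move=> c; rewrite /= epush_comp.
have aP : is_approx (epush p' \o (epush psi \o Q)).
  by apply: approx_follows => //; exists N, Q, q, psi.
apply: (@homotopic_trans _ _ _ _ (G \o (epush p' \o (epush psi \o Q)))).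
  by apply: homotopic_compl cG _; exact: approx_unique.
have cpsi := follows_cmap fpsi; have cr' := follows_cmap fr'.
apply: (@eq_homotopic _ _ _ _ (epush r' \o ((E' \o epush p') \o (epush psi \o Q))) _
  (epush r' \o (id \o (epush psi \o Q)))) => //.
  by move=> c; rewrite /= e'.
apply: homotopic_compl cr' _; apply: homotopic_compr h2'; exact: cmap_comp cQ cpsi.
Qed.

Lemma approx_inverse T T' (F : tchain T -> tchain T') (G : tchain T' -> tchain T) :
  tdom_all T T' -> is_approx F -> is_approx G -> homotopic (tom T) (tom T) (G \o F) id.
Proof.
move=> d aF aG; have [H aH h] := approx_comp d aF aG.
by apply: homotopic_trans h _; apply: approx_unique => //; exact: approx_id.
Qed.

Definition hinj T T' (F : tchain T -> tchain T') : Prop := forall n z, (0 < n)%N ->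
  Zc (tom T) n z -> Bc (tom T') n (F z) -> Bc (tom T) n z.
Definition hsurj T T' (F : tchain T -> tchain T') : Prop := forall n z', (0 < n)%N ->
  Zc (tom T') n z' -> exists2 z, Zc (tom T) n z & Bc (tom T') n (F z - z').

Lemma homotopic_id_hinj T T' (F : tchain T -> tchain T') (G : tchain T' -> tchain T) :
  cmap (tom T') (tom T) G -> homotopic (tom T) (tom T) (G \o F) id -> hinj F.
Proof.
move=> cG h n z n0 Zz BFz; have := BcB (cmap_Bc cG BFz) (h n z n0 Zz).
by rewrite /= subKr.
Qed.

Lemma approx_bijective T T' (F : tchain T -> tchain T') :
  tdom_all T T' -> tdom_all T' T -> is_approx F -> hinj F /\ hsurj F.
Proof.
move=> d d' aF; have [G aG] := exists_tapprox (tdom_allW d').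
have cG := approx_cmap aG; split.
  by apply: homotopic_id_hinj cG _; exact: approx_inverse.
move=> n z' n0 Zz'; exists (G z'); first exact: cmap_Zc Zz'.
exact: (approx_inverse d' aG aF).
Qed.

(** In the hatted case the vertex weights are inverted, so the smallest one on a carrier is the
    inverse of the largest original weight, which is determined by the weight function on the
    space. *)
Definition tcompat T T' : Prop := forall x,
  mn (@twt T) (tcar T x) = mn (@twt T') (tcar T' x).

Lemma tcompat_sym T T' : tcompat T T' -> tcompat T' T.
Proof. by move=> h x; rewrite h. Qed.

Lemma tmn_mem T x : exists2 v, v \in tcar T x & mn (@twt T) (tcar T x) = twt v.
Proof.
have [_ _ a0 _] := @twtP T; apply: mn_mem => //; exact/simps_neq0/tcar_simps.
Qed.

Lemma tmn_dvd T x v : v \in tcar T x -> dvdq (mn (@twt T) (tcar T x)) (twt v).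
Proof.
have [_ _ a0 ch] := @twtP T => vx; apply: mn_dvdq => //; exact/ch/tcar_simps.
Qed.

Lemma tcompat_dom T T' : tcompat T T' -> tdom T T'.
Proof.
move=> h x; have [v' v'x e] := tmn_mem T' x; exists v' => //.
have [v vx ev] := tmn_mem T x.
by rewrite -e -h ev; exact: tcar_dvd.
Qed.

Lemma tcompat_sdII T m : tcompat T (sdII T m).
Proof.
move=> x; have [v vx ev] := tmn_mem T x; have [w wx ew] := tmn_mem (sdII T m) x.
have [_ _ a0 ch] := @twtP T; have [_ _ b0 _] := @twtP (sdII T m).
have d1 : dvdq (mn (@twt T) (tcar T x)) (mn (@twt (sdII T m)) (tcar (sdII T m) x)).
  rewrite ew /= wIIE//; apply: dvdq_mn => //; first exact/simps_neq0/vcar_simps.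
  move=> u uw; apply: tmn_dvd; rewrite (tcar_sdn T m).
  by apply/bigcupP; exists w.
have d2 : dvdq (mn (@twt (sdII T m)) (tcar (sdII T m) x)) (mn (@twt T) (tcar T x)).
  rewrite ev; move: (vx); rewrite (tcar_sdn T m) => /bigcupP[u ux vu].
  apply: dvdq_trans (@tmn_dvd (sdII T m) x u ux) _; rewrite /= wIIE//.
  by apply: mn_dvdq => //; exact/ch/vcar_simps.
have p1 : 0 < mn (@twt T) (tcar T x) by rewrite ev.
have p2 : 0 < mn (@twt (sdII T m)) (tcar (sdII T m) x) by rewrite ew.
by apply/le_anti; rewrite !dvdq_le.
Qed.

Lemma tcompat_trans T T' T'' : tcompat T T' -> tcompat T' T'' -> tcompat T T''.
Proof. by move=> h h' x; rewrite h. Qed.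

(* The refinement T2 of T' is so fine that every weight of a vertex of the
   carrier of x in T2 divides one of the carrier of x in T. *)
Lemma compat_left_inverse T T' (F : tchain T -> tchain T') : tcompat T T' -> is_approx F ->
  exists T2 (E : tchain T' -> tchain T2) p (G : tchain T2 -> tchain T),
  [/\ refines E p, tcompat T2 T, is_approx G & homotopic (tom T) (tom T) (G \o (E \o F)) id].
Proof.
move=> hc aF; have dom : dominates (@tco T) (@tco T') (@twt T) (@twt T').
  by move=> x; have [v' v'x dv] := tcompat_dom hc x; exists v' => //; rewrite inE in v'x.
have [r hr] := exists_refinement cX (@tcoP T) (@tcoP T') (@twtP T) (@twtP T') dom.
have [p rp] := refines_sdII T' r; have [fp cE h1 h2] := rp.
set T2 := sdII T' r in p rp fp cE h1 h2.
have dall : tdom_all T T2 by move=> x w; rewrite inE; exact: hr.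
have c2 : tcompat T2 T.
  by apply: tcompat_sym; apply: tcompat_trans hc _; exact: tcompat_sdII.
have [F2 aF2] := exists_tapprox (tdom_allW dall).
have [G aG] := exists_tapprox (tcompat_dom c2).
exists T2, (@esdn (tcx T') r), p, G; split=> //.
have cG := approx_cmap aG; have cF2 := approx_cmap aF2.
apply: homotopic_trans (approx_inverse dall aF2 aG).
apply: homotopic_compl cG _.
(* Projecting [F2] from [T2] back to [T'] gives another approximation, homotopic to [F] by
   uniqueness; then the subdivision cancels the projection [p]. *)
apply: (@homotopic_trans _ _ _ _ (@esdn (tcx T') r \o (epush p \o F2))).
  apply: homotopic_compl cE _; apply: approx_unique aF _; exact: approx_follows.
apply: (@eq_homotopic _ _ _ _ ((@esdn (tcx T') r \o epush p) \o F2) _ (id \o F2)) => //.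
exact: homotopic_compr cF2 h2.
Qed.

Lemma compat_bijective T T' (F : tchain T -> tchain T') :
  tcompat T T' -> is_approx F -> hinj F /\ hsurj F.
Proof.
move=> hc aF; have cF := approx_cmap aF.
have [T2 [E [p [G [[fp cE h1 h2] c2 aG h]]]]] := compat_left_inverse hc aF.
have cG := approx_cmap aG; have cGE := cmap_comp cE cG; have cp := follows_cmap fp.
have iG : hinj G.
  have [T3 [E' [p' [G' [[_ cE' _ _] _ aG' h']]]]] := compat_left_inverse c2 aG.
  exact: (@homotopic_id_hinj _ _ G (G' \o E') (cmap_comp cE' (approx_cmap aG')) h').
split; first exact: (@homotopic_id_hinj _ _ F (G \o E) cGE h).
move=> n z' n0 Zz'; exists (G (E z')); first exact: (cmap_Zc cGE Zz').
set y := G (E z'); have Zy : Zc (tom T) n y by exact: (cmap_Zc cGE Zz').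
(* By the left inverse property, [G] sends [E (F y)] and [E z'] to homologous cycles. Injectivity of
   [G] makes [E (F y - z')] a boundary, and [p] brings this back to [T']. *)
have lin : E (F y - z') = E (F y) - E z' by apply: linearB_of; case: cE.
have BE : Bc (tom T2) n (E (F y - z')).
  apply: iG => //.
    rewrite lin; apply: ZcB; first exact/(cmap_Zc cE)/(cmap_Zc cF).
    exact: (cmap_Zc cE).
  rewrite lin linearB_of; last by case: cG.
  exact: h Zy.
have Zd : Zc (tom T') n (F y - z') by apply: ZcB => //; exact: cmap_Zc Zy.
have B1 := cmap_Bc cp BE; have B2 := h1 n _ n0 Zd.
by have := BcB B1 B2; rewrite /= subKr.
Qed.


End WeightedTriangulations.

Lemma homeo_comp (S T U : topologicalType) (p : S -> T) (q : T -> U) :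
  homeomorphism p -> homeomorphism q -> homeomorphism (q \o p).
Proof.
move=> [p' [pK p'K cp cp']] [q' [qK q'K cq cq']]; exists (p' \o q'); split.
- exact: can_comp.
- exact: can_comp.
- by move=> x; apply: continuous_comp; [exact: cp|exact: cq].
- by move=> x; apply: continuous_comp; [exact: cq'|exact: cp'].
Qed.

(** * The two induced homomorphisms *)

Section Main.
Variables (R : realType) (t : wtype) (X X' : topologicalType).
Variables (lam : X -> nat) (lam' : X' -> nat) (f : X -> X').
Hypotheses (hf : homeomorphism f) (hfw : forall x, lam' (f x) = lam x).
Variables (K K' : complex) (xi : weight K) (xi' : weight K').
Variables (g : X -> realization R K) (g' : X' -> realization R K').
Hypotheses (hK : triangulation t xi lam g) (hxi : is_divisible t xi).
Hypotheses (hK' : triangulation t xi' lam' g') (hxi' : is_divisible t xi').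

Let vw := divisible_vertex_weighted hxi.
Let vw' := divisible_vertex_weighted hxi'.

Let hg : homeomorphism g. Proof. by case: hK. Qed.
Let hg' : homeomorphism (g' \o f). Proof. by case: hK' => _ h _; exact: homeo_comp. Qed.
Let cX : compact [set: X]%classic := homeo_compact hg.

Let T : wtri R X := WTri (homeo_coordinates hg) (proj1 vw).
Let T' : wtri R X := WTri (homeo_coordinates hg') (proj1 vw').
Let U : wtri R X := WTri (homeo_coordinates hg) (proj1 (vw_inversion vw)).
Let U' : wtri R X := WTri (homeo_coordinates hg') (proj1 (vw_inversion vw')).

Let carK x : carrier (set_val (g x)) \in simps K := tcar_simps T x.
Let carK' x : carrier (set_val (g' (f x))) \in simps K' := tcar_simps T' x.

Lemma tmx_lam x : tmx T x = wtq t (lam x).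
Proof.
rewrite /tmx /= -(vw_mx vw); last exact: (carK x).
by case: hK => _ _ ->.
Qed.

Lemma tmx_lam' x : tmx T' x = wtq t (lam x).
Proof.
rewrite /tmx /= -(vw_mx vw'); last exact: (carK' x).
by rewrite -hfw; case: hK' => _ _ ->.
Qed.

Lemma main_dom : tdom_all T T'.
Proof. by move=> x v' v'x; rewrite tmx_lam -tmx_lam'; exact: tcar_dvd. Qed.

Lemma main_dom' : tdom_all T' T.
Proof. by move=> x v vx; rewrite tmx_lam' -tmx_lam; exact: tcar_dvd. Qed.

Lemma main_compat : tcompat U U'.
Proof.
move=> x; have e (V : finType) (a : V -> rat) S : mn (fun v => (a v)^-1) S = (mx a S)^-1.
  by rewrite /mn; congr (mx _ _)^-1; apply/funext => v; rewrite invrK.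
by rewrite !e; congr _^-1; have := tmx_lam x; rewrite -tmx_lam'.
Qed.

(** A point lies in the open star of [w] exactly when [w] is in its carrier. The weight conditions
    agree because the weight of a simplex is the largest of its vertex weights. *)
Lemma W_approx_follows m (rho : vert (Sdn K m) -> vert K') :
  W_simplicial_approx t xi xi' g g' f m rho <-> @follows R X (sdI T m) T' rho.
Proof.
have vwm := vw_sdwn vw m.
have [hp _ _ _] := homeo_coordinates hg.
split=> [[[sr dr] [_ st]]|[c d]].
  split=> [x w|w].
    rewrite !inE => xw.
    have /(st w)[y [yr yc] ye] : (f @` open_star_in g w)%classic (f x).
      exists x => //; exists (sdn_inv (set_val (g x)) (m := m)); last exact: sdn_invK.
      split; last by rewrite inE.
      by have [p1 p2 p3] := sdn_inv_pt m (hp x).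
    have {}ye : y = set_val (g' (f x)) := ye.
    by move: yc; rewrite inE ye.
  have wK : [set w] \in simps (Sdn K m) by exact: simps_vert.
  have h := dr _ wK; rewrite imset_set1 in h.
  rewrite /= -[wI _ _](vw_vertex vwm); apply/dvdq_wtq; last by case: (t) h.
    by rewrite (vw_gt0 vw')// simps_vert.
  by rewrite (vw_gt0 vwm).
have sr : simplicial rho.
  move=> S SK; rewrite -[rho @: S]finset.setUid.
  by apply: (@follows_contiguous R X (sdI T m) T') => //; split.
split; split=> //.
  move=> S SK; have r0 := vw_gt0 vw' (sr _ SK); have S0 := vw_gt0 vwm SK.
  suff : dvdq (wtq t (xi' (rho @: S))) (wtq t (sdwn xi m S)).
    by move=> /(dvdq_wtq _ r0 S0); case: (t).
  rewrite (vw_mx vw') ?sr// (vw_mx vwm)//.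
  case: (vw') => -[_ _ a0 _] _; apply: mx_dvdq => //; first exact/simps_neq0/sr.
  move=> _ /imsetP[v vS ->]; apply: dvdq_trans (d v) _.
  by case: vwm => -[_ _ b0 ch] _; apply: dvdq_mx => //; exact: ch.
move=> w _ [x [y [yr yw] ye] <-]; exists (set_val (g' (f x))) => //.
split; first exact: set_valP.
have yp : is_pt y by have [p1 p2 p3] := yr.
apply: (c x w); rewrite inE /= -ye sdn_coordK//.
by move: yw; rewrite inE.
Qed.

Lemma main_exists : exists m rho, W_simplicial_approx t xi xi' g g' f m rho.
Proof.
have [hp' _ _ _] := homeo_coordinates hg'.
have dom : dominates (@tco _ _ T) (@tco _ _ T') (@twt _ _ T) (@twt _ _ T').
  move=> x; have [v' v'x dv] := tdom_allW main_dom x; exists v' => //.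
  by rewrite inE in v'x.
have [m [rho [r1 r2]]] := exists_approx cX (@tcoP _ _ T) (@tcoP _ _ T') (@twtP _ _ T) dom.
exists m, rho; apply/W_approx_follows; split=> // x w; rewrite !inE; exact: r1.
Qed.

Lemma main_iso m (rho : vert (Sdn K m) -> vert K') :
  W_simplicial_approx t xi xi' g g' f m rho ->
  forall n, hom_iso (induced_hom t xi xi' m rho n).
Proof.
move=> hW; have fr := proj1 (W_approx_follows rho) hW.
have [p rp] := refines_sdI T m.
have [_ cE _ _] := rp.
have aF : @is_approx R X T T' (epush rho \o @esdn K m).
  by exists (sdI T m), (@esdn K m), p, rho; split=> //; exact: tight_sdI.
have [inj surj] := approx_bijective cX main_dom main_dom' aF.
have vwm := vw_sdwn vw m; have [[sr dr] _] := hW.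
apply: (hom_iso_hmap_comp vw vwm vw' (F1 := @esdn K m) (F2 := epush rho)) => //.
- exact: (emb_sdn vw m).
- move=> c; apply: (emb_push _ vwm vw' sr) => S SK.
  apply/(dvdq_wtq t (vw_gt0 vw' (sr _ SK)) (vw_gt0 vwm SK)).
  by have := dr _ SK; case: (t).
- exact: follows_cmap fr.
Qed.

(** The hatted subdivision takes values in [sdII U m], which need not be tight over [U]. Because
    [rho] preserves weights, it also follows from [sdI U m], and the operator [epush rho \o esdn m]
    is the same; so [compat_bijective] applies to it. *)
Lemma main_hat_iso m (rho : vert (Sdn K m) -> vert K') :
  W_simplicial_approx t xi xi' g g' f m rho ->
  weight_preserving (sdwn xi m) xi' rho ->
  forall n, hom_iso (hat_induced_hom t xi xi' m rho n).
Proof.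
move=> hW wp; have [frc frd] := proj1 (W_approx_follows rho) hW.
have vwm := vw_sdwn vw m; have [[sr dr] _] := hW.
have rhoE w : vwt t xi' (rho w) = wI (vwt t xi) w.
  rewrite -(vw_vertex vw') -(vw_vertex vwm) -wp ?imset_set1//; exact: simps_vert.
have iw w : (wI (vwt t xi) w)^-1 = wII (fun v => (vwt t xi v)^-1) (m := m) w.
  by rewrite /wII; congr (wI _ w)^-1; apply/funext => v; rewrite invrK.
have [_ _ u0 uch] := proj1 (vw_inversion vw).
(* The weight of [rho w] is the smallest inverted weight on the carrier of [w], which divides the
   largest. *)
have fI : @follows R X (sdI U m) U' rho.
  split=> [x w|w]; first exact: frc.
  rewrite /= rhoE iw wIIE// wIE//.
  have wK := vcar_simps w; have [v vw0 ->] := mn_mem u0 (simps_neq0 wK).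
  by apply: dvdq_mx => //; exact: uch.
have fII : @follows R X (sdII U m) U' rho.
  split=> [x w|w]; first exact: frc.
  by rewrite /= rhoE iw; exact: dvdq_refl.
have [p rp] := refines_sdI U m.
have [p2 [_ cE2 _ _]] := refines_sdII U m.
have aF : @is_approx R X U U' (epush rho \o @esdn K m).
  by exists (sdI U m), (@esdn K m), p, rho; split=> //; exact: tight_sdI.
have [inj surj] := compat_bijective cX main_compat aF.
have eI : (fun w => (wI (vwt t xi) w)^-1) = wII (fun v => (vwt t xi v)^-1) (m := m).
  exact/funext.
have vih := vw_inversion vwm; rewrite eI in vih.
apply: (hom_iso_hmap_comp (vw_inversion vw) vih (vw_inversion vw')
  (F1 := @esdn K m) (F2 := epush rho)) => //.
- exact: (emb_hsdn vw m).
- move=> c; apply: (emb_push _ vih (vw_inversion vw') sr) => S SK.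
  rewrite (vw_mx (vw_inversion vw')) ?sr// (vw_mx vih)//.
  apply: mx_dvdq; [|exact/simps_neq0/sr|].
    by case: (proj1 (vw_inversion vw')).
  move=> _ /imsetP[v vS ->]; rewrite rhoE iw.
  by case: (proj1 vih) => _ _ b0 ch; apply: dvdq_mx => //; exact: ch.
- exact: follows_cmap fII.
Qed.

End Main.

Theorem theorem6p15
  (R : realType) (t : wtype)
  (X X' : topologicalType) (lam : X -> nat) (lam' : X' -> nat)
  (hX : weighted_polyhedron R t lam) (hX' : weighted_polyhedron R t lam')
  (f : X -> X') (hf : homeomorphism f) (hfw : forall x, lam' (f x) = lam x)
  (K K' : complex) (xi : weight K) (xi' : weight K')
  (g : X -> realization R K) (g' : X' -> realization R K')
  (hK : triangulation t xi lam g) (hxi : is_divisible t xi)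
  (hK' : triangulation t xi' lam' g') (hxi' : is_divisible t xi') :
  [/\ (* f_* is defined *)
      exists (m : nat) (rho : vert (Sdn K m) -> vert K'),
        W_simplicial_approx t xi xi' g g' f m rho,
      (* f_* is an isomorphism *)
      forall (m : nat) (rho : vert (Sdn K m) -> vert K'),
        W_simplicial_approx t xi xi' g g' f m rho ->
        forall n : nat, hom_iso (induced_hom t xi xi' m rho n)
    & (* the hatted f_* is an isomorphism *)
      forall (m : nat) (rho : vert (Sdn K m) -> vert K'),
        W_simplicial_approx t xi xi' g g' f m rho ->
        weight_preserving (sdwn xi m) xi' rho ->
        forall n : nat, hom_iso (hat_induced_hom t xi xi' m rho n)].
Proof.
split.
- exact: (main_exists hf hfw hK hxi hK' hxi').
- exact: (main_iso hf hfw hK hxi hK' hxi').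
- exact: (main_hat_iso hf hfw hK hxi hK' hxi').
Qed.
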